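(* Let $d\ge1$ be an integer, let $s\in\{1,\ldots,d\}$, and let $n\ge2$ be an integer power of $2$. Let $A_T\subseteq[0,1]^d$ be any one of the $n$ point sets (each of size $n$) output by the superposition-modified subgaussian transference algorithm with parameter $s$ (defined in the context). Then for every function $f:[0,1]^d\to\mathbb{R}$ that has a Fourier decomposition $f(\boldsymbol{x})=\sum_{\boldsymbol{k}\in\mathbb{Z}^d}\widehat f(\boldsymbol{k})\exp(2\pi i\langle\boldsymbol{k},\boldsymbol{x}\rangle)$, the integration error satisfies $$\mathbb{E}\big[(\mathsf{err}(A_T,f))^2\big]\le O_s(1)\cdot\inf_{f=g+h,\ h\in\mathcal{F}_s}\left(\frac{\log n}{n}\,\sigma(g)^2+\frac{d^s(\log(dn))^{s+1}}{n^2}\,\sigma_{\mathsf{SO}}(h)^2\right),$$ where the infimum is over all decompositions of $f$ as the sum of two functions $g,h:[0,1]^d\to\mathbb{R}$ with $g\in L^2([0,1]^d)$ and $h\in\mathcal{F}_s$, where $$\mathcal{F}_s=\Big\{\sum_{u\subseteq\{1,\ldots,d\},\,|u|\le s}f_u(\boldsymbol{x}^u):\ f_u\in L^2([0,1]^d)\Big\}$$ is the class of functions involving interactions of order at most $s$ (each $f_u$ depends only on the coordinates $\boldsymbol{x}^u=(x_j)_{j\in u}$), and $$\sigma_{\mathsf{SO}}(h)^2:=\sum_{\boldsymbol{k}\in\mathbb{Z}^d\setminus\{\boldsymbol0\}}\big|\widehat h(\boldsymbol{k})\big|^2\Big(\sum_{\emptyset\ne u\subseteq\{1,\ldots,d\}}\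 \prod_{j\in u}|k_j|\Big).$$ Here the expectation is over all randomness of the algorithm, and $O_s(1)$ denotes a constant depending only on $s$.
   Context: Integration error and variance. For a finite set $A\subseteq[0,1]^d$, $\mathsf{err}(A,f):=\frac1{|A|}\sum_{\boldsymbol{x}\in A}f(\boldsymbol{x})-\int_{[0,1]^d}f(\boldsymbol{x})\,d\boldsymbol{x}$. For $g\in L^2([0,1]^d)$, $\sigma(g)^2:=\int g^2-(\int g)^2$ (integrals over $[0,1]^d$). $\widehat h(\boldsymbol{k})$ denotes the $\boldsymbol{k}$-th Fourier coefficient of $h$. Dyadic boxes. For $j\in\{0,1,2,\ldots\}$, $\mathcal{D}_j:=\{(\ell/2^j,(\ell+1)/2^j]:\ell=0,\ldots,2^j-1\}$; $\mathcal{D}_{\le L}:=\bigcup_{j\le L}\mathcal{D}_j$; $\mathcal{D}_{\le L}^{\otimes d}:=\{I_1\times\cdots\times I_d: I_j\in\mathcal{D}_{\le L}\text{ for all }j\}$. A box $B=B_1\times\cdots\times B_d$ is trivial in dimension $j$ if $B_j=(0,1]$. $\widetilde{\mathcal{D}}_{\le L}^{\otimes s}$ denotes the set of boxes in $\mathcal{D}_{\le L}^{\otimes d}$ that are non-trivial in at most $s$ dimensions. Self-Balancing Walk. Input: vectors $\boldsymbol{v}_1,\ldots,\boldsymbol{v}_N\in\mathbb{R}^m$ of Euclidean norm at most $1$ and a failure parameter $\delta$. Set $\boldsymbol{w}_0=\boldsymbol 0$, $\lambda=30\log(mN/\delta)$. For $j=1,\ldots,N$: if $|\langle\boldsymbol{w}_{j-1},\boldsymbol{v}_j\rangle|>\lambda$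 or $\|\boldsymbol{w}_{j-1}\|_\infty>\lambda$, fail; otherwise set $p_j=\frac12-\frac{\langle\boldsymbol{w}_{j-1},\boldsymbol{v}_j\rangle}{2\lambda}$, let $c_j=1$ with probability $p_j$ and $c_j=-1$ with probability $1-p_j$ (fresh randomness), and set $\boldsymbol{w}_j=\boldsymbol{w}_{j-1}+c_j\boldsymbol{v}_j$. Output $(c_1,\ldots,c_N)\in\{\pm1\}^N$. Convention: $\delta\in(0,1/2]$ with $\log(1/\delta)=O(\log(mN))$, and a failed run is repeated with fresh randomness until it succeeds. $\mathsf{BalSubgDisc}$. Input: vectors $\boldsymbol{v}_1,\ldots,\boldsymbol{v}_N$ with $N$ even. Apply Self-Balancing Walk to $\boldsymbol{v}_1-\boldsymbol{v}_2,\boldsymbol{v}_3-\boldsymbol{v}_4,\ldots,\boldsymbol{v}_{N-1}-\boldsymbol{v}_N$, all divided by the common factor $2\max_j\|\boldsymbol{v}_j\|_2$ so that their norms are at most $1$, to get signs $x_1,\ldots,x_{N/2}$; output the balanced coloring $c_{2i-1}=x_i$, $c_{2i}=-x_i$. Superposition-modified algorithm with parameter $s$. Let $L=O(\log(dn))$ be the level parameter, i.e. $L=\lceil C\log(dn)\rceil$ with $C$ a sufficiently large absolute constant. Sample a shift $\boldsymbol{\tau}$ uniformly from $[0,1)^d$ and shift the dyadic system by $\boldsymbol{\tau}$, coordinatewise modulo $1$; below, ''$\boldsymbol{z}\in B$'' refers to the shifted box $B+\boldsymbol{\tau}$ mod $1$. Let $T=\log_2 n$, and let $A_0^{(0)}$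 consist of $n^2$ independent uniform samples from $[0,1]^d$. For $t=0,\ldots,T-1$ and $i=0,\ldots,2^t-1$: put $A_t=A_t^{(i)}$; list its points as $\boldsymbol{z}_1,\ldots,\boldsymbol{z}_{|A_t|}$; to each $\boldsymbol{z}_j$ associate the vector $\boldsymbol{v}_j=\big(\boldsymbol{e}_j,(\mathbf{1}_{\{\boldsymbol{z}_j\in B\}})_{B\in\widetilde{\mathcal{D}}_{\le L}^{\otimes s}}\big)$, where $\boldsymbol{e}_j\in\{0,1\}^{|A_t|}$ is the $j$-th standard basis vector; let $\boldsymbol{c}_t\in\{\pm1\}^{|A_t|}$ be the output of $\mathsf{BalSubgDisc}$ on $(\boldsymbol{v}_j)_j$; set $A_{t+1}^{(2i)}=\{\boldsymbol{z}_j\in A_t:c_{t,j}=-1\}$ and $A_{t+1}^{(2i+1)}=\{\boldsymbol{z}_j\in A_t:c_{t,j}=+1\}$. Output the $2^T=n$ sets $A_T^{(i)}$, $0\le i<n$, each of size $n$; $A_T$ denotes any one of them (fixed index $i$). *)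

(* Defs.v *)
From HB Require Import structures.
From mathcomp Require Import all_boot all_order all_algebra.
From mathcomp Require Import all_classical all_reals all_analysis.
From mathcomp.real_closed Require Import complex.

Set Implicit Arguments.
Unset Strict Implicit.
Unset Printing Implicit Defensive.
Import Order.TTheory GRing.Theory Num.Theory.
Import numFieldNormedType.Exports.

Local Open Scope classical_set_scope.
Local Open Scope ring_scope.

Section TuplePower.
Context {disp : measure_display} {T : measurableType disp} {R : realType}.

Definition tcons (n : nat) (x : T * n.-tuple T) : n.+1.-tuple T :=
  [tuple of x.1 :: x.2].

Lemma measurable_tcons (n : nat) : measurable_fun setT (@tcons n).
Proof. exact: measurable_cons. Qed.

HB.instance Definition _ (n : nat) :=
  @isMeasurableFun.Build _ _ _ _ (@tcons n) (@measurable_tcons n).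

(* The product measure P \x ... \x P (n factors), carried by n.-tuple T. *)
Fixpoint tuple_prob (P : probability T R) (n : nat) :
    probability (n.-tuple T) R :=
  match n with
  | 0 => \d_([tuple])
  | m.+1 => distribution (P \x tuple_prob P m)%E (@tcons m)
  end.

End TuplePower.

(* Finitely supported distributions, as lists of (weight, value) pairs in
   which a value may be listed several times. *)
Section FiniteDistributions.
Context {R : realType}.

Definition fdist (T : Type) : Type := seq (R * T).

Definition ret (T : Type) (x : T) : fdist T := [:: (1, x)].

Definition bind (T U : Type) (m : fdist T) (k : T -> fdist U) : fdist U :=
  flatten [seq [seq (wx.1 * vy.1, vy.2) | vy <- k wx.2] | wx <- m].

Definition coin (p : R) : fdist bool := [:: (p, true); (1 - p, false)].

Definition expect (T : Type) (m : fdist T) (F : T -> R) : R :=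
  \sum_(wx <- m) wx.1 * F wx.2.

Definition failure_prob (T : Type) (m : fdist (option T)) : R :=
  expect m (fun o => (~~ isSome o)%:R).

(* Independent runs of m until one returns Some x.  The outcome x is obtained
   after exactly r failed runs with probability q ^+ r * m (Some x), where q is
   the failure probability; sum over r. *)
Definition retry (T : Type) (m : fdist (option T)) : fdist T :=
  pmap (fun wo : R * option T =>
          omap (pair (limn (series (fun r => failure_prob m ^+ r)) * wo.1)) wo.2)
       m.

End FiniteDistributions.
Arguments fdist : clear implicits.

(* Vectors of R^m are functions on an index set I with m elements; signs are
   booleans, true standing for +1 and false for -1. *)
Section SelfBalancingWalk.
Context {R : realType} {I : finType}.
Implicit Types (u v w : {ffun I -> R}) (vs : seq {ffun I -> R}).

Definition sgn (b : bool) : R := if b then 1 else -1.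

Definition dotv u v : R := \sum_i u i * v i.

Definition norm2 v : R := Num.sqrt (dotv v v).

Fixpoint walk (lambda : R) w vs : fdist R (option (seq bool)) :=
  match vs with
  | [::] => ret (Some [::])
  | v :: vs' =>
    if (lambda < `|dotv w v|) || [exists i, lambda < `|w i|] then ret None
    else bind (coin (2^-1 - dotv w v / (2 * lambda))) (fun c =>
         bind (walk lambda [ffun i => w i + sgn c * v i] vs') (fun o =>
         ret (omap (cons c) o)))
  end.

(* The failure parameter delta may depend on the dimension and on the number
   of vectors. *)
Definition self_balancing_walk (delta : nat -> nat -> R) vs :
    fdist R (seq bool) :=
  let lambda := 30 * ln ((#|I| * size vs)%:R / delta #|I| (size vs)) in
  retry (walk lambda [ffun=> 0] vs).

Fixpoint pair_differences vs : seq {ffun I -> R} :=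
  match vs with
  | u :: v :: vs' => [ffun i => u i - v i] :: pair_differences vs'
  | _ => [::]
  end.

Definition bal_subg_disc (delta : nat -> nat -> R) vs : fdist R (seq bool) :=
  let scale := 2 * \big[Num.max/0]_(v <- vs) norm2 v in
  bind (self_balancing_walk delta
          [seq [ffun i => v i / scale] | v : {ffun I -> R} <- pair_differences vs])
       (fun x => ret (flatten [seq [:: b; ~~ b] | b <- x])).

End SelfBalancingWalk.

(* The pair (j, l) with l < 2 ^ j encodes the interval (l/2^j, (l+1)/2^j]; it
   is (0, 1] exactly when j = 0. *)
Definition dyadic (L : nat) := {j : 'I_L.+1 & 'I_(2 ^ j)}.

Definition trivial_dyadic (L : nat) (I : dyadic L) : bool := tag I == ord0.

Definition dyadic_set (R : realType) (L : nat) (I : dyadic L) : set R :=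
  `](tagged I)%:R / 2 ^+ (tag I), (tagged I).+1%:R / 2 ^+ (tag I)].

Definition dyadic_box (d L s : nat) :=
  {B : {ffun 'I_d -> dyadic L} |
    (#|[set j | ~~ trivial_dyadic (B j)]%SET| <= s)%N}.

Section Algorithm.
Context {R : realType} (d : nat).

Definition pt : Type := d.-tuple (measurableTypeR R).

Definition coordinate (x : pt) (j : 'I_d) : R := tnth x j.

Definition in_shifted_box (L s : nat) (tau : pt) (B : dyadic_box d L s)
    (z : pt) : bool :=
  [forall j, `[< exists2 y : R, dyadic_set (val B j) y &
                 exists k : int, coordinate z j = y + coordinate tau j + k%:~R >]].

Section Halving.
Variables (L s : nat) (delta : nat -> nat -> R) (tau : pt).

(* Point sets are duplicate-tolerant lists; coinciding sample points occur with
   probability 0. *)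
Definition incidence_vectors (A : seq pt) :
    seq {ffun 'I_(size A) + dyadic_box d L s -> R} :=
  [seq [ffun i => match i with
                  | inl l => (l == j)%:R
                  | inr B => (in_shifted_box tau B (tnth (in_tuple A) j))%:R
                  end]
  | j <- enum 'I_(size A)].

Definition split_points (A : seq pt) : fdist R (seq pt * seq pt) :=
  bind (bal_subg_disc delta (incidence_vectors A)) (fun c =>
  ret (mask [seq ~~ b | b <- c] A, mask c A)).

(* Entries 2 i and 2 i + 1 of the new family are the two halves of entry i,
   which are split independently of each other. *)
Fixpoint split_all (As : seq (seq pt)) : fdist R (seq (seq pt)) :=
  match As with
  | [::] => ret [::]
  | A :: As' => bind (split_points A) (fun B =>
                bind (split_all As') (fun Bs =>
                ret (B.1 :: B.2 :: Bs)))
  end.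

Fixpoint levels (t : nat) (A0 : seq pt) : fdist R (seq (seq pt)) :=
  match t with
  | 0 => ret [:: A0]
  | t'.+1 => bind (levels t' A0) split_all
  end.

End Halving.

Definition level_bound (C : R) (n : nat) : nat :=
  `|Num.ceil (C * ln (d * n)%:R)|%N.

Definition subgaussian_transference (C : R) (s n : nat)
    (delta : nat -> nat -> R) (tau : pt) (A0 : seq pt) :
    fdist R (seq (seq pt)) :=
  levels (level_bound C n) s delta tau (trunc_log 2 n) A0.

End Algorithm.

Section IntegrationError.
Context {R : realType} (d : nat).
Local Notation pt := (@pt R d).
Implicit Types (f g h : pt -> R) (x : pt).

Definition cube : set pt := [set x | forall j, 0 <= coordinate x j <= 1].

Definition half_open_cube : set pt :=
  [set x | forall j, 0 <= coordinate x j < 1].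

(* Lebesgue measure restricted to the unit cube, i.e. the uniform law on it. *)
Definition unif_cube : probability pt R :=
  tuple_prob (uniform_prob (@ltr01 R)) d.

Definition cube_integral f : R := \int[unif_cube]_(x in cube) f x.

Definition square_integrable f : Prop := f \_ cube \in Lfun unif_cube 2%:E.

Definition err (A : seq pt) f : R :=
  (size A)%:R^-1 * (\sum_(x <- A) f x) - cube_integral f.

Definition sigma2 g : R :=
  cube_integral (fun x => g x ^+ 2) - cube_integral g ^+ 2.

Definition mean_square_err (C : R) (s n : nat) (delta : nat -> nat -> R)
    (i : 'I_n) f : \bar R :=
  (\int[unif_cube]_(tau in half_open_cube)
   \int[tuple_prob unif_cube (n ^ 2)]_(Z in [set Z | forall l, cube (tnth Z l)])
     (expect (subgaussian_transference C s n delta tau Z)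
             (fun As => err (nth [::] As i) f ^+ 2))%:E)%E.

Definition frequency : Type := {ffun 'I_d -> int}.

Definition phase (k : frequency) x : R :=
  2 * pi * \sum_j (k j)%:~R * coordinate x j.

Definition fourier_mode (k : frequency) x : R[i] :=
  Complex (cos (phase k x)) (sin (phase k x)).

Definition fourier_coef f (k : frequency) : R[i] :=
  Complex (cube_integral (fun x => f x * cos (phase k x)))
          (- cube_integral (fun x => f x * sin (phase k x))).

(* The sum over all k with `|k j| <= N for every j. *)
Definition fourier_partial_sum f (N : nat) x : R[i] :=
  \sum_(l : {ffun 'I_d -> 'I_(N.*2.+1)})
    let k : frequency := [ffun j => (l j)%:Z - N%:Z] in
    fourier_coef f k * fourier_mode k x.

(* f is the sum of its Fourier series in L^2. *)
Definition fourier_decomposable f : Prop :=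
  square_integrable f /\
  (\int[unif_cube]_(x in cube)
     (Normc.normc ((f x)%:C%C - fourier_partial_sum f N x) ^+ 2)%:E
     @[N --> \oo] --> 0)%E.

Definition depends_only_on (u : {set 'I_d}) f : Prop :=
  forall x y, cube x -> cube y ->
    (forall j, j \in u -> coordinate x j = coordinate y j) -> f x = f y.

Definition low_order (s : nat) h : Prop :=
  exists fu : {set 'I_d} -> pt -> R,
    (forall u : {set 'I_d}, (#|u| <= s)%N ->
       square_integrable (fu u) /\ depends_only_on u (fu u)) /\
    (forall x, cube x -> h x = \sum_(u : {set 'I_d} | (#|u| <= s)%N) fu u x).

Definition sigma_SO2 h : \bar R :=
  \esum_(k in [set k : frequency | k != [ffun=> 0]])
    (Normc.normc (fourier_coef h k) ^+ 2 *
     \sum_(u : {set 'I_d} | u != finset.set0) \prod_(j in u) `|k j|%:~R)%:E.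

Definition decomposition_bound (s n : nat) f : \bar R :=
  ereal_inf [set b : \bar R | exists g h,
    [/\ square_integrable g, low_order s h,
        (forall x, cube x -> f x = g x + h x) &
        b = ((ln n%:R / n%:R * sigma2 g)%:E +
             (d%:R ^+ s * ln (d * n)%:R ^+ s.+1 / n%:R ^+ 2)%:E
               * sigma_SO2 h)%E]].

End IntegrationError.

(* Main.v *)
(** Fix the shift and the initial sample Z.  If F = G + sum_B theta_B 1_B on Z, one
    self-balancing walk yields signs for which the signed sum of F has second
    moment at most 8 |G|^2 + 16 Lam |theta|^2, where Lam is lambda times the
    largest squared norm of an incidence vector: run backwards in time, the walk
    contracts theta by exactly the amount needed to pay for the variance of each
    step.  As flipping all the signs does not change their law, each half has half
    of the expected sum, and summing over the levels gives
    E err(A_T)^2 <= err(Z)^2 + O(1/n^3) sum_Z G^2 + O(Lam/n^2) |theta|^2.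

    A trigonometric polynomial h of order at most s is replaced by its values at
    the upper corners of the smallest shifted dyadic boxes.  These are combinations
    of indicators of boxes that are non-trivial in at most s dimensions, and the
    average of |theta|^2 over the shift is at most O_s(1) sigma_SO(h)^2, since a
    uniform shift makes the Fourier modes orthogonal.  The sampling error has mean
    square O(2^-L) sigma_SO(h)^2 and goes into G.

    For general f = g + h only the Fourier partial sum S_N h is treated in this way.
    What remains is S_N g + (f - S_N f) up to constants; by Bessel's inequality its
    variance is at most 2 sigma(g)^2 + 2 |f - S_N f|^2, and N goes to infinity. *)
From HB Require Import structures.
Require Import Defs.
From mathcomp Require Import all_boot all_order all_algebra.
From mathcomp Require Import all_classical all_reals all_analysis.
From mathcomp Require Import measurable_realfun.
From mathcomp.real_closed Require Import complex.
From mathcomp Require Import ring lra zify.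

Set Implicit Arguments.
Unset Strict Implicit.
Unset Printing Implicit Defensive.
Import Order.TTheory GRing.Theory Num.Theory.
Import numFieldNormedType.Exports.

Local Open Scope classical_set_scope.
Local Open Scope ring_scope.

(** * Finite distributions and the self-balancing walk *)

Section FiniteDistributionTheory.
Context {R : realType}.

(** Origin of the factors: a point lies in one interval of each level, hence in at most (d(L+1)+1)^s
    boxes; up to one, this is the squared norm of an incidence vector, and [lambda] adds one more
    logarithm, whence d^s (log(dn))^(s+1). The total number of boxes enters only through that
    logarithm. A level with 2^L >= n suffices, because the sampling error reaches the bound with a
    further factor 1/n.

    The weight in sigma_SO comes from one dimension: 2^j intervals of level j carry multipliers of
    squared size O(min(1, k^2/4^j)), the levels with 2^j near |k| dominate, and the total is 1 +
    O(|k|); products over the coordinates give the products of |k_j|.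

    [retry] conditions the walk on success, which an exact recursion does not survive. Hence the
    second moment is bounded with failed runs counted as 0, and a failure probability of at most 1/2
    costs a factor two.

    The partial sums are forced by the algorithm seeing point values: h need not equal its Fourier
    series at a point, so the difference has to be charged to the part that is controlled in L^2
    only. *)

Lemma expect_ret (T : Type) (x : T) (F : T -> R) : expect (ret x) F = F x.
Proof. by rewrite /expect /ret big_seq1 /= mul1r. Qed.

Lemma expect_bind (T U : Type) (m : fdist R T) (k : T -> fdist R U) (F : U -> R) :
  expect (bind m k) F = expect m (fun x => expect (k x) F).
Proof.
rewrite /expect /bind big_flatten big_map.
apply: eq_bigr => -[w x] _ /=; rewrite big_map mulr_sumr.
by apply: eq_bigr => -[v y] _ /=; rewrite mulrA.
Qed.

Lemma expect_coin (p : R) (F : bool -> R) :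
  expect (coin p) F = p * F true + (1 - p) * F false.
Proof. by rewrite /expect /coin big_cons big_seq1. Qed.

Lemma eq_expect (T : Type) (m : fdist R T) (F G : T -> R) :
  F =1 G -> expect m F = expect m G.
Proof. by move=> FG; apply: eq_bigr => x _; rewrite FG. Qed.

Lemma expectD (T : Type) (m : fdist R T) (F G : T -> R) :
  expect m (fun x => F x + G x) = expect m F + expect m G.
Proof. by rewrite /expect -big_split; apply: eq_bigr => x _; rewrite mulrDr. Qed.

Lemma expectZ (T : Type) (m : fdist R T) a (F : T -> R) :
  expect m (fun x => a * F x) = a * expect m F.
Proof. by rewrite /expect mulr_sumr; apply: eq_bigr => x _; rewrite mulrCA. Qed.

(** [fdist] does not force weights to be nonnegative, so nonnegativity travels together with the
    almost sure property; [le_expect] needs both. Total mass one is tracked separately, as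
    [expect _ (fun=> 1) = 1]. *)
Fixpoint supported (T : Type) (m : fdist R T) (P : T -> Prop) : Prop :=
  match m with
  | [::] => True
  | wx :: m' => (0 <= wx.1 /\ P wx.2) /\ supported m' P
  end.

Lemma supported_cat (T : Type) (m1 m2 : fdist R T) (P : T -> Prop) :
  supported m1 P -> supported m2 P -> supported (m1 ++ m2) P.
Proof. by elim: m1 => [//|wx m1 IH] /= [? ?] ?; split => //; exact: IH. Qed.

Lemma supported_ret (T : Type) (x : T) (P : T -> Prop) : P x -> supported (ret x) P.
Proof. by move=> Px; do 2?split => //=; exact: ler01. Qed.

Lemma supported_coin (p : R) (P : bool -> Prop) :
  0 <= p <= 1 -> P true -> P false -> supported (coin p) P.
Proof. by move=> /andP[p0 p1] Pt Pf; do !split => //=; rewrite subr_ge0. Qed.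

Lemma supported_mono (T : Type) (m : fdist R T) (P Q : T -> Prop) :
  supported m P -> (forall x, P x -> Q x) -> supported m Q.
Proof.
by move=> + PQ; elim: m => //= wx m IH [[? ?] ?]; split; [split; [|exact: PQ]|exact: IH].
Qed.

Lemma supported_bind (T U : Type) (m : fdist R T) (k : T -> fdist R U)
    (P : T -> Prop) (Q : U -> Prop) :
  supported m P -> (forall x, P x -> supported (k x) Q) -> supported (bind m k) Q.
Proof.
move=> + kQ; elim: m => [//|[w x] m IH] /= [[w0 Px] mP].
rewrite /bind /=; apply: supported_cat; last exact: IH.
have := kQ _ Px; elim: (k x) => [//|[v y] l IHl] /= [[v0 Qy] lQ].
by split; [split; [exact: mulr_ge0|]|exact: IHl].
Qed.

Lemma le_expect (T : Type) (m : fdist R T) (P : T -> Prop) (F G : T -> R) :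
  supported m P -> (forall x, P x -> F x <= G x) -> expect m F <= expect m G.
Proof.
move=> + FG; rewrite /expect; elim: m => [_|[w x] m IH] /=.
  by rewrite !big_nil.
move=> [[w0 Px] mP]; rewrite !big_cons /=; apply: lerD; last exact: IH.
by apply: ler_wpM2l => //; exact: FG.
Qed.

Lemma eq_expect_supported (T : Type) (m : fdist R T) (P : T -> Prop) (F G : T -> R) :
  supported m P -> (forall x, P x -> F x = G x) -> expect m F = expect m G.
Proof.
by move=> mP FG; apply/le_anti/andP; split;
  apply: (le_expect mP) => x Px; rewrite FG.
Qed.

Definition on_success (T : Type) (F : T -> R) (o : option T) : R :=
  if o is Some x then F x else 0.

Lemma expect_success (T : Type) (m : fdist R (option T)) :
  expect m (on_success (fun=> 1)) = expect m (fun=> 1) - failure_prob m.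
Proof.
apply/eqP; rewrite eq_sym subr_eq /failure_prob -expectD; apply/eqP/eq_expect.
by case=> [x|] /=; rewrite ?addr0 ?add0r.
Qed.

Lemma retry_factor (q : R) : 0 <= q < 1 -> limn (series (fun r => q ^+ r)) = (1 - q)^-1.
Proof.
move=> /andP[q0 q1]; apply/cvg_lim => //.
by rewrite exprn_geometric -[X in _ --> X]mul1r; apply: cvg_geometric_series; rewrite ger0_norm.
Qed.

Lemma expect_retry (T : Type) (m : fdist R (option T)) (F : T -> R) :
  expect (retry m) F =
  limn (series (fun r => failure_prob m ^+ r)) * expect m (on_success F).
Proof.
rewrite /expect /retry; move: (limn _) => L.
elim: m => [|[w [x|]] m IH] /=; rewrite ?big_nil ?mulr0 // !big_cons /= IH mulrDr ?mulrA//.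
by rewrite mulr0 add0r.
Qed.

Lemma supported_retry (T : Type) (m : fdist R (option T)) (P : T -> Prop) :
  0 <= failure_prob m < 1 ->
  supported m (fun o => if o is Some x then P x else True) -> supported (retry m) P.
Proof.
move=> q01; rewrite /retry retry_factor//.
have q1 : 0 <= (1 - failure_prob m)^-1.
  by rewrite invr_ge0 subr_ge0; apply/ltW; case/andP: q01.
move: (1 - _)^-1 q1 => L L0.
elim: m {q01} => [//|[w [x|]] m IH] /= [[w0 Px] mP]; last exact: IH.
by split; [split=> //; exact: mulr_ge0|exact: IH].
Qed.

End FiniteDistributionTheory.

(** * Second moment and failure probability of the walk *)

Section WalkAnalysis.
Context {R : realType} {I : finType}.
Implicit Types (u v w th : {ffun I -> R}) (vs : seq {ffun I -> R}).

Lemma dotvC u v : dotv u v = dotv v u.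
Proof. by apply: eq_bigr => i _; rewrite mulrC. Qed.

Lemma dotvDr th w v (a : R) :
  dotv th [ffun i => w i + a * v i] = dotv th w + a * dotv th v.
Proof.
rewrite /dotv mulr_sumr -big_split; apply: eq_bigr => i _ /=.
by rewrite ffunE; ring.
Qed.

Lemma dotvDl th w v (a : R) :
  dotv [ffun i => w i + a * v i] th = dotv w th + a * dotv v th.
Proof. by rewrite dotvC dotvDr dotvC (dotvC th v). Qed.

Lemma dotv_ge0 v : 0 <= dotv v v.
Proof. by apply: sumr_ge0 => i _; rewrite -expr2 sqr_ge0. Qed.

Lemma dotv0r th : dotv th [ffun=> 0] = 0.
Proof. by apply: big1 => i _; rewrite ffunE mulr0. Qed.

Lemma dotvZr th v (a : R) : dotv th [ffun i => a * v i] = a * dotv th v.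
Proof. by rewrite /dotv mulr_sumr; apply: eq_bigr => i _; rewrite ffunE; ring. Qed.

Lemma dotvZl th v (a : R) : dotv [ffun i => a * v i] th = a * dotv v th.
Proof. by rewrite dotvC dotvZr dotvC. Qed.

Variable lambda : R.
Hypothesis lambda_ge2 : 2 <= lambda.

Lemma coin_bias_ge0 w v : `|dotv w v| <= lambda ->
  0 <= 2^-1 - dotv w v / (2 * lambda) <= 1.
Proof.
move=> wv; have l2' := lambda_ge2; have l0 : 0 < lambda by lra.
have : `|dotv w v / (2 * lambda)| <= 2^-1.
  have l2 : 0 < 2 * lambda by rewrite mulr_gt0.
  by rewrite normrM normfV (gtr0_norm l2) ler_pdivrMr// mulKf.
by rewrite ler_norml => /andP[h1 h2]; apply/andP; split; lra.
Qed.

Lemma supported_walk w vs :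
  supported (walk lambda w vs) (fun o => if o is Some x then size x = size vs else True).
Proof.
elim: vs w => [|v vs IH] w /=; first exact: supported_ret.
case: ifPn => [_|]; first exact: supported_ret.
rewrite negb_or -leNgt => /andP[wv _].
have step b : supported
    (bind (walk lambda [ffun i => w i + sgn b * v i] vs) (fun o => ret (omap (cons b) o)))
    (fun o => if o is Some x then size x = (size vs).+1 else True).
  apply: (supported_bind (IH _)) => -[x|] /= xs; first by apply: supported_ret; rewrite /= xs.
  by do !split => //; exact: ler01.
apply: (supported_bind (P := fun=> True)) => //.
by apply: supported_coin => //; exact: coin_bias_ge0.
Qed.

Lemma expect_walk1 w vs : expect (walk lambda w vs) (fun=> 1) = 1.
Proof.
elim: vs w => [|v vs IH] w /=; first by rewrite expect_ret.
case: ifP => _; first by rewrite expect_ret.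
rewrite expect_bind expect_coin !expect_bind.
by under eq_expect do rewrite expect_ret;
   under [in X in _ + X]eq_expect do rewrite expect_ret; rewrite !IH; ring.
Qed.

Lemma expect_walk_cons w v vs (F : option (seq bool) -> R) :
  ~~ ((lambda < `|dotv w v|) || [exists i, lambda < `|w i|]) ->
  expect (walk lambda w (v :: vs)) F =
    (2^-1 - dotv w v / (2 * lambda)) *
      expect (walk lambda [ffun i => w i + v i] vs) (fun o => F (omap (cons true) o)) +
    (2^-1 + dotv w v / (2 * lambda)) *
      expect (walk lambda [ffun i => w i - v i] vs) (fun o => F (omap (cons false) o)).
Proof.
move=> /negbTE ok; have l2 := lambda_ge2; rewrite /= ok expect_bind expect_coin !expect_bind /=.
congr (_ * _ + _ * _); last 2 [by field; rewrite ?gt_eqF//; lra].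
- rewrite (_ : [ffun i => w i + 1 * v i] = [ffun i => w i + v i]); last first.
    by apply/ffunP => i; rewrite !ffunE mul1r.
  by apply: eq_expect => o; rewrite expect_ret.
- rewrite (_ : [ffun i => w i + -1 * v i] = [ffun i => w i - v i]); last first.
    by apply/ffunP => i; rewrite !ffunE mulN1r.
  by apply: eq_expect => o; rewrite expect_ret.
Qed.

Lemma walk_stop w v vs :
  (lambda < `|dotv w v|) || [exists i, lambda < `|w i|] ->
  walk lambda w (v :: vs) = ret None.
Proof. by rewrite /= => ->. Qed.

Local Arguments walk : simpl never.

(** Passing from w to -w swaps the two coin probabilities and leaves both stopping tests unchanged,
    so every sign is flipped. For the start 0 this makes the law of the signs symmetric. *)
Lemma walk_symmetric w vs (F : option (seq bool) -> R) :
  expect (walk lambda [ffun i => - w i] vs) F =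
  expect (walk lambda w vs) (F \o omap (map negb)).
Proof.
elim: vs w F => [|v vs IH] w F; first by rewrite /= !expect_ret.
have dN : dotv [ffun i => - w i] v = - dotv w v.
  by rewrite -mulN1r -dotvZl; congr dotv; apply/ffunP => i; rewrite !ffunE mulN1r.
have fN : (lambda < `|dotv [ffun i => - w i] v|) ||
    [exists i, lambda < `|[ffun i => - w i] i|] =
    (lambda < `|dotv w v|) || [exists i, lambda < `|w i|].
  by rewrite dN normrN; congr orb; apply: eq_existsb => i; rewrite ffunE normrN.
have [fail|ok] := boolP ((lambda < `|dotv w v|) || [exists i, lambda < `|w i|]).
  by rewrite !walk_stop ?fN// !expect_ret.
rewrite !expect_walk_cons ?fN// addrC dN.
rewrite (_ : [ffun i => [ffun i => - w i] i + v i] = [ffun i => - [ffun i => w i - v i] i]); last first.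
  by apply/ffunP => i; rewrite !ffunE opprB addrC.
rewrite (_ : [ffun i => [ffun i => - w i] i - v i] = [ffun i => - [ffun i => w i + v i] i]); last first.
  by apply/ffunP => i; rewrite !ffunE opprD.
rewrite !IH mulNr opprK; congr (_ * _ + _ * _).
- by apply: eq_expect => -[x|].
- by apply: eq_expect => -[x|].
Qed.

Fixpoint signed_sum (y : seq R) (c : seq bool) : R :=
  match y, c with
  | a :: y', b :: c' => sgn b * a + signed_sum y' c'
  | _, _ => 0
  end.

(* Backward induction: th0 is th transported through the contractions
   th |-> th - v (a + <th,v>) / lambda, which absorb the drift of the walk; the
   variance added in one step is paid for by the decrease of |th|^2. *)
Lemma walk_second_moment (av : seq (R * {ffun I -> R})) th :
  all (fun x => dotv x.2 x.2 <= 1) av ->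
  exists th0, exists2 Q : R,
    0 <= Q <= 2 * (\sum_(x <- av) x.1 ^+ 2 + lambda * (dotv th th - dotv th0 th0)) &
    forall s w, expect (walk lambda w [seq x.2 | x <- av])
      (on_success (fun c => (s + dotv th w
          + signed_sum [seq x.1 + dotv th x.2 | x <- av] c) ^+ 2))
      <= (s + dotv th0 w) ^+ 2 + Q.
Proof.
have l2 := lambda_ge2; have l0 : 0 < lambda by lra.
elim: av => [_|[a v] av IH /andP[/= v1 /IH[th1 [Q Q0 IHQ]]]].
  exists th; exists 0; first by rewrite big_nil; lra.
  by move=> s w /=; rewrite expect_ret /= !addr0.
set y := a + dotv th v in IHQ *; set z := a + dotv th1 v.
pose th0 := [ffun i => th1 i + - (z / lambda) * v i].
have eth0 : dotv th0 th0 = dotv th1 th1 - 2 * (z / lambda) * dotv th1 v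
    + (z / lambda) ^+ 2 * dotv v v.
  by rewrite /th0 dotvDl !dotvDr (dotvC v th1); ring.
(* Put b = <th1,v>, so that z = a + b. Since |v|^2/lambda <= 1/2, the right side exceeds z^2 by at
   least 2 b^2. *)
have zQ : z ^+ 2 <= 2 * (a ^+ 2 + lambda * (dotv th1 th1 - dotv th0 th0)).
  have -> : lambda * (dotv th1 th1 - dotv th0 th0) =
      2 * z * dotv th1 v - z ^+ 2 * (dotv v v / lambda).
    by rewrite eth0; field; rewrite gt_eqF.
  have : dotv v v / lambda <= 2^-1 by rewrite ler_pdivrMr//; lra.
  have := sqr_ge0 z; have := sqr_ge0 (dotv th1 v); rewrite /z.
  move: (dotv v v / lambda) (dotv th1 v) => r b b0 zz rl.
  have := ler_wpM2l zz rl; nra.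
exists th0; exists (Q + z ^+ 2).
  by rewrite big_cons /=; have := sqr_ge0 z => z0; case/andP: Q0 => Q0 QU; apply/andP; split; lra.
move=> s w /=; case: (boolP ((lambda < `|dotv w v|) || [exists i, lambda < `|w i|])).
  move=> fail; rewrite walk_stop// expect_ret /=.
  by rewrite !addr_ge0 ?sqr_ge0//; case/andP: Q0.
move=> ok; rewrite expect_walk_cons//.
have step (b : bool) : expect (walk lambda [ffun i => w i + sgn b * v i] [seq x.2 | x <- av])
    (fun o => on_success (fun c => (s + dotv th w + signed_sum
       (y :: [seq x.1 + dotv th x.2 | x <- av]) c) ^+ 2) (omap (cons b) o))
   <= (s + dotv th1 w + sgn b * z) ^+ 2 + Q.
  have h := IHQ (s + sgn b * a) [ffun i => w i + sgn b * v i].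
  rewrite !dotvDr in h.
  have -> : s + dotv th1 w + sgn b * z = s + sgn b * a + (dotv th1 w + sgn b * dotv th1 v).
    by rewrite /z; ring.
  apply: le_trans h; rewrite le_eqVlt; apply/orP; left; apply/eqP.
  by apply: eq_expect => -[c|] //=; rewrite /y; congr (_ ^+ 2); ring.
have := step true; have := step false; rewrite /= mul1r mulN1r.
rewrite (_ : [ffun i => w i + 1 * v i] = [ffun i => w i + v i]); last first.
  by apply/ffunP => i; rewrite !ffunE mul1r.
rewrite (_ : [ffun i => w i + -1 * v i] = [ffun i => w i - v i]); last first.
  by apply/ffunP => i; rewrite !ffunE mulN1r.
move: ok; rewrite negb_or -leNgt => /andP[/coin_bias_ge0/andP[p0 p1] _].
move: (expect _ _) => X; move: (expect _ _) => Y HX HY.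
have q0 : 0 <= 2^-1 + dotv w v / (2 * lambda) by lra.
apply: le_trans (lerD (ler_wpM2l p0 HY) (ler_wpM2l q0 HX)) _.
(* With r = <w,v>/lambda and t = <th1,w>, the sign c has mean -r, so the average of (s + t + c z)^2
   is (s + t - z r)^2 + z^2 - (z r)^2; and t - z r = <th0,w>. *)
rewrite /th0 dotvDl (dotvC v w).
have -> : dotv w v / (2 * lambda) = dotv w v / lambda / 2 by field; rewrite gt_eqF.
have -> : - (z / lambda) * dotv w v = - (z * (dotv w v / lambda)) by field; rewrite gt_eqF.
have := sqr_ge0 (z * (dotv w v / lambda)).
move: (dotv w v / lambda) (dotv th1 w) => r t; nra.
Qed.

Lemma walk_second_moment0 (av : seq (R * {ffun I -> R})) th :
  all (fun x => dotv x.2 x.2 <= 1) av ->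
  expect (walk lambda [ffun=> 0] [seq x.2 | x <- av])
      (on_success (fun c => signed_sum [seq x.1 + dotv th x.2 | x <- av] c ^+ 2))
  <= 2 * (\sum_(x <- av) x.1 ^+ 2 + lambda * dotv th th).
Proof.
move=> /(walk_second_moment th)[th0 [Q /andP[_ QU]]] /(_ 0 [ffun=> 0]).
rewrite !dotv0r !addr0 expr0n /= add0r.
under eq_expect do under eq_fun do rewrite add0r.
move/le_trans; apply; apply: le_trans QU _.
have l2 := lambda_ge2.
by rewrite ler_pM2l// lerD2l ler_pM2l; [rewrite gerBl dotv_ge0|lra].
Qed.

(** expR x * (1 - x) <= expR x * expR (- x) = 1, and (1 - x)(1 + x + 2 x^2) = 1 + x^2 (1 - 2 x) >=
    1. *)
Lemma expR_le_quadratic (x : R) : `|x| <= 2^-1 -> expR x <= 1 + x + 2 * x ^+ 2.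
Proof.
rewrite ler_norml => /andP[x1 x2].
have h : 1 - x <= expR (- x) by exact: expR_ge1Dx.
have : expR x * (1 - x) <= 1.
  by rewrite -[leRHS](expRxMexpNx_1 x) ler_wpM2l// expR_ge0.
rewrite -ler_pdivlMr; last lra.
by move/le_trans; apply; rewrite ler_pdivrMr; [nra|lra].
Qed.

(** Young's inequality, from |v - a t u|^2 >= 0 with a the sign of <u,v>. *)
Lemma dotv_le (t : R) u v : 0 < t -> 2 * `|dotv u v| <= t * dotv u u + t^-1 * dotv v v.
Proof.
move=> t0; have h (a : R) : `|a| = 1 -> 2 * (a * dotv u v) <= t * dotv u u + t^-1 * dotv v v.
  move=> a1; have := dotv_ge0 [ffun i => v i + (- (a * t)) * u i].
  have a2 : a ^+ 2 = 1 by rewrite -real_normK ?num_real// a1 expr1n.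
  rewrite dotvDl !dotvDr (dotvC v u) => h.
  have {}h : 0 <= dotv v v - 2 * t * (a * dotv u v) + a ^+ 2 * t ^+ 2 * dotv u u by lra.
  rewrite a2 mul1r in h; have ti : 0 <= t^-1 by rewrite invr_ge0 ltW.
  have := mulr_ge0 ti h; have -> : t^-1 * (dotv v v - 2 * t * (a * dotv u v) + t ^+ 2 * dotv u u) =
      t^-1 * dotv v v - 2 * (a * dotv u v) + t * dotv u u by field; rewrite gt_eqF.
  by lra.
have [_|_] := ger0P (dotv u v).
  by have := h 1 (normr1 _); rewrite mul1r.
by have := h (-1) (normrN1 _); rewrite mulN1r.
Qed.

(* Below the threshold, [expR (dotv th w - 2 * lambda * dotv th th)] is a
   supermartingale up to moving th to T th.  Each step adds the 2(|I| + 1) test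
   vectors a u / 4, where a is a sign and u is v or a unit vector: if the walk stops,
   one of their exponentials is at least one. *)
Lemma walk_potential vs : all (fun v => dotv v v <= 1) vs ->
  exists2 Th : seq {ffun I -> R},
    size Th = (2 * #|I|.+1 * size vs)%N /\ all (fun th => dotv th th <= 16^-1) Th &
    forall w, failure_prob (walk lambda w vs)
      <= \sum_(th <- Th) expR (dotv th w - 2 * lambda * dotv th th - lambda / 8).
Proof.
have l2 := lambda_ge2; have l0 : 0 < lambda by lra.
elim: vs => [_|v vs IH /andP[/= v1 /IH[Th [sTh Th1] IHTh]]].
  by exists [::]; [rewrite muln0|move=> w; rewrite /failure_prob /= expect_ret big_nil].
pose us := v :: [seq [ffun j => (i == j)%:R] | i <- enum I].
pose tests := [seq [ffun j => a / 4 * u j] | a <- [:: 1; -1], u : {ffun I -> R} <- us].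
pose T th := [ffun i => th i + - (dotv th v / lambda) * v i].
have us1 u : u \in us -> dotv u u <= 1.
  rewrite inE => /orP[/eqP-> //|/mapP[i _ ->]].
  rewrite /dotv (bigD1 i)//= big1 => [|j ji]; rewrite !ffunE ?eqxx ?mulr1 ?addr0//.
  by rewrite eq_sym (negbTE ji) mulr0.
have dT th : dotv (T th) (T th) = dotv th th - dotv th v ^+ 2 / lambda * (2 - dotv v v / lambda).
  rewrite /T dotvDl !dotvDr (dotvC v th); field; rewrite gt_eqF//.
have vl : 0 <= dotv v v / lambda <= 2^-1.
  by rewrite divr_ge0 ?dotv_ge0 ?(ltW l0)//= ler_pdivrMr//; lra.
have dTle th : dotv (T th) (T th) <= dotv th th.
  by rewrite dT gerBl mulr_ge0 ?divr_ge0 ?sqr_ge0 ?ltW//; lra.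
exists (tests ++ [seq T th | th <- Th]).
  split.
    by rewrite size_cat size_map sTh size_allpairs /= size_map -cardE; lia.
  rewrite all_cat; apply/andP; split.
    apply/allP => th /allpairsP[[a u] /= [a1 uus ->]].
    have : a ^+ 2 = 1 by move: a1; rewrite !inE => /orP[] /eqP->; ring.
    by move=> a2; rewrite dotvZl dotvZr; have := us1 _ uus; nra.
  by apply/allP => _ /mapP[th th1 ->]; apply: le_trans (dTle _) _; exact: (allP Th1).
move=> w; have e0 (S : seq _) : 0 <= \sum_(th <- S) expR (dotv th w - 2 * lambda * dotv th th - lambda / 8).
  by apply: sumr_ge0 => th _; exact: expR_ge0.
rewrite big_cat /=.
have [fail|ok] := boolP ((lambda < `|dotv w v|) || [exists i, lambda < `|w i|]).
  rewrite walk_stop// {1}/failure_prob expect_ret [leLHS]/= -[leLHS]addr0; apply: lerD => //.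
  have [u uus lu] : exists2 u, u \in us & lambda < `|dotv u w|.
    case/orP: fail => [lv|/existsP[i li]].
      by exists v; rewrite ?inE ?eqxx// dotvC.
    exists [ffun j => (i == j)%:R].
      by rewrite inE; apply/orP; right; apply/mapP; exists i; rewrite ?mem_enum.
    rewrite /dotv (bigD1 i)//= big1 => [|j ji].
      by rewrite ffunE eqxx mul1r addr0.
    by rewrite ffunE eq_sym (negbTE ji) mul0r.
  have [a a1 la] : exists2 a : R, a \in [:: 1; -1] & lambda < a * dotv u w.
    move: lu; case: (ger0P (dotv u w)) => _ lu; first by exists 1; rewrite ?inE ?eqxx// mul1r.
    by exists (-1); rewrite ?inE ?eqxx ?orbT// mulN1r.
  have tm : [ffun j => a / 4 * u j] \in tests by apply/allpairsP; exists (a, u).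
  rewrite (perm_big _ (perm_to_rem tm)) big_cons /= -[leLHS]addr0; apply: lerD => //.
  (* The exponent is at least lambda/4 - 2 lambda/16 - lambda/8 = 0; this is what fixes the factor
     1/4 of the test vectors and the offset [lambda / 8]. *)
  rewrite -[leLHS]expR0 ler_expR !dotvZl dotvZr; have := us1 _ uus.
  have -> : a / 4 * (a / 4 * dotv u u) = a ^+ 2 / 16 * dotv u u by field.
  have -> : a ^+ 2 = 1 by move: a1; rewrite !inE => /orP[] /eqP->; ring.
  nra.
rewrite -[leLHS]add0r; apply: lerD => //.
rewrite /failure_prob expect_walk_cons//.
have fN b u : expect (walk lambda u vs) (fun o => (~~ isSome (omap (cons b) o))%:R) =
    failure_prob (walk lambda u vs) by apply: eq_expect => -[].
rewrite !fN; move: ok; rewrite negb_or -leNgt => /andP[/coin_bias_ge0/andP[p0 p1] _].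
have q0 : 0 <= 2^-1 + dotv w v / (2 * lambda) by lra.
apply: le_trans (lerD (ler_wpM2l p0 (IHTh _)) (ler_wpM2l q0 (IHTh _))) _.
rewrite big_map !mulr_sumr -big_split big_seq [leRHS]big_seq; apply: ler_sum => th thT /=.
have dp : dotv th [ffun i => w i + v i] = dotv th w + dotv th v.
  by rewrite -[in RHS](mul1r (dotv th v)) -dotvDr; congr dotv; apply/ffunP => i; rewrite !ffunE mul1r.
have dm : dotv th [ffun i => w i - v i] = dotv th w - dotv th v.
  by rewrite -[in RHS](mulN1r (dotv th v)) -dotvDr; congr dotv; apply/ffunP => i; rewrite !ffunE mulN1r.
have y2 : `|dotv th v| <= 2^-1.
  have := dotv_le th v (ltr0n _ 4 : 0 < 4 :> R); have := allP Th1 _ thT.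
  by move: `|_| => y /=; lra.
have yp := expR_le_quadratic y2.
have ym : expR (- dotv th v) <= 1 - dotv th v + 2 * dotv th v ^+ 2.
  by rewrite -[in leRHS]sqrrN; apply: expR_le_quadratic; rewrite normrN.
rewrite dp dm dT /T dotvDl (dotvC v w).
have -> : 2^-1 - dotv w v / (2 * lambda) = 2^-1 - dotv w v / lambda / 2 by field; rewrite gt_eqF.
have -> : 2^-1 + dotv w v / (2 * lambda) = 2^-1 + dotv w v / lambda / 2 by field; rewrite gt_eqF.
have -> : dotv th w + dotv th v - 2 * lambda * dotv th th - lambda / 8 =
  dotv th w - 2 * lambda * dotv th th - lambda / 8 + dotv th v by ring.
have -> : dotv th w - dotv th v - 2 * lambda * dotv th th - lambda / 8 =
  dotv th w - 2 * lambda * dotv th th - lambda / 8 + - dotv th v by ring.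
have -> : dotv th w + - (dotv th v / lambda) * dotv w v
    - 2 * lambda * (dotv th th - dotv th v ^+ 2 / lambda * (2 - dotv v v / lambda)) - lambda / 8
  = dotv th w - 2 * lambda * dotv th th - lambda / 8
    + (2 * dotv th v ^+ 2 * (2 - dotv v v / lambda) - dotv w v / lambda * dotv th v).
  by field; rewrite gt_eqF.
have p0' : 0 <= 2^-1 - dotv w v / lambda / 2.
  by move: p0; rewrite invfM mulrA (mulrAC (dotv w v)).
have q0' : 0 <= 2^-1 + dotv w v / lambda / 2.
  by move: q0; rewrite invfM mulrA (mulrAC (dotv w v)).
rewrite !(expRD (_ - lambda / 8)) mulrCA (mulrCA (2^-1 + _)) -mulrDr ler_wpM2l ?expR_ge0//.
(* With y = <th,v>, r = <w,v>/lambda and rho = |v|^2/lambda, the average of the two exponentials is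
   at most 1 - r y + 2 y^2, while passing to [T th] raises the exponent by 2 y^2 (2 - rho) - r y. As
   rho <= 1/2, the second wins. *)
apply: le_trans (lerD (ler_wpM2l p0' yp) (ler_wpM2l q0' ym)) _.
apply: le_trans (expR_ge1Dx _).
have := sqr_ge0 (dotv th v); case/andP: vl => _ vl.
move: (dotv v v / lambda) vl (dotv w v / lambda) (dotv th v) => rho rho1 r y y0.
have := ler_wpM2l y0 rho1; nra.
Qed.

Lemma failure_prob_ge0 w vs : 0 <= failure_prob (walk lambda w vs).
Proof.
rewrite /failure_prob -[leLHS](mul0r (expect (walk lambda w vs) (fun=> 1))) -expectZ.
by apply: (le_expect (supported_walk w vs)) => o _; rewrite mul0r ler0n.
Qed.

Lemma walk_failure vs : all (fun v => dotv v v <= 1) vs ->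
  failure_prob (walk lambda [ffun=> 0] vs) <=
  (2 * #|I|.+1 * size vs)%:R * expR (- (lambda / 8)).
Proof.
have l2 := lambda_ge2; have l0 : 0 < lambda by lra.
move=> /walk_potential[Th [<- _] /(_ [ffun=> 0])] /le_trans; apply.
rewrite [leRHS](_ : _ = \sum_(th <- Th) expR (- (lambda / 8))); last first.
  by rewrite big_const_seq count_predT iter_addr_0 mulr_natl.
apply: ler_sum => th _.
rewrite ler_expR dotv0r; have := mulr_ge0 (ltW l0) (dotv_ge0 th); lra.
Qed.

End WalkAnalysis.

(** * Balanced signs *)

Section BalancedSigns.
Context {R : realType} {I : finType}.
Implicit Types (u v w th : {ffun I -> R}) (vs : seq {ffun I -> R}).

Definition walk_lambda (delta : R) (m : nat) : R := 30 * ln (m%:R / delta).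

(** The quadratic bound at 1/2 gives expR (1/2) <= 1 + 1/2 + 2/4 = 2. *)
Lemma ln2_ge_half : 2^-1 <= ln 2 :> R.
Proof.
rewrite -ler_expR lnK ?posrE//.
have := @expR_le_quadratic R 2^-1; rewrite ger0_norm ?invr_ge0// => /(_ (lexx _)).
by move/le_trans; apply; lra.
Qed.

Section LambdaBounds.
Variables (delta : R) (m : nat).
Hypotheses (delta_bounds : 0 < delta <= 2^-1) (m_gt1 : (1 < m)%N).

Let dm : 0 < delta / m%:R <= 4^-1.
Proof.
case/andP: delta_bounds => d0 d2.
have m2 : 2 <= m%:R :> R by rewrite ler_nat.
by rewrite divr_gt0 ?ltr0n ?(ltnW m_gt1)//= ler_pdivrMr; lra.
Qed.

Let lambdaE : walk_lambda delta m = - (30 * ln (delta / m%:R)).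
Proof.
case/andP: dm => dm0 _; rewrite /walk_lambda -mulrN -lnV ?posrE//.
by rewrite invf_div.
Qed.

Lemma walk_lambda_ge2 : 2 <= walk_lambda delta m.
Proof.
rewrite lambdaE; case/andP: dm => dm0 dm4.
have : ln (delta / m%:R) <= ln 2^-1.
  by rewrite ler_ln ?posrE//; apply: le_trans dm4 _; lra.
rewrite lnV ?posrE//; have := ln2_ge_half; lra.
Qed.

(** Put x = delta/m. The factor 30 gives lambda/8 >= 3 ln(1/x), and |I| + 1 <= 2 |I|, so the sum of
    the exponentials is at most 4 m x^3 = 4 delta x^2 <= 1/8. *)
Lemma walk_failure_half vs : all (fun v => dotv v v <= 1) vs ->
  m = (#|I| * size vs)%N ->
  0 <= failure_prob (walk (walk_lambda delta m) [ffun=> 0] vs) <= 2^-1.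
Proof.
move=> vs1 mE; have l2 := walk_lambda_ge2; rewrite failure_prob_ge0//=.
apply: le_trans (walk_failure l2 vs1) _; set x := delta / m%:R.
case/andP: dm => x0 x4; rewrite -/x in x0 x4.
have m0 : 0 < m%:R :> R by rewrite ltr0n (ltnW m_gt1).
have ex : expR (- (walk_lambda delta m / 8)) <= x ^+ 3.
  rewrite -[in leRHS](lnK (_ : x \in Num.pos)) ?posrE// -expRM_natl ler_expR lambdaE -/x.
  have : ln x <= 0 by apply: ln_le0; lra.
  lra.
apply: le_trans (ler_wpM2l (ler0n _ _) ex) _.
have xm : m%:R * x = delta by rewrite /x mulrC divfK// gt_eqF.
have : (2 * #|I|.+1 * size vs)%:R <= 4 * m%:R :> R.
  rewrite -natrM ler_nat mE mulnA leq_mul2r; apply/orP; right.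
  by case: #|I| mE m_gt1 => [->//|k _ _]; clear; lia.
move=> /(ler_wpM2r (exprn_ge0 3 (ltW x0))) /le_trans; apply.
have -> : 4 * m%:R * x ^+ 3 = 4 * x ^+ 2 * (m%:R * x) by ring.
rewrite xm; case/andP: delta_bounds => d0 d2; nra.
Qed.

End LambdaBounds.

Variable delta : nat -> nat -> R.
Hypothesis delta_bounds : forall m N, (1 < m * N)%N -> 0 < delta m N <= 2^-1.

Section Walk.
Variable vs : seq {ffun I -> R}.
Hypotheses (vs_small : all (fun v => dotv v v <= 1) vs) (vs_size : (1 < #|I| * size vs)%N).

Let lambda := walk_lambda (delta #|I| (size vs)) (#|I| * size vs).
Let lambda_ge2 : 2 <= lambda := walk_lambda_ge2 (delta_bounds vs_size) vs_size.
Let q := failure_prob (walk lambda [ffun=> 0] vs).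

Let q_half : 0 <= q <= 2^-1.
Proof. exact: (walk_failure_half (delta_bounds vs_size)). Qed.

Let q_lt1 : 0 <= q < 1.
Proof. by case/andP: q_half => -> ?; apply: le_lt_trans (_ : _ <= 2^-1) _ => //; lra. Qed.

Lemma expect_sbw (F : seq bool -> R) :
  expect (self_balancing_walk delta vs) F =
  (1 - q)^-1 * expect (walk lambda [ffun=> 0] vs) (on_success F).
Proof. by rewrite /self_balancing_walk expect_retry retry_factor//. Qed.

Lemma supported_sbw : supported (self_balancing_walk delta vs) (fun x => size x = size vs).
Proof. by apply: supported_retry => //; exact: supported_walk. Qed.

Lemma expect_sbw1 : expect (self_balancing_walk delta vs) (fun=> 1) = 1.
Proof.
rewrite expect_sbw expect_success expect_walk1 mulVf// subr_eq0 eq_sym.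
by rewrite lt_eqF//; case/andP: q_lt1.
Qed.

Lemma sbw_symmetric (F : seq bool -> R) :
  expect (self_balancing_walk delta vs) (F \o map negb) =
  expect (self_balancing_walk delta vs) F.
Proof.
rewrite !expect_sbw; congr (_ * _).
have e0 : [ffun=> 0] = [ffun i => - [ffun=> 0] i] :> {ffun I -> R}.
  by apply/ffunP => i; rewrite !ffunE oppr0.
have := walk_symmetric lambda_ge2 [ffun=> 0] vs (on_success F); rewrite -e0 => ->.
by apply: eq_expect => -[].
Qed.

End Walk.

(** Conditioning on success divides by 1 - q >= 1/2, which at most doubles the bound of
    [walk_second_moment0]. *)
Lemma sbw_second_moment (av : seq (R * {ffun I -> R})) th :
  let vs := [seq x.2 | x <- av] in
  all (fun v => dotv v v <= 1) vs -> (1 < #|I| * size av)%N ->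
  expect (self_balancing_walk delta vs)
    (fun c => signed_sum [seq x.1 + dotv th x.2 | x <- av] c ^+ 2)
  <= 4 * (\sum_(x <- av) x.1 ^+ 2
          + walk_lambda (delta #|I| (size av)) (#|I| * size av) * dotv th th).
Proof.
move=> vs vs1 vsN; have sv : size vs = size av by rewrite size_map.
rewrite -sv in vsN *; rewrite expect_sbw//.
have l2 := walk_lambda_ge2 (delta_bounds vsN) vsN.
have := walk_failure_half (delta_bounds vsN) vsN vs1 erefl.
move: (failure_prob _) => q /andP[q0 q1].
have {}vs1 : all (fun x : R * {ffun I -> R} => dotv x.2 x.2 <= 1) av by rewrite all_map in vs1.
have := walk_second_moment0 l2 th vs1; rewrite -/vs.
have Y0 : 0 <= \sum_(x <- av) x.1 ^+ 2
    + walk_lambda (delta #|I| (size vs)) (#|I| * size vs) * dotv th th.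
  apply: addr_ge0; first by apply: sumr_ge0 => x _; exact: sqr_ge0.
  by apply: mulr_ge0 (dotv_ge0 _); apply: le_trans l2.
move: (expect _ _) (_ + _) Y0 => X Y Y0 XY.
have qi : (1 - q)^-1 <= 2 by rewrite -[leRHS]invrK lef_pV2 ?posrE; lra.
have qi0 : 0 <= (1 - q)^-1 by rewrite invr_ge0; lra.
apply: le_trans (ler_wpM2l qi0 XY) _; rewrite mulrA ler_wpM2r//; lra.
Qed.

Fixpoint pairwise (T U : Type) (f : T -> T -> U) (l : seq T) : seq U :=
  match l with
  | x :: y :: l' => f x y :: pairwise f l'
  | _ => [::]
  end.

Definition balance (x : seq bool) : seq bool := flatten [seq [:: b; ~~ b] | b <- x].

Lemma pair_ind (T : Type) (P : seq T -> Prop) :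
  P [::] -> (forall x y l, ~~ odd (size l) -> P l -> P (x :: y :: l)) ->
  forall l, ~~ odd (size l) -> P l.
Proof.
move=> P0 PS l; have [n] := ubnP (size l); elim: n l => // n IH [//|x [//|y l]] /= ln ol.
by rewrite negbK in ol; apply: PS => //; apply: IH => //; lia.
Qed.

Lemma size_pairwise (T U : Type) (f : T -> T -> U) l : size (pairwise f l) = (size l)./2.
Proof.
have [n] := ubnP (size l); elim: n l => // n IH [//|x [//|y l]] /= ln.
by rewrite IH//; lia.
Qed.

Lemma size_balance x : size (balance x) = (size x).*2.
Proof. by elim: x => //= b x ->; rewrite doubleS. Qed.

Lemma count_balance x : count id (balance x) = size x /\ count negb (balance x) = size x.
Proof. by elim: x => //= -[] x [-> ->]. Qed.

Lemma balance_negb x : balance (map negb x) = map negb (balance x).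
Proof. by elim: x => //= b x IH; rewrite /balance /= -/(balance _) IH. Qed.

Lemma signed_sum_balance (y : seq R) x : ~~ odd (size y) ->
  signed_sum y (balance x) = signed_sum (pairwise (fun a b => a - b) y) x.
Proof.
move=> oy; move: y oy x; apply: pair_ind => [|a b y _ IH] [|c x] //=.
by rewrite -IH /sgn; case: c => /=; ring.
Qed.

Lemma signed_sum_negb (y : seq R) c : signed_sum y (map negb c) = - signed_sum y c.
Proof.
elim: y c => [|a y IH] [|b c] /=; rewrite ?oppr0// IH /sgn.
by case: b => /=; ring.
Qed.

Lemma sum_mask_negb (T : Type) (A : seq T) (F : T -> R) c : size c = size A ->
  \sum_(z <- mask c A) F z = (\sum_(z <- A) F z + signed_sum [seq F z | z <- A] c) / 2 /\
  \sum_(z <- mask [seq ~~ b | b <- c] A) F z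
    = (\sum_(z <- A) F z - signed_sum [seq F z | z <- A] c) / 2.
Proof.
elim: A c => [|z A IH] [|[] c] //= => [_|[/IH[h1 h2]]|[/IH[h1 h2]]].
- by rewrite !big_nil subr0 addr0 mul0r.
- by rewrite !big_cons h1 h2; split; lra.
- by rewrite !big_cons h1 h2; split; lra.
Qed.

Section Discrepancy.
Variables (av : seq (R * {ffun I -> R})) (th : {ffun I -> R}) (S : R).
Hypotheses (av_even : ~~ odd (size av)) (av_large : (2 < size av)%N)
  (av_bounded : forall x, x \in av -> dotv x.2 x.2 <= S)
  (av_nonzero : forall x, x \in av -> 0 < dotv x.2 x.2).

Let vs := [seq x.2 | x <- av].
Let M := (size av)./2.
Let scale : R := 2 * \big[Num.max/0]_(v <- vs) norm2 v.
Let norm_le v : v \in vs -> norm2 v <= \big[Num.max/0]_(v <- vs) norm2 v.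
Proof. by move=> vvs; apply: le_bigmax_seq. Qed.

Lemma discrepancy_scale : [/\ 0 < scale, scale ^+ 2 <= 4 * S &
  forall v, v \in vs -> dotv v v <= scale ^+ 2 / 4].
Proof.
have [x xav] : exists x, x \in av by case: (av) av_large => // x l _; exists x; rewrite inE eqxx.
have S0 : 0 < S by apply: lt_le_trans (av_nonzero xav) (av_bounded xav).
have s0 : 0 < scale.
  rewrite mulr_gt0//; apply: lt_le_trans (norm_le (map_f _ xav)).
  by rewrite /norm2 sqrtr_gt0 av_nonzero.
have m0 : 0 <= \big[Num.max/0]_(v <- vs) norm2 v by rewrite -(pmulr_rge0 _ (ltr0n _ 2)) ltW.
split => // [|v vvs].
  rewrite /scale exprMn ler_pM ?sqr_ge0//; first by rewrite le_eqVlt -natrX eqxx.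
  rewrite -(sqr_sqrtr (ltW S0)) ler_sqr ?nnegrE ?sqrtr_ge0//.
  rewrite big_seq; apply: bigmax_le => [|v /mapP[y yav ->]]; first exact: sqrtr_ge0.
  by rewrite ler_wsqrtr// av_bounded.
have -> : scale ^+ 2 / 4 = (\big[Num.max/0]_(v <- vs) norm2 v) ^+ 2.
  by rewrite /scale exprMn; field.
by rewrite -[leLHS](sqr_sqrtr (dotv_ge0 v)) ler_sqr ?nnegrE ?sqrtr_ge0// norm_le.
Qed.

Let scaled : seq {ffun I -> R} :=
  [seq [ffun i => v i / scale] | v : {ffun I -> R} <- pair_differences vs].

Lemma bal_subg_discE (F : seq bool -> R) :
  expect (bal_subg_disc delta vs) F =
  expect (self_balancing_walk delta scaled) (F \o balance).
Proof. by rewrite /bal_subg_disc expect_bind; apply: eq_expect => x; rewrite expect_ret. Qed.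

Let diffs : seq (R * {ffun I -> R}) :=
  pairwise (fun x y : R * {ffun I -> R} =>
    (x.1 - y.1, [ffun i => (x.2 i - y.2 i) / scale])) av.

Let scaledE : scaled = [seq x.2 | x <- diffs].
Proof.
rewrite /scaled /diffs /vs; move: av av_even; apply: pair_ind => //= x y l _ ->.
by congr (_ :: _); apply/ffunP => i; rewrite !ffunE.
Qed.

Lemma scaled_small : all (fun v => dotv v v <= 1) scaled.
Proof.
have [s0 _ sv] := discrepancy_scale.
rewrite scaledE /diffs; move: sv; rewrite /vs; move: av av_even; apply: pair_ind => // x y l _ IH h.
rewrite [pairwise _ _]/= map_cons; apply/andP; split; last first.
  by apply: IH => v vl; apply: h; rewrite !inE vl !orbT.
have hx := h _ (mem_head _ _).
have hy : dotv y.2 y.2 <= scale ^+ 2 / 4 by apply: h; rewrite !inE eqxx orbT.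
rewrite (_ : [ffun i => _] = [ffun i => scale^-1 * [ffun i => x.2 i + -1 * y.2 i] i]); last first.
  by apply/ffunP => i; rewrite !ffunE; field; rewrite gt_eqF.
rewrite /= dotvZl dotvZr; set d := dotv _ _.
rewrite (_ : _ * _ = d / scale ^+ 2); last by field; rewrite gt_eqF.
rewrite ler_pdivrMr ?exprn_gt0// mul1r /d.
(* Parallelogram law: |x - y|^2 <= 2 |x|^2 + 2 |y|^2 <= scale^2. *)
have := dotv_ge0 [ffun i => x.2 i + 1 * y.2 i].
rewrite !dotvDl !dotvDr (dotvC y.2 x.2); lra.
Qed.

Lemma size_scaled : size scaled = M.
Proof. by rewrite scaledE size_map size_pairwise. Qed.

Hypothesis I_gt0 : (0 < #|I|)%N.

Let scaled_size : (1 < #|I| * size scaled)%N.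
Proof. by rewrite size_scaled /M; move: av_large av_even I_gt0; nia. Qed.

Lemma supported_disc : supported (bal_subg_disc delta vs) (fun c => exists2 x,
  size x = M & c = balance x).
Proof.
apply: supported_bind (supported_sbw scaled_small scaled_size) _ => x sx.
by apply: supported_ret; exists x; rewrite -?size_scaled.
Qed.

Lemma expect_disc1 : expect (bal_subg_disc delta vs) (fun=> 1) = 1.
Proof. by rewrite bal_subg_discE; exact: (expect_sbw1 scaled_small scaled_size). Qed.

Lemma expect_disc_sum (y : seq R) : expect (bal_subg_disc delta vs) (signed_sum y) = 0.
Proof.
have : expect (bal_subg_disc delta vs) (signed_sum y) = - expect (bal_subg_disc delta vs) (signed_sum y).
  rewrite bal_subg_discE -[in LHS]sbw_symmetric ?scaled_small// -mulN1r -expectZ.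
  by apply: eq_expect => x /=; rewrite balance_negb signed_sum_negb mulN1r.
lra.
Qed.

Let lambda := walk_lambda (delta #|I| M) (#|I| * M).

(** The walk sees differences divided by [scale]; replacing th by [scale * th] undoes the division
    and multiplies |th|^2 by at most 4 S. With (a - b)^2 <= 2 a^2 + 2 b^2 for the scalar parts, the
    constants are 8 = 4 * 2 and 16 = 4 * 4. *)
Lemma disc_second_moment :
  expect (bal_subg_disc delta vs)
    (fun c => signed_sum [seq x.1 + dotv th x.2 | x <- av] c ^+ 2)
  <= 8 * \sum_(x <- av) x.1 ^+ 2 + 16 * (lambda * S * dotv th th).
Proof.
have [s0 sS _] := discrepancy_scale.
have sd : size diffs = M by rewrite size_pairwise.
have := @sbw_second_moment diffs [ffun i => scale * th i].
rewrite -scaledE sd => /(_ scaled_small); rewrite -size_scaled => /(_ scaled_size).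
rewrite size_scaled -/lambda dotvZl dotvZr => h.
rewrite bal_subg_discE.
rewrite (_ : expect _ _ = expect (self_balancing_walk delta scaled)
  (fun c => signed_sum [seq x.1 + dotv [ffun i => scale * th i] x.2 | x <- diffs] c ^+ 2)); last first.
  apply: eq_expect => c /=; rewrite signed_sum_balance ?size_map//.
  congr (signed_sum _ _ ^+ 2); rewrite /diffs; move: av av_even; apply: pair_ind => //= x y l _ ->.
  congr (_ :: _); rewrite dotvZl.
  rewrite (_ : [ffun i => _] = [ffun i => scale^-1 * [ffun i => x.2 i + -1 * y.2 i] i]); last first.
    by apply/ffunP => i; rewrite !ffunE; field; rewrite gt_eqF.
  by rewrite dotvZr dotvDr; field; rewrite gt_eqF.
apply: le_trans h _; rewrite mulrDr; apply: lerD.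
  rewrite (_ : 8 = 4 * 2); last by ring.
  rewrite -mulrA ler_wpM2l// /diffs; move: av av_even; apply: pair_ind => [|x y l _ IH].
    by rewrite !big_nil mulr0.
  rewrite [pairwise _ _]/= !big_cons /=; have := sqr_ge0 (x.1 + y.1); lra.
have l0 : 0 <= lambda.
  apply: le_trans (walk_lambda_ge2 (delta_bounds _) _); rewrite ?ler0n//; by rewrite -size_scaled.
rewrite (_ : 16 = 4 * 4); last by ring.
rewrite -mulrA ler_wpM2l//.
have -> : lambda * (scale * (scale * dotv th th)) = scale ^+ 2 * (lambda * dotv th th) by ring.
have -> : 4 * (lambda * S * dotv th th) = 4 * S * (lambda * dotv th th) by ring.
by rewrite ler_wpM2r// mulr_ge0 ?dotv_ge0.
Qed.

End Discrepancy.

End BalancedSigns.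

(** * Halving a point set *)

(** The pairs (j, f j) over the support determine f; padding their list with [None] to length s
    makes f the image of an s-tuple over [option (I * T)]. This serves to count the boxes through a
    point as well as all boxes. *)
Lemma support_card (I T : finType) (t0 : T) (s : nat) :
  (#|[set f : {ffun I -> T} | (#|[set j | f j != t0]%SET| <= s)%N]%SET|
     <= (#|I| * #|T|).+1 ^ s)%N.
Proof.
pose dec (p : s.-tuple (option (I * T))) : {ffun I -> T} :=
  [ffun j => odflt t0 (ohead (pmap (fun o : option (I * T) =>
     obind (fun x : I * T => if x.1 == j then Some x.2 else None) o) p))].
apply: (@leq_trans #|[set dec p | p : s.-tuple (option (I * T))]%SET|).
  apply/subset_leq_card/fintype.subsetP => f; rewrite inE => fs.
  pose l := [seq Some (j, f j) | j <- enum [set j | f j != t0]%SET].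
  have sl : size (l ++ nseq (s - size l) None) == s.
    by rewrite size_cat size_nseq subnKC// size_map -cardE.
  apply/imsetP; exists (Tuple sl) => //; apply/ffunP => j; rewrite ffunE /= pmap_cat.
  have -> : pmap (fun o : option (I * T) => obind (fun x => if x.1 == j then Some x.2 else None) o)
      (nseq (s - size l) None) = [::] by elim: (s - size l)%N.
  rewrite cats0 /l.
  have : (j \in enum [set j | f j != t0]%SET) = (f j != t0) by rewrite mem_enum inE.
  elim: (enum _) => [|k e IH] /=; first by case: eqP.
  rewrite inE; case: eqVneq => [->//|kj] /=; exact: IH.
by rewrite (leq_trans (leq_imset_card _ _))// card_tuple card_option card_prod.
Qed.

(** * One split, one level, and the whole tree of halvings *)

Section Splitting.
Context {R : realType} (d L s : nat).
Local Notation pt := (@pt R d).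
Implicit Types (A : seq pt) (F G H : pt -> R).
Variables (tau : pt) (delta : nat -> nat -> R).
Hypothesis delta_bounds : forall m N, (1 < m * N)%N -> 0 < delta m N <= 2^-1.

Definition hits (z : pt) : nat := #|[set B : dyadic_box d L s | in_shifted_box tau B z]%SET|.

Variables (F G : pt -> R) (theta : dyadic_box d L s -> R) (S : R).

Section OneSplit.
Variable A : seq pt.
Hypotheses (A_even : ~~ odd (size A)) (A_large : (2 < size A)%N)
  (A_hits : forall z, z \in A -> 1 + (hits z)%:R <= S)
  (A_F : forall z, z \in A ->
     F z = G z + \sum_B theta B * (in_shifted_box tau B z)%:R).

Let I : finType := ('I_(size A) + dyadic_box d L s)%type.
Let vec (j : 'I_(size A)) : {ffun I -> R} := [ffun i => match i with
                  | inl l => (l == j)%:R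
                  | inr B => (in_shifted_box tau B (tnth (in_tuple A) j))%:R
                  end].
Let av : seq (R * {ffun I -> R}) := [seq (G (tnth (in_tuple A) j), vec j) | j <- enum 'I_(size A)].
(** Only the box weights are put into [th]. The values of G are the scalar parts of [av], whose
    squares enter the bound without the factor [lambda * S]. *)
Let th : {ffun I -> R} := [ffun i => if i is inr B then theta B else 0].

Let avE : [seq x.2 | x <- av] = incidence_vectors L s tau A.
Proof. by rewrite /av -map_comp. Qed.

Let size_av : size av = size A.
Proof. by rewrite size_map size_enum_ord. Qed.

Let dotv_vec j : dotv (vec j) (vec j) = 1 + (hits (tnth (in_tuple A) j))%:R.
Proof.
rewrite /dotv big_sumType /=; congr (_ + _).
  rewrite (bigD1 j)//= !ffunE eqxx mulr1 big1 ?addr0// => i /negbTE ij.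
  by rewrite !ffunE ij mulr0.
rewrite /hits -sum1dep_card natr_sum [RHS]big_mkcond; apply: eq_bigr => B _ /=.
by rewrite !ffunE; case: in_shifted_box; rewrite ?mulr1 ?mulr0.
Qed.

Let valE : [seq x.1 + dotv th x.2 | x <- av] = [seq F z | z <- A].
Proof.
transitivity [seq F z | z <- [seq tnth (in_tuple A) j | j <- enum 'I_(size A)]]; last by rewrite map_tnth_enum.
rewrite /av -!map_comp.
apply: eq_map => j /=; rewrite A_F ?mem_tnth//; congr (_ + _).
rewrite /dotv big_sumType /= big1 ?add0r => [|i _]; last by rewrite ffunE mul0r.
by apply: eq_bigr => B _; rewrite !ffunE.
Qed.

Let M := (size A)./2.
Let lambda := walk_lambda (delta #|I| M) (#|I| * M).

Let av_even : ~~ odd (size av). Proof. by rewrite size_av. Qed.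
Let av_large : (2 < size av)%N. Proof. by rewrite size_av. Qed.
Let av_bounded x : x \in av -> dotv x.2 x.2 <= S.
Proof. by case/mapP=> j _ -> /=; rewrite dotv_vec A_hits ?mem_tnth. Qed.
Let av_nonzero x : x \in av -> 0 < dotv x.2 x.2.
Proof. by case/mapP=> j _ -> /=; rewrite dotv_vec ltr_wpDr. Qed.
Let I_gt0 : (0 < #|I|)%N.
Proof. by rewrite card_sum card_ord addn_gt0 (ltnW (ltnW A_large)). Qed.

Let disc := bal_subg_disc delta [seq x.2 | x <- av].

Let supported_c : supported disc (fun c => [/\ size c = size A, count id c = M & count negb c = M]).
Proof.
have := supported_disc delta_bounds av_even av_large av_bounded av_nonzero I_gt0.
rewrite -/disc size_av -/M => /supported_mono; apply=> _ [x sx ->].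
rewrite size_balance sx !(count_balance x).1 !(count_balance x).2 sx; split=> //.
by rewrite /M -[RHS]odd_double_half (negbTE A_even).
Qed.

Let disc1 : expect disc (fun=> 1) = 1.
Proof. exact: (expect_disc1 delta_bounds av_even av_large av_bounded av_nonzero I_gt0). Qed.

Let disc_sum y : expect disc (signed_sum y) = 0.
Proof. exact: (expect_disc_sum delta_bounds av_even av_large av_bounded av_nonzero I_gt0). Qed.

Definition half (b : bool) (B : seq pt * seq pt) : seq pt := if b then B.2 else B.1.

Let split_pointsE (Phi : seq pt * seq pt -> R) :
  expect (split_points L s delta tau A) Phi =
  expect disc (fun c => Phi (mask [seq ~~ b | b <- c] A, mask c A)).
Proof.
by rewrite /split_points -avE expect_bind; apply: eq_expect => c; rewrite expect_ret.
Qed.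

Lemma supported_split : supported (split_points L s delta tau A)
  (fun B => forall b, size (half b B) = M /\ {subset half b B <= A}).
Proof.
rewrite /split_points -avE; apply: supported_bind supported_c _ => c [sc c1 c2].
apply: supported_ret => -[] /=; split; try by move=> z /mem_mask.
  by rewrite size_mask.
by rewrite size_mask ?size_map// count_map -c2; apply: eq_count.
Qed.

Lemma expect_split1 : expect (split_points L s delta tau A) (fun=> 1) = 1.
Proof. by rewrite split_pointsE disc1. Qed.

Lemma split_mean b H : expect (split_points L s delta tau A)
  (fun B => \sum_(z <- half b B) H z) = (\sum_(z <- A) H z) / 2.
Proof.
rewrite split_pointsE.
transitivity (expect disc (fun c => (\sum_(z <- A) H z) / 2 * 1
    + (sgn b / 2) * signed_sum [seq H z | z <- A] c)).
  apply: (eq_expect_supported supported_c) => c [sc _ _].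
  have [h1 h2] := sum_mask_negb H sc.
  by case: b => /=; rewrite ?h1 ?h2; field.
by rewrite expectD !expectZ disc1 disc_sum mulr0 addr0 mulr1.
Qed.

(** A half has the sum (X + D)/2 or (X - D)/2, where D is the signed sum. The cross term has mean
    zero by symmetry, and D^2 is bounded by [disc_second_moment]. *)
Lemma split_square b : expect (split_points L s delta tau A)
  (fun B => (\sum_(z <- half b B) F z) ^+ 2) <=
  ((\sum_(z <- A) F z) ^+ 2 + 8 * \sum_(z <- A) G z ^+ 2
     + 16 * (lambda * S * \sum_B theta B ^+ 2)) / 4.
Proof.
rewrite split_pointsE.
set X := \sum_(z <- A) F z.
have -> : expect disc (fun c => (\sum_(z <- half b (mask [seq ~~ b | b <- c] A, mask c A)) F z) ^+ 2)
  = expect disc (fun c => X ^+ 2 / 4 * 1 + (X * sgn b / 2 * signed_sum [seq F z | z <- A] c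
    + 4^-1 * signed_sum [seq F z | z <- A] c ^+ 2)).
  apply: (eq_expect_supported supported_c) => c [sc _ _].
  have [h1 h2] := sum_mask_negb F sc; rewrite -/X in h1 h2.
  by case: b => /=; rewrite ?h1 ?h2; field.
rewrite !expectD !expectZ disc1 disc_sum mulr0 add0r mulr1.
have := disc_second_moment delta_bounds th av_even av_large av_bounded av_nonzero I_gt0.
rewrite valE size_av -/disc -/M -/lambda.
have -> : \sum_(x <- av) x.1 ^+ 2 = \sum_(z <- A) G z ^+ 2.
  by rewrite big_map /= big_enum [RHS]big_tnth.
have -> : dotv th th = \sum_B theta B ^+ 2.
  rewrite /dotv big_sumType /= big1 ?add0r => [|i _]; last by rewrite ffunE mul0r.
  by apply: eq_bigr => B _; rewrite !ffunE.
move: (expect _ _) => E; lra.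
Qed.

End OneSplit.

(** Entry i is the half [odd i] of the set [i./2]; the splits of all other sets have total mass one
    and integrate out. *)
Lemma expect_split_all As i (Phi : seq pt -> R) :
  (forall A, A \in As -> expect (split_points L s delta tau A) (fun=> 1) = 1) ->
  (i./2 < size As)%N ->
  expect (split_all L s delta tau As) (fun Bs => Phi (nth [::] Bs i)) =
  expect (split_points L s delta tau (nth [::] As i./2)) (fun B => Phi (half (odd i) B)).
Proof.
elim: As i => [//|A As IH] i one iAs /=.
have all1 : expect (split_all L s delta tau As) (fun=> 1) = 1.
  elim: As one {IH iAs} => [|A' As IH] one /=; first by rewrite expect_ret.
  rewrite expect_bind (eq_expect _ (G := fun=> 1)) ?one ?inE ?eqxx ?orbT// => B.
  rewrite expect_bind (eq_expect _ (G := fun=> 1)) ?IH// => [A'' A''s|Bs]; last by rewrite expect_ret.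
  by apply: one; move: A''s; rewrite !inE => /orP[->//|->]; rewrite !orbT.
rewrite expect_bind; case: i iAs => [|[|i]] iAs /=.
- apply: eq_expect => B; rewrite expect_bind -[RHS]mulr1 -[in RHS]all1 -expectZ.
  by apply: eq_expect => Bs; rewrite expect_ret mulr1.
- apply: eq_expect => B; rewrite expect_bind -[RHS]mulr1 -[in RHS]all1 -expectZ.
  by apply: eq_expect => Bs; rewrite expect_ret mulr1.
- rewrite (eq_expect _ (G := fun=> expect (split_all L s delta tau As) (fun Bs => Phi (nth [::] Bs i)) * 1)).
    rewrite expectZ one ?inE ?eqxx// mulr1 negbK; apply: IH => // A' A's.
    by apply: one; rewrite inE A's orbT.
  by move=> B; rewrite expect_bind mulr1; apply: eq_expect => Bs; rewrite expect_ret.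
Qed.

Lemma supported_split_all As (P : seq pt -> Prop) :
  (forall A, A \in As -> supported (split_points L s delta tau A) (fun B => forall b, P (half b B))) ->
  supported (split_all L s delta tau As) (fun Bs => size Bs = (size As).*2 /\ forall A, A \in Bs -> P A).
Proof.
elim: As => [|A As IH] AP /=; first by apply: supported_ret.
apply: supported_bind (AP A (mem_head _ _)) _ => B PB.
apply: (supported_bind (IH _)) => [A' A's|Bs [sBs PBs]].
  by apply: AP; rewrite inE A's orbT.
apply: supported_ret; split => /=; first by rewrite sBs doubleS.
move=> A'; rewrite !inE => /or3P[/eqP->|/eqP->|/PBs//]; [exact: (PB false)|exact: (PB true)].
Qed.

Section Levels.
Variables (T : nat) (A0 : seq pt) (Lam : R).
Hypotheses (A0_size : size A0 = (4 ^ T)%N) (Lam_ge0 : 0 <= Lam)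
  (A0_hits : forall z, z \in A0 -> 1 + (hits z)%:R <= S)
  (A0_F : forall z, z \in A0 ->
     F z = G z + \sum_B theta B * (in_shifted_box tau B z)%:R)
  (Lam_bound : forall N, (2 < N <= 4 ^ T)%N ->
     let m := (N + #|{: dyadic_box d L s}|)%N in
     walk_lambda (delta m N./2) (m * N./2) * S <= Lam).

Let level_size t := (2 ^ (T + (T - t)))%N.

Let level_even t : (t < T)%N -> level_size t = (level_size t.+1).*2.
Proof.
by move=> tT; rewrite /level_size -muln2 -expnSr; congr (_ ^ _)%N; lia.
Qed.

Let level_large t : (t < T)%N -> (2 < level_size t)%N.
Proof. by move=> tT; apply: (@leq_trans (2 ^ 2)); rewrite // leq_exp2l//; lia. Qed.

Let ok (t : nat) (A : seq pt) := size A = level_size t /\ {subset A <= A0}.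

Let ok_split t A : (t < T)%N -> ok t A -> [/\ ~~ odd (size A), (2 < size A)%N,
  forall z, z \in A -> 1 + (hits z)%:R <= S &
  forall z, z \in A -> F z = G z + \sum_B theta B * (in_shifted_box tau B z)%:R].
Proof.
move=> tT [-> sub]; split; [by rewrite level_even// odd_double|exact: level_large| |].
  by move=> z /sub; exact: A0_hits.
by move=> z /sub; exact: A0_F.
Qed.

Lemma supported_levels t : (t <= T)%N -> supported (levels L s delta tau t A0)
  (fun As => size As = (2 ^ t)%N /\ forall A, A \in As -> ok t A).
Proof.
elim: t => [_|t IH tT] /=.
  apply: supported_ret; split=> // A; rewrite inE => /eqP->; split=> //.
  by rewrite A0_size /level_size subn0 addnn -mul2n expnM.
apply: supported_bind (IH (ltnW tT)) _ => As [sAs okAs].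
apply: (supported_mono (supported_split_all (P := ok t.+1) _)).
  move=> A /okAs okA; have [h1 h2 h3 h4] := ok_split tT okA.
  apply: supported_mono (supported_split h1 h2 h3) _ => B hB b.
  have [sB subB] := hB b; split; last by move=> z /subB; apply: okA.2.
  by rewrite sB okA.1 level_even// doubleK.
by move=> Bs [-> okBs]; split=> //; rewrite sAs -mul2n -expnS.
Qed.

Lemma levels_step t i (Phi : seq pt -> R) : (t < T)%N -> (i < 2 ^ t.+1)%N ->
  expect (levels L s delta tau t.+1 A0) (fun As => Phi (nth [::] As i)) =
  expect (levels L s delta tau t A0) (fun As =>
    expect (split_points L s delta tau (nth [::] As i./2)) (fun B => Phi (half (odd i) B))).
Proof.
move=> tT it; rewrite /= expect_bind.
apply: (eq_expect_supported (supported_levels (ltnW tT))) => As [sAs okAs].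
apply: expect_split_all => [A /okAs okA|].
  by have [h1 h2 h3 h4] := ok_split tT okA; exact: (expect_split1 h1 h2 h3).
by rewrite sAs; move: it; rewrite expnS; lia.
Qed.

Lemma expect_levels1 t : (t <= T)%N -> expect (levels L s delta tau t A0) (fun=> 1) = 1.
Proof.
elim: t => [_|t IH tT] /=; first by rewrite expect_ret.
rewrite expect_bind -[RHS](IH (ltnW tT)).
apply: (eq_expect_supported (supported_levels (ltnW tT))) => As [_ okAs].
have : forall A, A \in As -> expect (split_points L s delta tau A) (fun=> 1) = 1.
  by move=> A /okAs okA; have [h1 h2 h3 h4] := ok_split tT okA; exact: (expect_split1 h1 h2 h3).
elim: As {okAs} => [_|A As IHA one] /=; first by rewrite expect_ret.
rewrite expect_bind -[RHS](one A (mem_head _ _)); apply: eq_expect => B.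
rewrite expect_bind -[RHS]IHA; first by apply: eq_expect => Bs; rewrite expect_ret.
by move=> A' A's; apply: one; rewrite inE A's orbT.
Qed.

Lemma levels_mean t i H : (t <= T)%N -> (i < 2 ^ t)%N ->
  expect (levels L s delta tau t A0) (fun As => \sum_(z <- nth [::] As i) H z) =
  (\sum_(z <- A0) H z) / 2 ^+ t.
Proof.
elim: t i => [|t IH] i tT it.
  by move: it; rewrite expn0 ltnS leqn0 => /eqP->; rewrite expect_ret divr1.
rewrite (levels_step (fun A => \sum_(z <- A) H z)) //.
have it2 : (i./2 < 2 ^ t)%N by move: it; rewrite expnS; lia.
transitivity (expect (levels L s delta tau t A0) (fun As =>
    2^-1 * \sum_(z <- nth [::] As i./2) H z)).
  apply: (eq_expect_supported (supported_levels (ltnW tT))) => As [sAs okAs].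
  have okA : ok t (nth [::] As i./2) by apply/okAs/mem_nth; rewrite sAs.
  by have [h1 h2 h3 h4] := ok_split tT okA; rewrite (split_mean h1 h2 h3) mulrC.
by rewrite expectZ IH// ?(ltnW tT)// exprS invfM mulrCA.
Qed.

(** The factor 4^t compensates the halving of the sums. Level t then adds 8 * 2^t times the sum of
    G^2, as the mean of that sum has been halved t times, and 16 * 4^t times the energy term. Both
    series are geometric: the first closes exactly, the second by 8 + 16 <= 32. *)
Lemma levels_square t i : (t <= T)%N -> (i < 2 ^ t)%N ->
  4 ^+ t * expect (levels L s delta tau t A0) (fun As => (\sum_(z <- nth [::] As i) F z) ^+ 2) <=
  (\sum_(z <- A0) F z) ^+ 2 + 8 * 2 ^+ t * \sum_(z <- A0) G z ^+ 2
    + 8 * 4 ^+ t * (Lam * \sum_B theta B ^+ 2).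
Proof.
have Th0 : 0 <= \sum_B theta B ^+ 2 by apply: sumr_ge0 => B _; exact: sqr_ge0.
have G0 : 0 <= \sum_(z <- A0) G z ^+ 2 by apply: sumr_ge0 => z _; exact: sqr_ge0.
have LT := mulr_ge0 Lam_ge0 Th0.
elim: t i => [|t IH] i tT it.
  by move: it; rewrite expn0 ltnS leqn0 => /eqP->; rewrite expect_ret /= !expr0; lra.
rewrite (levels_step (fun A => (\sum_(z <- A) F z) ^+ 2))//.
have it2 : (i./2 < 2 ^ t)%N by move: it; rewrite expnS; lia.
have {IH} := IH _ (ltnW tT) it2.
have := levels_mean (fun z => G z ^+ 2) (ltnW tT) it2.
set X := expect _ _; set Y := expect _ _; set Z := expect _ _ => XE YE.
have : Z <= (Y + 8 * X + 16 * (Lam * \sum_B theta B ^+ 2)) / 4.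
  rewrite (_ : _ / 4 = expect (levels L s delta tau t A0) (fun As =>
      4^-1 * (\sum_(z <- nth [::] As i./2) F z) ^+ 2 + (2 * (\sum_(z <- nth [::] As i./2) G z ^+ 2)
        + 4 * (Lam * \sum_B theta B ^+ 2) * 1))); last first.
    rewrite expectD expectD expectZ -/Y expectZ -/X expectZ (expect_levels1 (ltnW tT)).
    transitivity (4^-1 * Y + (2 * X + 4 * (Lam * \sum_B theta B ^+ 2) * 1)); last by [].
    by field.
  apply: (le_expect (supported_levels (ltnW tT))) => As [sAs okAs].
  have okA : ok t (nth [::] As i./2) by apply/okAs/mem_nth; rewrite sAs.
  have [h1 h2 h3 h4] := ok_split tT okA.
  apply: le_trans (split_square h1 h2 h3 h4 _) _; rewrite card_sum card_ord.
  have : (2 < size (nth [::] As i./2)%SEQ <= 4 ^ T)%N.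
    rewrite h2 okA.1 /level_size -(expnM 2 2) leq_exp2l//; lia.
  move=> /Lam_bound /=; move: (walk_lambda _ _) => lam /(ler_wpM2r Th0).
  move: (\sum_(z <- _) F z) (\sum_(z <- _) G z ^+ 2) => a b; lra.
have p2 : 0 < 2 ^+ t :> R by rewrite exprn_gt0.
have p4 : 0 < 4 ^+ t :> R by rewrite exprn_gt0.
have e4 : 4 ^+ t = 2 ^+ t * 2 ^+ t :> R by rewrite -exprMn; congr (_ ^+ _); ring.
have XE' : 4 ^+ t * X = 2 ^+ t * \sum_(z <- A0) G z ^+ 2.
  by rewrite XE e4; field; rewrite gt_eqF.
move=> ZE; have := ler_wpM2l (ltW p4) ZE; rewrite (exprS 4) (exprS 2) => ZE'.
have := mulr_ge0 (ltW p4) LT; have := mulr_ge0 (ltW p2) G0.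
move: YE ZE' XE'; rewrite -/Y -/Z.
set g := \sum_(z <- A0) G z ^+ 2; set l := Lam * _.
move: (\sum_(z <- A0) F z) => f.
have -> : 4 ^+ t * ((Y + 8 * X + 16 * l) / 4) =
    (4 ^+ t * Y + 8 * (4 ^+ t * X) + 16 * (4 ^+ t * l)) / 4.
  by ring.
have -> : 8 * (2 * 2 ^+ t) * g = 16 * (2 ^+ t * g) by ring.
have -> : 8 * 2 ^+ t * g = 8 * (2 ^+ t * g) by ring.
have -> : 8 * (4 * 4 ^+ t) * l = 32 * (4 ^+ t * l) by ring.
have -> : 8 * 4 ^+ t * l = 8 * (4 ^+ t * l) by ring.
have -> : 4 * 4 ^+ t * Z = 4 * (4 ^+ t * Z) by ring.
by move=> h1 h2 h3; rewrite h3 in h2; lra.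
Qed.

End Levels.

End Splitting.

(** * Product of uniform laws *)

Section IntegralMonotonicity.
Local Open Scope ereal_scope.
Context {disp : measure_display} {T : measurableType disp} {R : realType}.
Variable mu : {measure set T -> \bar R}.

(* The library's [ge0_le_integral] requires the smaller function to be
   measurable. *)
Lemma ge0_le_integral_nonmeasurable (D : set T) (f g : T -> \bar R) :
  (forall x, D x -> 0 <= f x) -> (forall x, D x -> f x <= g x) ->
  \int[mu]_(x in D) f x <= \int[mu]_(x in D) g x.
Proof.
move=> f0 fg.
have f0' x : 0 <= (f \_ D) x by rewrite patchE; case: ifPn => // /[!inE] /f0.
have fg' x : (f \_ D) x <= (g \_ D) x by rewrite !patchE; case: ifPn => // /[!inE] /fg.
have g0' x : 0 <= (g \_ D) x by exact: le_trans (fg' x).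
rewrite /integral; apply: leeB.
  apply: ereal_sup_le => _ [h hf <-]; exists h => //= x; apply: le_trans (hf x) _.
  rewrite !funeposE; move: (f0' x) (g0' x) (fg' x) => f0x g0x fgx.
  by rewrite !max_l.
apply: ereal_sup_le => _ [h hf <-]; exists h => //= x; apply: le_trans (hf x) _.
rewrite !funenegE; move: (f0' x) (g0' x) => f0x g0x.
by rewrite !max_r ?oppe_le0.
Qed.

End IntegralMonotonicity.

(** * Rotations of the unit interval *)

Section UnitInterval.
Context {R : realType}.
Local Notation U := (uniform_prob (@ltr01 R)).
Local Notation T := (measurableTypeR R).

Lemma lebesgue_integral_shift (t : R) (f : T -> \bar R) :
  measurable_fun setT f -> (forall x, 0 <= f x)%E ->
  (\int[@lebesgue_measure R]_x f (x + t)%R = \int[@lebesgue_measure R]_x f x)%E.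
Proof.
move=> mf f0; pose sh : T -> T := fun x : R => x + t.
have msh : measurable_fun [set: T] sh by apply: measurable_funD.
have := ge0_integral_pushforward msh (@lebesgue_measure R) measurableT mf (fun x _ => f0 x).
rewrite preimage_setT => <-.
apply: (eq_measure_integral (@lebesgue_measure R)) => A mA _.
apply/esym; apply: (@lebesgue_measure_unique R (pushforward (@lebesgue_measure R) sh)) => // _ [[a b] _ <-].
rewrite /= /pushforward (_ : sh @^-1` _ = [set` `]a - t, b - t]]); last first.
  by apply/seteqP; split=> x; rewrite /= !in_itv /sh /= ltrBlDr lerBrDr.
rewrite !lebesgue_measure_itv /= !lte_fin ltrBlDr subrK.
by case: ifP => // _; rewrite -!EFinB; congr EFin; ring.
Qed.

(** The representative modulo 1 is taken in (0,1] rather than [0,1), to agree with dyadic intervals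
    that are closed on the right. *)
Definition frac1 (x : R) : R := x - (Num.ceil x)%:~R + 1.

Lemma frac1_bounds x : 0 < frac1 x <= 1.
Proof.
rewrite /frac1; have /andP[h1 h2] := ceil_itv x; move: h1; rewrite intrB.
by move=> h1; apply/andP; split; lra.
Qed.

Lemma frac1_shift (y : R) (k : int) : 0 < y <= 1 -> frac1 (y + k%:~R) = y.
Proof.
move=> /andP[y0 y1]; rewrite /frac1 (_ : Num.ceil _ = k + 1); first by rewrite intrD; ring.
by apply/eqP; rewrite ceil_eq addrK intrD; apply/andP; split; lra.
Qed.

Lemma frac1E x : exists k : int, x = frac1 x + k%:~R.
Proof. by exists (Num.ceil x - 1); rewrite /frac1 intrB; ring. Qed.

Lemma measurable_ceil : measurable_fun [set: R] (fun x : R => (Num.ceil x)%:~R : R).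
Proof.
apply: nondecreasing_measurable => // x y xy.
by rewrite ler_int le_ceil.
Qed.

Lemma measurable_frac1 : measurable_fun [set: R] frac1.
Proof.
apply: measurable_funD => //; apply: measurable_funB => //; exact: measurable_ceil.
Qed.

Lemma integral_uniform01 (f : T -> \bar R) :
  measurable_fun setT f -> (forall x, 0 <= f x)%E ->
  (\int[U]_x f x = \int[@lebesgue_measure R]_(x in `]0%R, 1%R]) f x)%E.
Proof.
move=> mf f0; rewrite integral_uniform// subr0 invr1 mul1e integral_itv_obnd_cbnd//.
exact: measurable_funTS.
Qed.

(** With u = [frac1 t], the interval (0,1] is cut at 1 - u: the left piece is translated by u onto
    (u,1], the right one by u - 1 onto (0,u]. *)
Lemma uniform_shift (t : R) (f : T -> \bar R) :
  measurable_fun setT f -> (forall x, 0 <= f x)%E ->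
  (\int[U]_x f (frac1 (x + t)) = \int[U]_x f x)%E.
Proof.
move=> mf f0.
have mft : measurable_fun [set: T] (fun x : T => f (frac1 (x + t))).
  apply: (measurableT_comp mf); apply: (measurableT_comp measurable_frac1).
  exact: measurable_funD.
rewrite !integral_uniform01// [LHS]integral_mkcond [RHS]integral_mkcond.
set u := frac1 t; have /andP[u0 u1] := frac1_bounds t.
have [k tE] := frac1E t; rewrite -/u in u0 u1 tE.
have pE : point = 0%E :> \bar R by [].
have ms (a b : R) : measurable (`]a, b] : set T) by exact: measurable_itv.
have mp (D : set T) : measurable D -> measurable_fun [set: T] (f \_ D).
  by move=> mD; apply/(measurable_restrictT _ mD); exact: measurable_funTS.
have p0 (D : set T) x : (0 <= (f \_ D) x)%E by rewrite patchE; case: ifP.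
pose Iu1 : set T := [set` `]u, 1]]; pose I0u : set T := [set` `]0, u]].
have -> : (fun x : T => f (frac1 (x + t))) \_ [set` `]0, 1]] =
    (fun x : T => (f \_ Iu1) (x + u)%R + (f \_ I0u) (x + (u - 1))%R)%E.
  apply/funext => x; rewrite !patchE /Iu1 /I0u !mem_setE !in_itv /= ?pE.
  have [x0|x0] := ltP 0 x; last first.
    rewrite /= ?pE; case: ifP => [/andP[h1 h2]|_]; first by exfalso; lra.
    by case: ifP => [/andP[h1 h2]|_]; [exfalso; lra|rewrite adde0].
  have [x1|x1] := leP x 1; last first.
    rewrite /= ?pE; case: ifP => [/andP[h1 h2]|_]; first by exfalso; lra.
    by case: ifP => [/andP[h1 h2]|_]; [exfalso; lra|rewrite adde0].
  rewrite /= ?pE; have [xu|xu] := leP (x + u) 1.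
    rewrite ifT; last by apply/andP; split; lra.
    rewrite ifF ?adde0; last by apply/negP => /andP[h1 h2]; exfalso; lra.
    by rewrite tE addrA frac1_shift//; apply/andP; split; lra.
  rewrite ifF; last by apply/negP => /andP[h1 h2]; exfalso; lra.
  rewrite ifT ?add0e; last by apply/andP; split; lra.
  have -> : x + t = x + (u - 1) + (k + 1)%:~R by rewrite tE intrD; ring.
  by rewrite frac1_shift//; apply/andP; split; lra.
have m1 : measurable_fun [set: T] (fun x : T => (f \_ Iu1) (x + u)).
  by apply: (measurableT_comp (mp _ (ms u 1))); exact: measurable_funD.
have m2 : measurable_fun [set: T] (fun x : T => (f \_ I0u) (x + (u - 1))).
  by apply: (measurableT_comp (mp _ (ms 0 u))); exact: measurable_funD.
rewrite (ge0_integralD (@lebesgue_measure R) measurableT (fun x _ => p0 _ _) m1 (fun x _ => p0 _ _) m2).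
rewrite (lebesgue_integral_shift u (mp _ (ms u 1)))// (lebesgue_integral_shift _ (mp _ (ms 0 u)))//.
rewrite -(ge0_integralD (@lebesgue_measure R) measurableT (fun x _ => p0 _ _) (mp _ (ms u 1))
  (fun x _ => p0 _ _) (mp _ (ms 0 u))).
apply: eq_integral => x _; rewrite !patchE /Iu1 /I0u !mem_setE !in_itv /= ?pE.
have [x0|x0] := ltP 0 x; have [xu|xu] := ltP u x; have [x1|x1] := leP x 1 => //=;
  rewrite ?adde0 ?add0e//; exfalso; lra.
Qed.

End UnitInterval.

Lemma integral_prob_cst {disp : measure_display} {T : measurableType disp} {R : realType}
    (P : probability T R) (a : R) : (\int[P]_x a%:E = a%:E)%E.
Proof. by rewrite integral_cst//= probability_setT mule1. Qed.

(** * Powers of a probability measure *)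

Section TupleProbability.
Context {disp : measure_display} {T : measurableType disp} {R : realType}.
Variable P : probability T R.
Local Open Scope ereal_scope.

Lemma measurable_tcons_fun n (f : n.+1.-tuple T -> \bar R) :
  measurable_fun setT f -> measurable_fun setT (fun x : T * n.-tuple T => f (tcons x)).
Proof. by move=> mf; apply: (measurableT_comp mf); exact: measurable_tcons. Qed.

Lemma tuple_probS n (f : n.+1.-tuple T -> \bar R) :
  measurable_fun setT f -> (forall x, 0 <= f x) ->
  \int[tuple_prob P n.+1]_x f x = \int[P]_x \int[tuple_prob P n]_y f (tcons (x, y)).
Proof.
move=> mf f0; rewrite /= ge0_integral_distribution//.
rewrite (fubini_tonelli1 (fun x => f (tcons x)))//; exact: measurable_tcons_fun.
Qed.

Lemma measurable_tuple_probS n (f : n.+1.-tuple T -> \bar R) :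
  measurable_fun setT f -> (forall x, 0 <= f x) ->
  measurable_fun setT (fun x => \int[tuple_prob P n]_y f (tcons (x, y))).
Proof.
move=> mf f0; apply: (@measurable_fun_fubini_tonelli_F _ _ _ _ _ (tuple_prob P n) (fun x => f (tcons x))) => //.
exact: measurable_tcons_fun.
Qed.

Lemma tuple_prob_map n (S : 'I_n -> T -> T) (f : n.-tuple T -> \bar R) :
  (forall i, measurable_fun setT (S i)) ->
  (forall i (g : T -> \bar R), measurable_fun setT g -> (forall x, 0 <= g x) ->
     \int[P]_x g (S i x) = \int[P]_x g x) ->
  measurable_fun setT f -> (forall x, 0 <= f x) ->
  \int[tuple_prob P n]_x f [tuple S i (tnth x i) | i < n] = \int[tuple_prob P n]_x f x.
Proof.
elim: n S f => [|n IH] S f mS SP mf f0.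
  by apply: eq_integral => x _; congr f; rewrite tuple0; apply: val_inj; case: x => -[].
have mT k (S' : 'I_k -> T -> T) : (forall i, measurable_fun setT (S' i)) ->
    measurable_fun setT (fun x : k.-tuple T => [tuple S' i (tnth x i) | i < k]).
  move=> mS'; apply/measurable_fun_tnthP => i.
  rewrite (_ : _ \o _ = fun x : k.-tuple T => S' i (tnth x i)).
    by apply: (measurableT_comp (mS' i)); exact: measurable_tnth.
  by apply/funext => x /=; rewrite tnth_mktuple.
have mfS : measurable_fun setT (fun x => f [tuple S i (tnth x i) | i < n.+1]).
  exact: measurableT_comp (mT _ _ mS).
rewrite (tuple_probS mfS (fun x => f0 _)) (tuple_probS mf f0).
pose S' i := S (lift ord0 i).
have mcons x0 : measurable_fun setT (fun y : n.-tuple T => f (tcons (x0, y))).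
  apply: (measurableT_comp mf); apply: (measurableT_comp (@measurable_tcons _ T n)).
  exact: pair1_measurable.
transitivity (\int[P]_x0 \int[tuple_prob P n]_y f (tcons (S ord0 x0, y))).
  apply: eq_integral => x0 _.
  rewrite -(IH S' (fun y => f (tcons (S ord0 x0, y))))//.
  - apply: eq_integral => y _; congr f; apply: eq_from_tnth => i.
    rewrite tnth_mktuple; case: (unliftP ord0 i) => [j ->|->].
      by rewrite /tcons !tnthS /= tnth_mktuple.
    by rewrite /tcons !tnth0.
  - by move=> i; exact: mS.
  - by move=> i; exact: SP.
rewrite (SP ord0 (fun x => \int[tuple_prob P n]_y f (tcons (x, y))))//.
  exact: measurable_tuple_probS.
by move=> x; apply: integral_ge0 => y _.
Qed.

(* The cross terms vanish because F has mean zero. *)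
Lemma tuple_prob_sqr_sum n (F : T -> R) :
  measurable_fun setT F -> P.-integrable setT (EFin \o F) ->
  P.-integrable setT (fun x => (F x ^+ 2)%:E) -> \int[P]_x (F x)%:E = 0 ->
  \int[tuple_prob P n]_Z ((\sum_(i < n) F (tnth Z i)) ^+ 2)%:E
  = n%:R%:E * \int[P]_x (F x ^+ 2)%:E.
Proof.
move=> mF iF iF2 F0.
have mS k : measurable_fun setT (fun Z : k.-tuple T => (\sum_(i < k) F (tnth Z i))%R).
  by apply: measurable_sum => i; apply: (measurableT_comp mF); exact: measurable_tnth.
have mS2 k : measurable_fun setT (fun Z : k.-tuple T => ((\sum_(i < k) F (tnth Z i)) ^+ 2)%:E).
  by apply/measurable_EFinP; apply: measurable_funX; exact: mS.
have S0 k (Z : k.-tuple T) : 0 <= ((\sum_(i < k) F (tnth Z i)) ^+ 2)%:E by rewrite lee_fin sqr_ge0.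
elim: n => [|n IH].
  rewrite mul0e; under eq_integral do rewrite big_ord0 expr0n.
  by rewrite integral0.
rewrite tuple_probS//.
rewrite (fubini_tonelli (m1 := P) (m2 := tuple_prob P n)
  (fun z => ((\sum_(i < n.+1) F (tnth (tcons z) i)) ^+ 2)%:E))//; last first.
  exact: (measurable_tcons_fun (mS2 n.+1)).
have inner (c : R) : \int[P]_x ((F x + c) ^+ 2)%:E = \int[P]_x (F x ^+ 2)%:E + (c ^+ 2)%:E.
  have ic : P.-integrable setT (fun=> (c ^+ 2)%:E) by exact: finite_measure_integrable_cst.
  have iZ : P.-integrable setT (fun x => (2 * c)%:E * (F x)%:E) by exact: integrableZl.
  transitivity (\int[P]_x ((F x ^+ 2)%:E + ((2 * c)%:E * (F x)%:E + (c ^+ 2)%:E))).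
    by apply: eq_integral => x _; rewrite -EFinM -!EFinD; congr EFin; ring.
  rewrite integralD//; last exact: integrableD.
  by rewrite integralD// integralZl// F0 mule0 add0e integral_prob_cst.
transitivity (\int[tuple_prob P n]_y (\int[P]_x (F x ^+ 2)%:E + ((\sum_(i < n) F (tnth y i)) ^+ 2)%:E)).
  apply: eq_integral => y _; rewrite -inner; apply: eq_integral => x _.
  congr ((_ ^+ 2)%:E); rewrite big_ord_recl; congr (F _ + _)%R.
  by apply: eq_bigr => i _; rewrite /tcons tnthS.
have V0 : 0 <= \int[P]_x (F x ^+ 2)%:E by apply: integral_ge0 => x _; rewrite lee_fin sqr_ge0.
have Vfin := integrable_fin_num measurableT iF2; rewrite -(fineK Vfin) in V0 IH *.
move: (fine _) V0 IH => V V0 IH.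
rewrite (ge0_integralD (tuple_prob P n) measurableT (fun _ _ => V0) (measurable_cst _)
  (fun Z _ => S0 n Z) (mS2 n)).
by rewrite IH integral_prob_cst -!EFinM -EFinD -natr1; congr EFin; ring.
Qed.

End TupleProbability.

(** * Trigonometric polynomials on the cube *)

Section Exponential.
Context {R : realType}.
Local Notation Re := complex.Re.
Local Notation Im := complex.Im.

Definition expi (t : R) : R[i] := Complex (cos (2 * pi * t)) (sin (2 * pi * t)).

Definition normsq (z : R[i]) : R := Re z ^+ 2 + Im z ^+ 2.

Lemma normsq_ge0 z : 0 <= normsq z.
Proof. by rewrite addr_ge0 ?sqr_ge0. Qed.

Lemma normsqM z w : normsq (z * w) = normsq z * normsq w.
Proof. by case: z w => [a b] [c d]; rewrite /normsq /=; ring. Qed.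

Lemma normsq0 : normsq 0 = 0.
Proof. by rewrite /normsq /= expr0n addr0. Qed.

Lemma normsq1 : normsq 1 = 1.
Proof. by rewrite /normsq /= expr0n expr1n addr0. Qed.

Lemma normsq_prod (I : Type) (r : seq I) (F : I -> R[i]) :
  normsq (\prod_(i <- r) F i) = \prod_(i <- r) normsq (F i).
Proof. exact: (big_morph _ normsqM normsq1). Qed.

Lemma normsq_expi t : normsq (expi t) = 1.
Proof. exact: cos2Dsin2. Qed.

Lemma normc_sqr (z : R[i]) : Normc.normc z ^+ 2 = normsq z.
Proof. by case: z => a b; rewrite /Normc.normc sqr_sqrtr// addr_ge0 ?sqr_ge0. Qed.

Lemma expiD s t : expi (s + t) = expi s * expi t.
Proof.
by apply/eqP; rewrite eq_complex /= mulrDr cosD sinD; apply/andP; split; apply/eqP; ring.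
Qed.

Lemma expi0 : expi 0 = 1.
Proof. by rewrite /expi mulr0 cos0 sin0. Qed.

Lemma expi_int (m : int) : expi m%:~R = 1.
Proof.
have e1 : expi 1 = 1 by rewrite /expi mulr1 mulr_natl cos2pi sin2pi.
have en (n : nat) : expi n%:R = 1.
  by elim: n => [|n IH]; rewrite ?expi0// -natr1 expiD IH e1 mulr1.
case: m => n; first exact: en.
have h := expiD (- n.+1%:R) n.+1%:R; rewrite addNr expi0 en mulr1 in h.
by rewrite NegzE mulrNz h.
Qed.

Lemma expi_half : expi 2^-1 = -1.
Proof.
rewrite /expi mulrAC divff// mul1r cospi sinpi.
by apply/eqP; rewrite eq_complex /= oppr0 !eqxx.
Qed.

Lemma norm_sin_le (x : R) : `|sin x| <= `|x|.
Proof.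
wlog x0 : x / 0 <= x.
  move=> h; have [|x0] := leP 0 x; first exact: h.
  by rewrite -normrN -sinN -[leRHS]normrN; apply: h; rewrite oppr_ge0 ltW.
have [c _] := @MVT_segment R sin cos 0 x x0 (fun y _ => is_derive_sin y)
  (continuous_subspaceT (@continuous_sin R)).
rewrite sin0 !subr0 => ->; rewrite normrM -[leRHS]mul1r ler_wpM2r//.
by rewrite ler_norml cos_geN1 cos_le1.
Qed.

Lemma normsq_expiB s t : normsq (expi s - expi t) = 4 * sin (pi * (s - t)) ^+ 2.
Proof.
rewrite (_ : expi s - expi t = expi t * (expi (s - t) - 1)); last first.
  by rewrite mulrBr mulr1 -expiD (_ : t + (s - t) = s)//; ring.
rewrite normsqM normsq_expi mul1r /normsq /= subr0.
have -> : 2 * pi * (s - t) = pi * (s - t) *+ 2 by rewrite mulr2n; ring.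
have := cos2Dsin2 (pi * (s - t)); rewrite mulr2n cosD sinD.
move: (cos _) (sin _) => c z h; have -> : c * c = 1 - z ^+ 2 by rewrite -h; ring.
have -> : (z * c + c * z) ^+ 2 = 4 * z ^+ 2 * c ^+ 2 by ring.
by have -> : c ^+ 2 = 1 - z ^+ 2 by [rewrite -h; ring]; ring.
Qed.

Lemma normsq_expiB_le4 s t : normsq (expi s - expi t) <= 4.
Proof.
rewrite normsq_expiB; have := cos2Dsin2 (pi * (s - t)).
by move=> h; have := sqr_ge0 (cos (pi * (s - t))); lra.
Qed.

Lemma normsq_expiB_sqr s t : normsq (expi s - expi t) <= 64 * (s - t) ^+ 2.
Proof.
rewrite normsq_expiB; have h : sin (pi * (s - t)) ^+ 2 <= (pi * (s - t)) ^+ 2.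
  by rewrite -real_normK ?num_real// -[leRHS]real_normK ?num_real// lerXn2r ?nnegrE// norm_sin_le.
have p4 : pi <= 4 :> R by have := @pihalf_lt2 R; lra.
have p0 := @pi_ge0 R.
have : (pi : R) ^+ 2 <= 16 by have := ler_pM p0 p0 p4 p4; rewrite -expr2; lra.
move/(ler_wpM2r (sqr_ge0 (s - t))); rewrite -exprMn; lra.
Qed.

(** min(4, 64 u^2) <= 16 u, the switch being at u = 1/4. A bound of degree one is needed because
    [weight] controls the sum of the |k_j| but not their squares. *)
Lemma normsq_expiB_norm s t : normsq (expi s - expi t) <= 16 * `|s - t|.
Proof.
have := normsq_expiB_le4 s t; have := normsq_expiB_sqr s t.
rewrite -[(s - t) ^+ 2]real_normK ?num_real//; have : 0 <= `|s - t| by [].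
move: `|s - t| (normsq _) => u v u0 h1 h2.
have [ul|ul] := leP u (4^-1); nra.
Qed.

End Exponential.

(** * Translations of the torus, orthogonality of modes, trigonometric polynomials *)

Section Torus.
Context {R : realType} {d : nat}.
Local Notation pt := (@pt R d).
Local Notation mu := (@unif_cube R d).
Local Notation Re := complex.Re.
Local Notation Im := complex.Im.

Local Notation Cube := (@cube R d).

Definition dotk (k : frequency d) (x : pt) : R := \sum_j (k j)%:~R * coordinate x j.

Lemma fourier_modeE k x : fourier_mode k x = expi (dotk k x).
Proof. by []. Qed.

Definition cshift (t x : pt) : pt := [tuple frac1 (tnth x j + tnth t j) | j < d].

Definition padd (t x : pt) : pt := [tuple tnth x j + tnth t j | j < d].

Lemma dotkD k t x : dotk k (padd t x) = dotk k x + dotk k t.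
Proof.
rewrite /dotk -big_split; apply: eq_bigr => j _ /=.
by rewrite /coordinate tnth_mktuple mulrDr.
Qed.

Lemma expi_cshift k t x : expi (dotk k (cshift t x)) = expi (dotk k x) * expi (dotk k t).
Proof.
rewrite -expiD -dotkD.
have [m ->] : exists m : int, dotk k (padd t x) = dotk k (cshift t x) + m%:~R.
  have h j : exists m : int, coordinate (padd t x) j = coordinate (cshift t x) j + m%:~R.
    by rewrite /coordinate !tnth_mktuple; exact: frac1E.
  exists (\sum_j k j * projT1 (cid (h j))).
  rewrite /dotk rmorph_sum -big_split; apply: eq_bigr => j _ /=.
  by rewrite rmorphM -mulrDr; congr (_ * _); exact: (projT2 (cid (h j))).
by rewrite expiD expi_int mulr1.
Qed.

Lemma measurable_coordinate j : measurable_fun setT (fun x : pt => coordinate x j).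
Proof. exact: (measurable_tnth j). Qed.

Lemma measurable_cshift t : measurable_fun setT (cshift t).
Proof.
apply/measurable_fun_tnthP => j.
rewrite (_ : _ \o _ = fun x : pt => frac1 (coordinate x j + tnth t j)).
  apply: (measurableT_comp measurable_frac1); apply: measurable_funD => //.
  exact: measurable_coordinate.
by apply/funext => x /=; rewrite tnth_mktuple.
Qed.

Lemma ge0_integral_cshift t (f : pt -> \bar R) :
  measurable_fun setT f -> (forall x, 0 <= f x)%E ->
  (\int[mu]_x f (cshift t x) = \int[mu]_x f x)%E.
Proof.
move=> mf f0; have := @tuple_prob_map _ _ R (uniform_prob (@ltr01 R)) d (fun j x => frac1 (x + tnth t j)) f.
apply=> //.
  by move=> j; apply: (measurableT_comp measurable_frac1); exact: measurable_funD.
by move=> j g mg g0; exact: uniform_shift.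
Qed.

Lemma integral_cshift t (f : pt -> \bar R) : measurable_fun setT f ->
  (\int[mu]_x f (cshift t x) = \int[mu]_x f x)%E.
Proof.
move=> mf; rewrite integralE [RHS]integralE.
rewrite (funepos_comp f (cshift t)) (funeneg_comp f (cshift t)).
congr (_ - _)%E; apply: ge0_integral_cshift => //.
- exact: measurable_funepos.
- exact: measurable_funeneg.
Qed.

Lemma cube_cshift t x : cube (cshift t x).
Proof.
move=> j; rewrite /coordinate tnth_mktuple.
by have /andP[/ltW -> ->] := frac1_bounds (tnth x j + tnth t j).
Qed.

Lemma measurable_cube : measurable (@cube R d).
Proof.
rewrite (_ : Cube = \bigcap_(j in [set: 'I_d]) ((fun x : pt => coordinate x j) @^-1` `[0, 1])).
  apply: fin_bigcap_measurable; first exact: finite_finset.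
  by move=> j _; rewrite -[X in measurable X]setTI; apply: measurable_coordinate => //; exact: measurable_itv.
apply/seteqP; split=> x /=; first by move=> h j _ /=; rewrite in_itv /=; exact: h.
by move=> h j; have := h j I; rewrite /= in_itv.
Qed.

(** The shift by zero folds every point into the cube and preserves integrals, so both integrands
    agree everywhere after folding. *)
Lemma integral_cube (f : pt -> \bar R) : measurable_fun setT f ->
  (\int[mu]_(x in Cube) f x = \int[mu]_x f x)%E.
Proof.
move=> mf; pose z : pt := [tuple 0 | j < d].
have mfc : measurable_fun setT (f \_ Cube).
  by apply/(measurable_restrictT _ measurable_cube); exact: measurable_funTS.
rewrite integral_mkcond -(integral_cshift z mfc) -[RHS](integral_cshift z mf).
by apply: eq_integral => x _; rewrite patchE mem_set//; exact: cube_cshift.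
Qed.

Lemma Rintegral_cshift t (f : pt -> R) : measurable_fun setT f ->
  \int[mu]_x f (cshift t x) = \int[mu]_x f x.
Proof.
by move=> mf; rewrite /Rintegral (integral_cshift t (f := EFin \o f))//; exact/measurable_EFinP.
Qed.

Definition tame (f : pt -> R) : Prop :=
  measurable_fun setT f /\ exists M, forall x, `|f x| <= M.

Lemma tame_integrable f : tame f -> mu.-integrable setT (EFin \o f).
Proof.
move=> [mf [M fM]]; apply: measurable_bounded_integrable => //.
  by apply: le_lt_trans (probability_le1 mu measurableT) _; exact: ltry.
by exists M; split; [exact: num_real|move=> x Mx y _; exact: le_trans (fM y) (ltW Mx)].
Qed.

Lemma tameD f g : tame f -> tame g -> tame (fun x => f x + g x).
Proof.
move=> [mf [M fM]] [mg [N gN]]; split; first exact: measurable_funD.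
by exists (M + N) => x; apply: le_trans (ler_normD _ _) _; apply: lerD.
Qed.

Lemma tameM f g : tame f -> tame g -> tame (fun x => f x * g x).
Proof.
move=> [mf [M fM]] [mg [N gN]]; split; first exact: measurable_funM.
by exists (M * N) => x; rewrite normrM ler_pM.
Qed.

Lemma tame_cst c : tame (fun=> c).
Proof. by split=> //; exists `|c|. Qed.

Lemma tame_sum (I : Type) (r : seq I) (F : I -> pt -> R) :
  (forall i, tame (F i)) -> tame (fun x => \sum_(i <- r) F i x).
Proof.
move=> tF; elim: r => [|i r IH].
  by under eq_fun do rewrite big_nil; exact: tame_cst.
by under eq_fun do rewrite big_cons; exact: tameD.
Qed.

Lemma Rintegral_tame_sum (I : Type) (r : seq I) (F : I -> pt -> R) :
  (forall i, tame (F i)) ->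
  \int[mu]_x (\sum_(i <- r) F i x) = \sum_(i <- r) \int[mu]_x F i x.
Proof.
move=> tF; elim: r => [|i r IH].
  by under eq_Rintegral do rewrite big_nil; rewrite Rintegral_cst// mul0r big_nil.
under eq_Rintegral do rewrite big_cons.
rewrite RintegralD//; first by rewrite IH big_cons.
- exact: tame_integrable.
- by apply: tame_integrable; exact: tame_sum.
Qed.

Lemma Re_mul_expi (a : R[i]) t :
  Re (a * expi t) = Re a * cos (2 * pi * t) - Im a * sin (2 * pi * t).
Proof. by case: a. Qed.

Lemma measurable_Re_expi {d' : measure_display} {T : measurableType d'} (a : R[i]) (f : T -> R) :
  measurable_fun setT f -> measurable_fun setT (fun x => Re (a * expi (f x))).
Proof.
move=> mf; under eq_fun do rewrite Re_mul_expi.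
have m2 : measurable_fun setT (fun x => 2 * pi * f x) by exact: measurable_funM.
apply: measurable_funB; apply: measurable_funM => //.
- apply: (measurableT_comp _ m2); apply: continuous_measurable_fun; exact: continuous_cos.
- apply: (measurableT_comp _ m2); apply: continuous_measurable_fun; exact: continuous_sin.
Qed.

Lemma measurable_dotk {d' : measure_display} {T : measurableType d'} k (f : T -> pt) :
  (forall j, measurable_fun setT (fun x => coordinate (f x) j)) ->
  measurable_fun setT (fun x => dotk k (f x)).
Proof. by move=> mf; apply: measurable_sum => j; exact: measurable_funM. Qed.

Lemma tame_Re_expi (a : R[i]) k : tame (fun x => Re (a * expi (dotk k x))).
Proof.
split.
  by apply: measurable_Re_expi; apply: measurable_dotk => j; exact: measurable_coordinate.
exists (`|Re a| + `|Im a|) => x; rewrite Re_mul_expi.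
apply: le_trans (ler_normB _ _) _; rewrite !normrM.
apply: lerD; rewrite ler_piMr//; [exact: cos_max|exact: sin_max].
Qed.

(* Translating by 1/(2 k_j) in a coordinate j with k_j <> 0 changes the sign. *)
Definition half_period (k : frequency d) (j : 'I_d) : pt :=
  [tuple if i == j then (2 * (k j)%:~R)^-1 else 0 | i < d].

Lemma expi_half_period (k : frequency d) j x : k j != 0 ->
  expi (dotk k (cshift (half_period k j) x)) = - expi (dotk k x).
Proof.
move=> kj; rewrite expi_cshift (_ : dotk k (half_period k j) = 2^-1).
  by rewrite expi_half mulrN1.
rewrite /dotk (bigD1 j)//= big1 ?addr0 => [|i /negbTE ij].
  by rewrite /coordinate tnth_mktuple eqxx; field; rewrite intr_eq0.
by rewrite /coordinate tnth_mktuple ij mulr0.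
Qed.

Lemma integral_mode (a : R[i]) (k : frequency d) : k != [ffun=> 0] ->
  \int[mu]_x Re (a * expi (dotk k x)) = 0.
Proof.
move=> k0; have [j kj] : exists j, k j != 0.
  apply/existsP; move: k0; apply: contraR; rewrite negb_exists => /forallP h.
  by apply/eqP/ffunP => j; rewrite ffunE; apply/eqP; rewrite -[_ == _]negbK.
have [mf _] := tame_Re_expi a k.
have := Rintegral_cshift (half_period k j) mf.
have ReN (z : R[i]) : Re (- z) = -1 * Re z by case: z => u v; rewrite mulN1r.
under eq_Rintegral do rewrite expi_half_period// mulrN ReN.
rewrite RintegralZl//; last exact: (tame_integrable (tame_Re_expi a k)).
by move: (Rintegral _ _ _) => u; lra.
Qed.

Section TrigonometricPolynomials.
Context {X : finType} (kappa : X -> frequency d).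
Implicit Types a b : X -> R[i].

(** Taking real parts gives a real function for arbitrary coefficients, so no conjugate symmetry has
    to be tracked when they are multiplied by phases or box multipliers. *)
Definition trig a (x : pt) : R := \sum_i Re (a i * expi (dotk (kappa i) x)).

Lemma tame_trig a : tame (trig a).
Proof. by apply: tame_sum => i; exact: tame_Re_expi. Qed.

Lemma Re_sum (I : Type) (r : seq I) (F : I -> R[i]) :
  Re (\sum_(i <- r) F i) = \sum_(i <- r) Re (F i).
Proof. by apply: (big_morph (@complex.Re R)) => // -[? ?] [? ?]. Qed.

Hypothesis kappa_inj : injective kappa.

(** Parseval's identity for the complex sum A, together with (Re A)^2 <= |A|^2; the latter makes
    this an inequality. *)
Lemma trig_sqr_integral a :
  (\int[mu]_x (trig a x ^+ 2)%:E <= (\sum_i normsq (a i))%:E)%E.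
Proof.
pose A x := \sum_i a i * expi (dotk (kappa i) x).
have trigA x : trig a x = Re (A x) by rewrite Re_sum.
pose c i j := a i * (a j)^*%C.
have Re_conj (z w : R[i]) : normsq z = Re (z * z^*%C) /\ Re (z * w^*%C) = Re z * Re w + Im z * Im w.
  by case: z w => [u v] [u' v']; rewrite /normsq /=; split; ring.
pose dk (p : X * X) : frequency d := [ffun l => kappa p.1 l - kappa p.2 l].
have conjE t : (expi t)^*%C = expi (- t) :> R[i].
  by rewrite /expi mulrN cosN sinN.
have dkE (p : X * X) x : dotk (dk p) x = dotk (kappa p.1) x - dotk (kappa p.2) x.
  rewrite /dotk -sumrB; apply: eq_bigr => l _.
  by rewrite ffunE intrB mulrBl.
have AE x : normsq (A x) = \sum_(p : X * X) Re (c p.1 p.2 * expi (dotk (dk p) x)).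
  rewrite (Re_conj _ 0).1 /A rmorph_sum mulr_suml.
  rewrite -(pair_bigA _ (fun i j => Re (c i j * expi (dotk (dk (i, j)) x)))) /=.
  rewrite Re_sum; apply: eq_bigr => i _; rewrite mulr_sumr Re_sum; apply: eq_bigr => j _.
  by congr Re; rewrite dkE expiD -conjE rmorphM /c; ring.
have tR p : tame (fun x => Re (c p.1 p.2 * expi (dotk (dk p) x))) by exact: tame_Re_expi.
have IA : \int[mu]_x normsq (A x) = \sum_i normsq (a i).
  under eq_Rintegral do rewrite AE.
  rewrite Rintegral_tame_sum// -(pair_bigA _ (fun i j => \int[mu]_x Re (c i j * expi (dotk (dk (i, j)) x)))) /=.
  apply: eq_bigr => i _; rewrite (bigD1 i)//= big1 => [|j ji]; last first.
    apply: integral_mode; apply: contra ji => /eqP/ffunP h; apply/eqP/kappa_inj/ffunP => l.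
    by apply/eqP; have := h l; rewrite !ffunE /= => /eqP; rewrite subr_eq0 eq_sym.
  rewrite addr0; under eq_Rintegral => x _ do rewrite dkE subrr expi0 mulr1.
  rewrite Rintegral_cst// /c -(Re_conj _ 0).1.
  by have /= -> := probability_setT mu; rewrite mulr1.
have tA : tame (fun x => normsq (A x)).
  by under eq_fun do rewrite AE; exact: tame_sum.
rewrite -IA /Rintegral fineK; last exact: (integrable_fin_num measurableT (tame_integrable tA)).
apply: ge0_le_integral_nonmeasurable => x _; rewrite lee_fin ?sqr_ge0//.
by rewrite trigA /normsq lerDl sqr_ge0.
Qed.

Lemma measurable_trig {d' : measure_display} {T : measurableType d'} a (f : T -> pt) :
  (forall j, measurable_fun setT (fun x => coordinate (f x) j)) ->
  measurable_fun setT (fun x => trig a (f x)).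
Proof.
by move=> mf; apply: measurable_sum => i; apply: measurable_Re_expi; exact: measurable_dotk.
Qed.

Lemma trig_padd a t x : trig a (padd t x) = trig (fun i => a i * expi (dotk (kappa i) x)) t.
Proof. by apply: eq_bigr => i _; rewrite dotkD expiD mulrA. Qed.

Lemma trigB a b x : trig a x - trig b x = trig (fun i => a i - b i) x.
Proof.
rewrite /trig -sumrB; apply: eq_bigr => i _; rewrite mulrBl.
by case: (a i * _) (b i * _) => [? ?] [? ?].
Qed.

Lemma trig_cshift_padd a t x : trig a (padd t (cshift [tuple - tnth t j | j < d] x)) = trig a x.
Proof.
apply: eq_bigr => i _; congr (Re (_ * _)).
rewrite dotkD addrC expiD mulrC expi_cshift -mulrA -expiD.
rewrite (_ : dotk _ [tuple - tnth t j | j < d] = - dotk (kappa i) t) ?addNr ?expi0 ?mulr1//.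
by rewrite /dotk -sumrN; apply: eq_bigr => j _; rewrite /coordinate tnth_mktuple mulrN.
Qed.

Definition weight (k : frequency d) : R :=
  \sum_(u : {set 'I_d} | u != finset.set0) \prod_(j in u) `|k j|%:~R.

Lemma weight_ge0 k : 0 <= weight k.
Proof. by apply: sumr_ge0 => u _; apply: prodr_ge0 => j _; rewrite ler0z. Qed.

Lemma weight_ge_norm1 (k : frequency d) : \sum_j `|k j|%:~R <= weight k.
Proof.
pose im := [set [set j]%SET | j : 'I_d]%SET.
have -> : \sum_j `|k j|%:~R = \sum_(u in im) \prod_(j in u) `|k j|%:~R :> R.
  rewrite big_imset /=; last by move=> i j _ _; exact: set1_inj.
  by apply: eq_bigr => j _; rewrite big_set1.
rewrite /weight [leRHS](bigID (fun u => u \in im)) /= -[leLHS]addr0 lerD//.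
  rewrite le_eqVlt; apply/orP; left; apply/eqP; apply: eq_bigl => u.
  by case: (boolP (u \in im)) => [/imsetP[j _ ->]|]; rewrite ?andbF// andbT -card_gt0 cards1.
by apply: sumr_ge0 => u _; apply: prodr_ge0 => j _; rewrite ler0z.
Qed.

Lemma weight_ge1 (k : frequency d) : k != [ffun=> 0] -> 1 <= weight k.
Proof.
move=> k0; apply: le_trans (weight_ge_norm1 k).
have [j kj] : exists j, k j != 0.
  apply/existsP; move: k0; apply: contraR; rewrite negb_exists => /forallP h.
  by apply/eqP/ffunP => j; rewrite ffunE; apply/eqP; rewrite -[_ == _]negbK.
rewrite (bigD1 j)//= -[leLHS]addr0 lerD//; last by apply: sumr_ge0 => i _; rewrite ler0z.
by rewrite ler1z -gtz0_ge1 normr_gt0.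
Qed.

(** For fixed y and r the increment is a trigonometric polynomial in the shift t, so it can be
    bounded mode by mode; the mode k costs 16 |<k, y - r>| <= 16 eta times the sum of the |k_j|. *)
Lemma trig_increment a (y r : pt) (eta : R) : 0 <= eta ->
  (forall j, `|coordinate y j - coordinate r j| <= eta) ->
  (\int[mu]_t ((trig a (padd t y) - trig a (padd t r)) ^+ 2)%:E <=
    (16 * eta * \sum_i normsq (a i) * weight (kappa i))%:E)%E.
Proof.
move=> eta0 yr; under eq_integral do rewrite !trig_padd trigB.
apply: le_trans (trig_sqr_integral _) _; rewrite lee_fin mulr_sumr; apply: ler_sum => i _.
rewrite -mulrBr normsqM mulrCA ler_wpM2l ?normsq_ge0//.
apply: le_trans (normsq_expiB_norm _ _) _; rewrite -mulrA ler_wpM2l//.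
rewrite /dotk -sumrB; apply: le_trans (ler_norm_sum _ _ _) _.
apply: le_trans (ler_wpM2l eta0 (weight_ge_norm1 _)); rewrite mulr_sumr; apply: ler_sum => l _.
by rewrite -mulrBr normrM mulrC intr_norm ler_wpM2r.
Qed.

End TrigonometricPolynomials.

End Torus.

(** * Dyadic sampling *)

Section Dyadic.
Context {R : realType} (L : nat).
Local Notation Re := complex.Re.
Local Notation Im := complex.Im.
Implicit Types (y : R) (I : dyadic L) (k : int).

(** A ceiling minus one instead of a floor, because the intervals are open on the left; for y in
    (0,1] the absolute value changes nothing. *)
Definition dyadic_index (j : nat) y : nat := `|Num.ceil (2 ^+ j * y) - 1|%N.

Lemma dyadic_indexP j y (l : nat) : 0 < y <= 1 ->
  (l == dyadic_index j y) = (l%:R < 2 ^+ j * y <= l.+1%:R).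
Proof.
move=> /andP[y0 y1]; have c0 : (0 < Num.ceil (2 ^+ j * y)) by rewrite ceil_gt0 mulr_gt0 ?exprn_gt0.
have -> : (l%:R < 2 ^+ j * y <= l.+1%:R) = (Num.ceil (2 ^+ j * y) == l.+1).
  by rewrite ceil_eq (_ : (l.+1 : int) - 1 = l)//; lia.
by rewrite /dyadic_index; move: (Num.ceil _) c0 => c; lia.
Qed.

Lemma dyadic_index_lt j y : 0 < y <= 1 -> (dyadic_index j y < 2 ^ j)%N.
Proof.
move=> y01; have := dyadic_indexP j (dyadic_index j y) y01; rewrite eqxx => /esym /andP[h _].
rewrite -(ltr_nat R) natrX; apply: lt_le_trans h _.
by rewrite ler_piMr ?exprn_ge0//; case/andP: y01.
Qed.

Lemma dyadic_index_half j y : 0 < y <= 1 -> (dyadic_index j.+1 y)./2 = dyadic_index j y.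
Proof.
move=> y01; apply/eqP; rewrite dyadic_indexP//.
have := dyadic_indexP j.+1 (dyadic_index j.+1 y) y01; rewrite eqxx exprS => /esym.
set l := dyadic_index _ _ => /andP[h1 h2].
have l1 : (l./2.*2)%:R <= l%:R :> R by rewrite ler_nat; lia.
have l2 : l%:R <= (l./2.*2.+1)%:R :> R by rewrite ler_nat; lia.
move: l1 l2 h1 h2; rewrite -!natr1 -mul2n natrM => l1 l2 h1 h2.
by apply/andP; split; nra.
Qed.

Lemma dyadic_set_bounds I y : dyadic_set I y -> 0 < y <= 1.
Proof.
rewrite /dyadic_set /= in_itv /= => /andP[h1 h2]; apply/andP; split.
  by apply: le_lt_trans h1; rewrite divr_ge0 ?exprn_ge0.
apply: le_trans h2 _; rewrite ler_pdivrMr ?exprn_gt0// mul1r -natrX ler_nat.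
exact: ltn_ord.
Qed.

Lemma dyadic_setP I y : 0 < y <= 1 ->
  dyadic_set I y <-> nat_of_ord (tagged I) = dyadic_index (tag I) y.
Proof.
move=> y01; rewrite /dyadic_set /= in_itv /=.
rewrite ltr_pdivrMr ?exprn_gt0// ler_pdivlMr ?exprn_gt0// mulrC -dyadic_indexP//.
by split => /eqP.
Qed.

Definition sample (j : nat) y : R := (dyadic_index j y).+1%:R / 2 ^+ j.

Lemma sample_dist j y : 0 < y <= 1 -> `|y - sample j y| <= 2 ^- j.
Proof.
move=> y01; have := dyadic_indexP j (dyadic_index j y) y01; rewrite eqxx => /esym /andP[h1 h2].
have p2 : 0 < 2 ^+ j :> R by rewrite exprn_gt0.
rewrite distrC ger0_norm /sample; last by rewrite subr_ge0 ler_pdivlMr// mulrC.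
by rewrite lerBlDr ler_pdivrMr// mulrDl mulVf ?gt_eqF// -natr1; lra.
Qed.

Lemma measurable_sample : measurable_fun setT (sample L).
Proof.
have -> : sample L = fun y => (`|(Num.ceil (2 ^+ L * y))%:~R - 1| + 1) / 2 ^+ L.
  apply/funext => y; rewrite /sample /dyadic_index -natr1 natr_absz intr_norm.
  by rewrite intrB.
apply: measurable_funM => //; apply: measurable_funD => //.
apply: measurableT_comp => //; apply: measurable_funB => //.
by apply: (measurableT_comp measurable_ceil); exact: measurable_funM.
Qed.

(* The difference, on I, between the samples of t |-> expi (k t) at the levels j and
   j - 1, so that the sum over all levels telescopes to the sample at level L. *)
Definition haar_multiplier (I : dyadic L) k : R[i] :=
  if tag I == ord0 then 1
  else expi (k%:~R * ((tagged I).+1%:R / 2 ^+ tag I))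
     - expi (k%:~R * ((tagged I)./2.+1%:R / 2 ^+ (tag I).-1)).

Lemma haar_multiplier0 I : tag I != ord0 -> haar_multiplier I 0 = 0.
Proof. by move=> /negbTE I0; rewrite /haar_multiplier I0 !mul0r subrr. Qed.

Lemma sum_dyadic (V : nmodType) (F : dyadic L -> V) :
  \sum_I F I = \sum_(j < L.+1) \sum_(l < 2 ^ j) F (Tagged (fun j : 'I_L.+1 => 'I_(2 ^ j)) l).
Proof.
rewrite (sig_big_dep xpredT (fun _ => xpredT)
  (fun (j : 'I_L.+1) (l : 'I_(2 ^ j)) => F (Tagged (fun j : 'I_L.+1 => 'I_(2 ^ j)) l))) /=.
by apply: eq_bigr => -[j l].
Qed.

Lemma sum_haar_multiplier k y : 0 < y <= 1 ->
  \sum_I haar_multiplier I k * (nat_of_ord (tagged I) == dyadic_index (tag I) y)%:R =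
  expi (k%:~R * sample L y).
Proof.
move=> y01; rewrite sum_dyadic.
pose D j := if j == 0%N then 1 else
  expi (k%:~R * sample j y) - expi (k%:~R * sample j.-1 y) : R[i].
transitivity (\sum_(j < L.+1) D j).
  apply: eq_bigr => j _; rewrite (bigD1 (Ordinal (dyadic_index_lt j y01)))//= big1 => [|l].
    rewrite eqxx mulr1 addr0 /haar_multiplier /D /=.
    case: (eqVneq j ord0) => [->//|j0]; rewrite ifF; last by apply/negbTE.
    rewrite /sample -(dyadic_index_half j.-1 y01) prednK// lt0n; exact: j0.
  move=> ll; rewrite (_ : (_ == _) = false) ?mulr0//.
  by apply/negbTE; apply: contra ll => /eqP ll; apply/eqP/val_inj.
elim: (L) => [|n IH]; last first.
  by rewrite big_ord_recr /= IH /D /= addrC subrK.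
(* At level 0 the sampling point is 1, and [expi] is 1 at the integer k: this is why the trivial
   interval has multiplier 1. *)
rewrite big_ord1 /D /= /sample expr0 divr1.
have := dyadic_index_lt 0 y01; rewrite expn0 ltnS leqn0 => /eqP->.
by rewrite mulr1 expi_int.
Qed.

(** Let 2^J <= Q <= 2 * 2^J. Up to level J the bound 4 gives at most 8 * 2^J <= 8 Q; beyond it the
    bound Q^2/4^j gives at most Q^2/2^J <= 2 Q. *)
Lemma sum_dyadic_geometric (c : nat -> R) (Q m : nat) :
  (forall j, 0 <= c j <= 4) -> (forall j, c j <= Q%:R ^+ 2 / 4 ^+ j) ->
  \sum_(1 <= j < m.+1) 2 ^+ j * c j <= 10 * Q%:R.
Proof.
move=> c4 cQ; case: (posnP Q) => [Q0|Q0].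
  rewrite big1 ?mulr_ge0// => j _; have := cQ j; have /andP[c0 _] := c4 j.
  rewrite Q0 expr0n mul0r => cj; have -> : c j = 0 by apply/le_anti; rewrite cj c0.
  by rewrite mulr0.
pose J := trunc_log 2 Q; have /andP[J1 J2] := trunc_log_bounds (isT : (1 < 2)%N) Q0.
have {}J1 : 2 ^+ J <= Q%:R :> R by rewrite -natrX ler_nat.
have {}J2 : Q%:R <= 2 * 2 ^+ J :> R by rewrite -exprS -natrX ler_nat ltnW.
have p (j : nat) : 0 < 2 ^+ j :> R by rewrite exprn_gt0.
have low i : (i <= J)%N -> \sum_(1 <= j < i.+1) 2 ^+ j * c j <= 8 * 2 ^+ i.
  elim: i => [|i IH] iJ; first by rewrite big_geq// mulr_ge0.
  rewrite big_nat_recr//=; have /andP[_ ci] := c4 i.+1.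
  by have := IH (ltnW iJ); have := ler_wpM2l (ltW (p i.+1)) ci; rewrite exprS; have := p i; lra.
have high i : \sum_(1 <= j < (J + i).+1) 2 ^+ j * c j
    <= 8 * 2 ^+ J + Q%:R ^+ 2 * (2 ^- J - 2 ^- (J + i)).
  elim: i => [|i IH]; first by rewrite addn0 subrr mulr0 addr0 low.
  rewrite addnS big_nat_recr//=; have := ler_wpM2l (ltW (p (J + i).+1)) (cQ (J + i).+1).
  have -> : 2 ^+ (J + i).+1 * (Q%:R ^+ 2 / 4 ^+ (J + i).+1) = Q%:R ^+ 2 * 2 ^- (J + i).+1 :> R.
    have -> : 4 ^+ (J + i).+1 = 2 ^+ (J + i).+1 * 2 ^+ (J + i).+1 :> R.
      by rewrite -exprMn; congr (_ ^+ _); ring.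
    by field; rewrite gt_eqF.
  move: IH; have -> : 2 ^- (J + i) = 2 * 2 ^- (J + i).+1 :> R by rewrite exprS; field; rewrite gt_eqF.
  lra.
have last : Q%:R ^+ 2 * 2 ^- J <= 2 * Q%:R :> R.
  rewrite ler_pdivrMr// expr2 -mulrA mulrC mulrCA ler_wpM2l//; lra.
have [mJ|mJ] := leqP m J.
  apply: le_trans (low m mJ) _; have : 2 ^+ m <= 2 ^+ J :> R by rewrite ler_eXn2l// ltr1n.
  by have : 0 <= Q%:R :> R by []; lra.
rewrite -(subnKC (ltnW mJ)); apply: le_trans (high _) _.
have : 0 <= Q%:R ^+ 2 * 2 ^- (J + (m - J)) :> R by rewrite mulr_ge0 ?exprn_ge0// invr_ge0 ltW.
by rewrite mulrBr; lra.
Qed.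

(** The trivial interval contributes 1. Each of the 2^j multipliers of level j >= 1 has squared
    modulus at most min(4, 64 k^2/4^j), which is the situation of [sum_dyadic_geometric] with Q = 8
    |k|. *)
Lemma sum_normsq_haar k : \sum_I normsq (haar_multiplier I k) <= 1 + 80 * `|k|%:~R :> R.
Proof.
pose Q := (8 * `|k|)%N; pose c j : R := Num.min 4 (Q%:R ^+ 2 / 4 ^+ j).
have QE : Q%:R ^+ 2 = 64 * k%:~R ^+ 2 :> R.
  by rewrite /Q natrM exprMn natr_absz intr_norm real_normK ?num_real//; ring.
have c0 j : 0 <= c j <= 4.
  by rewrite /c le_min ge_min lexx ler0n/= divr_ge0 ?exprn_ge0.
have cQ j : c j <= Q%:R ^+ 2 / 4 ^+ j by rewrite /c ge_min lexx orbT.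
have := sum_dyadic_geometric L c0 cQ.
have -> : 10 * Q%:R = 80 * `|k|%:~R :> R by rewrite /Q natrM natr_absz; ring.
move=> h; rewrite sum_dyadic big_ord_recl; apply: lerD.
  by rewrite big_ord_recl big_ord0 addr0 /haar_multiplier /= normsq1.
apply: le_trans h; rewrite big_add1 big_mkord; apply: ler_sum => j _.
have -> : 2 ^+ j.+1 * c j.+1 = \sum_(l < 2 ^ j.+1) c j.+1.
  by rewrite sumr_const card_ord -natrX mulr_natl.
apply: ler_sum => l _; rewrite /haar_multiplier /= /c le_min normsq_expiB_le4/=.
apply: le_trans (normsq_expiB_sqr _ _) _.
rewrite QE -mulrA ler_wpM2l// -mulrBr exprMn ler_wpM2l ?sqr_ge0//.
have p2 : 0 < 2 ^+ j :> R by rewrite exprn_gt0.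
have -> : l.+1%:R / 2 ^+ bump 0 j - l./2.+1%:R / 2 ^+ j = (l.+1%:R - 2 * l./2.+1%:R) / 2 ^+ j.+1 :> R.
  by rewrite /bump /= add1n exprS; field; rewrite gt_eqF.
have -> : 4 ^- j.+1 = (2 ^- j.+1) ^+ 2 :> R.
  by rewrite exprVn -exprM mulnC exprM; congr ((_ ^+ _)^-1); ring.
rewrite exprMn ler_piMl ?sqr_ge0//.
(* An interval with l odd shares its right endpoint with its parent; for l even the two endpoints
   differ by one interval length. *)
have -> : l.+1%:R = 2 * l./2%:R + (odd l)%:R + 1 :> R.
  by rewrite -natr1 -[in LHS](odd_double_half l) natrD -mul2n natrM; ring.
rewrite -natr1; case: (odd l) => /=; nra.
Qed.

End Dyadic.

Lemma card_dyadic L : (#|{: dyadic L}| <= L.+1 * 2 ^ L)%N.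
Proof.
rewrite card_tagged sumnE big_map big_enum /=.
apply: (@leq_trans (\sum_(j < L.+1) 2 ^ L)); last by rewrite sum_nat_const card_ord.
by apply: leq_sum => j _; rewrite card_ord leq_exp2l// -ltnS.
Qed.

(** * Counting shifted boxes *)

Section ShiftedBoxes.
Context {R : realType} (d L s : nat).
Local Notation pt := (@pt R d).
Implicit Types (B : dyadic_box d L s) (tau z : pt).

Definition hit B (y : pt) : bool :=
  [forall j, nat_of_ord (tagged (val B j)) == dyadic_index (tag (val B j)) (coordinate y j)].

Lemma in_shifted_boxE tau B z :
  in_shifted_box tau B z = hit B (cshift [tuple - tnth tau j | j < d] z).
Proof.
apply: eq_forallb => j; rewrite /coordinate !tnth_mktuple.
have f01 := frac1_bounds (tnth z j - tnth tau j).
apply/asboolP/eqP => [[y yB [k zE]]|h].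
  have y01 := dyadic_set_bounds yB.
  have -> : tnth z j - tnth tau j = y + k%:~R by rewrite zE; ring.
  by rewrite frac1_shift//; exact/dyadic_setP.
exists (frac1 (tnth z j - tnth tau j)); first exact/dyadic_setP.
have [k kE] := frac1E (tnth z j - tnth tau j); exists k.
by rewrite addrAC -kE subrK.
Qed.

(** A box through z is determined by the levels of its sides, as one interval of each level contains
    a given coordinate; at most s of these levels are nonzero. *)
Lemma hits_le tau z : (hits L s tau z <= (d * L.+1).+1 ^ s)%N.
Proof.
pose lev (B : dyadic_box d L s) : {ffun 'I_d -> 'I_L.+1} := [ffun j => tag (val B j)].
have := support_card 'I_d (@ord0 L) s; rewrite !card_ord; apply: leq_trans.
rewrite /hits -(card_in_imset (f := lev)).
  apply/subset_leq_card/fintype.subsetP => _ /imsetP[B _ ->]; rewrite inE.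
  apply: leq_trans (valP B); apply/subset_leq_card/fintype.subsetP => j.
  by rewrite !inE ffunE.
move=> B B'; rewrite !inE !in_shifted_boxE => /forallP hB /forallP hB' /ffunP BB'.
apply/val_inj/ffunP => j; have := BB' j; rewrite !ffunE => tj.
have {hB hB'} := (eqP (hB j), eqP (hB' j)); move: tj.
case: (val B j) (val B' j) => [i l] [i' l'] /= ii'; rewrite -ii' in l' *.
by move=> [h h']; congr existT; apply: val_inj; rewrite /= h h'.
Qed.

(** A crude count is enough: the number of boxes is part of the dimension of the walk, which only
    enters through the logarithm in lambda. *)
Lemma card_dyadic_box : (#|{: dyadic_box d L s}| <= (d * (L.+1 * 2 ^ L)).+1 ^ s)%N.
Proof.
pose t0 : dyadic L := Tagged (fun j : 'I_L.+1 => 'I_(2 ^ j)) (ord0 : 'I_(2 ^ (@ord0 L))).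
apply: (@leq_trans ((d * #|{: dyadic L}|).+1 ^ s)%N); last first.
  have h : ((d * #|{: dyadic L}|).+1 <= (d * (L.+1 * 2 ^ L)).+1)%N.
    by rewrite ltnS leq_mul2l card_dyadic orbT.
  by case: (s) => // s'; rewrite leq_exp2r.
have := support_card 'I_d t0 s; rewrite card_ord; apply: leq_trans.
rewrite card_sig; apply/subset_leq_card/fintype.subsetP => B; rewrite !inE.
apply: leq_trans; apply/subset_leq_card/fintype.subsetP => j; rewrite !inE.
apply: contra => /eqP; rewrite /trivial_dyadic; case: (B j) => i l /= i0.
rewrite /t0; move: l; rewrite i0 => l; apply/eqP; congr existT; apply: val_inj => /=.
by apply/eqP; rewrite -leqn0 -ltnS.
Qed.

End ShiftedBoxes.

(** * Expansion of sampled modes in indicators of boxes *)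

Section Sampling.
Context {R : realType} (d L s : nat).
Local Notation pt := (@pt R d).
Local Notation Re := complex.Re.
Local Notation mu := (@unif_cube R d).

Definition order_at_most (k : frequency d) : bool := (#|[set j | k j != 0]%SET| <= s)%N.

Definition box_multiplier (B : {ffun 'I_d -> dyadic L}) (k : frequency d) : R[i] :=
  \prod_j haar_multiplier (B j) (k j).

Definition sample_pt (y : pt) : pt := [tuple sample L (tnth y j) | j < d].

(** Some coordinate has a non-trivial side of B and k_j = 0; the samples of a constant do not change
    between levels, so its factor is 0. This confines modes of order at most s to the available
    boxes. *)
Lemma box_multiplier_eq0 (B : {ffun 'I_d -> dyadic L}) (k : frequency d) : order_at_most k ->
  ~~ (#|[set j | ~~ trivial_dyadic (B j)]%SET| <= s)%N -> box_multiplier B k = 0.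
Proof.
move=> ks; rewrite -ltnNge => sB.
have [j Bj kj] : exists2 j, ~~ trivial_dyadic (B j) & k j = 0.
  have : ~~ ([set j | ~~ trivial_dyadic (B j)]%SET \subset [set j | k j != 0]%SET).
    by apply: contraL sB => /subset_leq_card h; rewrite -leqNgt; exact: leq_trans h ks.
  case/fintype.subsetPn => j; rewrite !inE => Bj; rewrite negbK => /eqP kj.
  by exists j.
by rewrite /box_multiplier (bigD1 j)//= kj haar_multiplier0// mul0r.
Qed.

(** Each factor of the mode is expanded by [sum_haar_multiplier], the product is multiplied out over
    all choices of sides, and boxes with too many non-trivial sides drop out. *)
Lemma expi_sample_pt (k : frequency d) (y : pt) : order_at_most k ->
  (forall j, 0 < coordinate y j <= 1) ->
  expi (dotk k (sample_pt y)) =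
  \sum_(B : dyadic_box d L s) box_multiplier (val B) k * (hit B y)%:R.
Proof.
move=> ks y01.
pose hitF (B : {ffun 'I_d -> dyadic L}) :=
  [forall j, nat_of_ord (tagged (B j)) == dyadic_index (tag (B j)) (coordinate y j)].
pose G B := box_multiplier B k * (hitF B)%:R.
transitivity (\sum_B G B); last first.
  rewrite (bigID (fun B : {ffun 'I_d -> dyadic L} => #|[set j | ~~ trivial_dyadic (B j)]%SET| <= s)%N) /=.
  rewrite [X in _ + X]big1 ?addr0 => [|B Bs]; last by rewrite /G box_multiplier_eq0// mul0r.
  exact: (big_sub (fun B : {ffun 'I_d -> dyadic L} => #|[set j | ~~ trivial_dyadic (B j)]%SET| <= s)%N G).
have -> : expi (dotk k (sample_pt y)) = \prod_j expi ((k j)%:~R * sample L (coordinate y j)).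
  rewrite /dotk (big_morph (@expi R) (@expiD R) (@expi0 R)).
  by apply: eq_bigr => j _; rewrite {1}/coordinate tnth_mktuple.
under eq_bigr do rewrite -sum_haar_multiplier//.
rewrite bigA_distr_bigA; apply: eq_bigr => B _; rewrite big_split /G; congr (_ * _).
rewrite /hitF; case: forallP => [h|h]; first by rewrite big1// => j _; rewrite h.
have /existsP[j hj] : [exists j, nat_of_ord (tagged (B j)) != dyadic_index (tag (B j)) (coordinate y j)].
  by rewrite -negb_forall; apply/negP => /forallP.
by rewrite (bigD1 j)//= (negbTE hj) mul0r.
Qed.

(** The sum over all boxes factors into at most the product of the 1 + 80 |k_j|. Multiplied out over
    sets J, only J inside the support of k survive, so 80^|J| <= 80^s; the empty set contributes 1
    <= [weight k], whence the factor 2. *)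
Lemma sum_normsq_box_multiplier (k : frequency d) : order_at_most k -> k != [ffun=> 0] ->
  \sum_(B : dyadic_box d L s) normsq (box_multiplier (val B) k) <= 2 * 80 ^+ s * weight k.
Proof.
move=> ks k0.
apply: (@le_trans _ _ (\sum_(B : {ffun 'I_d -> dyadic L}) normsq (box_multiplier B k))).
  rewrite -(big_sub (fun B : {ffun 'I_d -> dyadic L} => #|[set j | ~~ trivial_dyadic (B j)]%SET| <= s)%N
    (fun B => normsq (box_multiplier B k))) big_mkcond /=.
  by apply: ler_sum => B _; case: ifP => // _; exact: normsq_ge0.
under eq_bigr do rewrite normsq_prod.
rewrite -(bigA_distr_bigA (fun j I => normsq (haar_multiplier I (k j)))).
apply: (@le_trans _ _ (\prod_j (80 * `|k j|%:~R + 1))).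
  apply: ler_prod => j _; rewrite addrC sum_normsq_haar andbT.
  by apply: sumr_ge0 => I _; exact: normsq_ge0.
rewrite bigA_distr /=.
apply: (@le_trans _ _ (\sum_(J : {set 'I_d}) 80 ^+ s * \prod_(j in J) `|k j|%:~R)).
  apply: ler_sum => J _; rewrite -big_mkcond /= big_split /=.
  have [Js|Js] := boolP (J \subset [set j | k j != 0]%SET); last first.
    case/fintype.subsetPn: Js => j jJ; rewrite inE negbK => /eqP kj.
    by rewrite [X in _ * X](bigD1 j)//= kj normr0 mul0r mulr0 mulr_ge0// ?exprn_ge0//;
      apply: prodr_ge0 => i _; rewrite ler0z.
  apply: ler_wpM2r; first by apply: prodr_ge0 => i _; rewrite ler0z.
  rewrite prodr_const; apply: ler_weXn2l; first by rewrite ler1n.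
  exact: leq_trans (subset_leq_card Js) ks.
rewrite -mulr_sumr (bigD1 finset.set0)//= big_set0.
rewrite -/(weight k) mulrDr mulr1.
have w1 := weight_ge1 (R := R) k0; have e0 : 0 <= 80 ^+ s :> R by rewrite exprn_ge0.
by have := ler_wpM2l e0 w1; rewrite mulr1; lra.
Qed.

Section Decomposition.
Context {X : finType} (kappa : X -> frequency d) (a : X -> R[i]).
Hypotheses (kappa_inj : injective kappa)
  (a_low : forall i, a i = 0 \/ (order_at_most (kappa i) /\ kappa i != [ffun=> 0])).

Definition box_coef (B : dyadic_box d L s) (t : pt) : R :=
  trig kappa (fun i => a i * box_multiplier (val B) (kappa i)) t.

(* The value of the polynomial at the upper corner of the smallest shifted box
   containing z. *)
Definition sampled (t z : pt) : R :=
  trig kappa a (padd t (sample_pt (cshift [tuple - tnth t j | j < d] z))).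

Lemma cshift_bounds (t z : pt) j : 0 < coordinate (cshift t z) j <= 1.
Proof. by rewrite /coordinate tnth_mktuple; exact: frac1_bounds. Qed.

Lemma sampledE t z :
  sampled t z = \sum_B box_coef B t * (in_shifted_box t B z)%:R.
Proof.
rewrite /sampled trig_padd /box_coef /trig.
under [RHS]eq_bigr do rewrite mulr_suml.
rewrite exchange_big /=; apply: eq_bigr => i _.
case: (a_low i) => [->|[ki _]].
  by rewrite big1 => [|B _]; rewrite !mul0r //= mul0r.
rewrite expi_sample_pt//; last exact: cshift_bounds.
rewrite mulr_sumr mulr_suml Re_sum; apply: eq_bigr => B _.
rewrite -in_shifted_boxE; case: (in_shifted_box t B z); last by rewrite !mulr0n !mulr0 mul0r.
by rewrite !mulr1n !mulr1.
Qed.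

Lemma box_energy :
  (\int[mu]_t (\sum_B box_coef B t ^+ 2)%:E
   <= (2 * 80 ^+ s * \sum_i normsq (a i) * weight (kappa i))%:E)%E.
Proof.
have m2 B : measurable_fun setT (fun t => (box_coef B t ^+ 2)%:E).
  by apply/measurable_EFinP; apply: measurable_funX; exact: (tame_trig kappa _).1.
under eq_integral do rewrite -sumEFin.
rewrite ge0_integral_sum//; last by move=> B t _; rewrite lee_fin sqr_ge0.
apply: (@le_trans _ _ (\sum_(B : dyadic_box d L s)
   (\sum_i normsq (a i * box_multiplier (val B) (kappa i)))%:E)%E).
  by apply: lee_sum => B _; exact: trig_sqr_integral.
rewrite sumEFin lee_fin exchange_big mulr_sumr; apply: ler_sum => i _ /=.
under eq_bigr do rewrite normsqM.
rewrite -mulr_sumr mulrCA; case: (a_low i) => [->|[ki k0]]; first by rewrite normsq0 !mul0r.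
by rewrite ler_wpM2l ?normsq_ge0//; exact: sum_normsq_box_multiplier.
Qed.

Lemma sampling_error :
  (\int[mu]_t \int[mu]_z ((trig kappa a z - sampled t z) ^+ 2)%:E
   <= (16 * 2 ^- L * \sum_i normsq (a i) * weight (kappa i))%:E)%E.
Proof.
pose psi (p : pt * pt) : \bar R :=
  ((trig kappa a (padd p.1 p.2) - trig kappa a (padd p.1 (sample_pt p.2))) ^+ 2)%:E.
have psi0 p : (0 <= psi p)%E by rewrite lee_fin sqr_ge0.
have mpsi : measurable_fun setT psi.
  apply/measurable_EFinP; apply: measurable_funX; apply: measurable_funB; apply: measurable_trig => j.
    under eq_fun do rewrite /coordinate tnth_mktuple.
    apply: measurable_funD.
      exact: (measurableT_comp (measurable_tnth j) measurable_snd).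
    exact: (measurableT_comp (measurable_tnth j) measurable_fst).
  under eq_fun do rewrite /coordinate !tnth_mktuple.
  apply: measurable_funD.
    have m2 : measurable_fun setT (fun p : pt * pt => tnth p.2 j : R).
      exact: (measurableT_comp (measurable_tnth j) measurable_snd).
    exact: (measurableT_comp (measurable_sample L) m2).
  exact: (measurableT_comp (measurable_tnth j) measurable_fst).
(* The substitution y = z - t modulo 1 makes the grid independent of t, so that after Tonelli's
   theorem the shift is integrated for a fixed y. *)
have -> : (\int[mu]_t \int[mu]_z ((trig kappa a z - sampled t z) ^+ 2)%:E =
    \int[mu]_t \int[mu]_y psi (t, y))%E.
  apply: eq_integral => t _.
  rewrite -[RHS](ge0_integral_cshift [tuple - tnth t j | j < d]) //; last first.
    by apply: (measurableT_comp mpsi); exact: pair1_measurable.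
  by apply: eq_integral => z _; rewrite /psi /sampled /= trig_cshift_padd.
rewrite (fubini_tonelli (m1 := mu) (m2 := mu) psi mpsi psi0).
(* The zero shift puts y into (0,1]^d, where [sample_dist] applies. *)
rewrite -(ge0_integral_cshift [tuple 0 | j < d]); last 2 first.
- exact: measurable_fun_fubini_tonelli_G.
- by move=> y; apply: integral_ge0 => t _; exact: psi0.
rewrite -[leRHS](integral_prob_cst mu); apply: ge0_le_integral_nonmeasurable.
  by move=> y _; apply: integral_ge0 => t _; exact: psi0.
move=> z _; set y := cshift _ z; have eta0 : 0 <= 2 ^- L :> R by rewrite invr_ge0 exprn_ge0.
have ye j : `|coordinate y j - coordinate (sample_pt y) j| <= 2 ^- L.
  by rewrite [coordinate (sample_pt y) j]tnth_mktuple; apply: sample_dist; exact: cshift_bounds.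
exact: (trig_increment kappa_inj a eta0 ye).
Qed.

Lemma measurable_sampled : measurable_fun setT (fun p : pt * pt => sampled p.1 p.2).
Proof.
apply: measurable_trig => j; under eq_fun do rewrite /coordinate !tnth_mktuple.
have m1 : measurable_fun setT (fun p : pt * pt => tnth p.1 j : R).
  exact: (measurableT_comp (measurable_tnth j) measurable_fst).
have m2 : measurable_fun setT (fun p : pt * pt => tnth p.2 j : R).
  exact: (measurableT_comp (measurable_tnth j) measurable_snd).
have mB : measurable_fun setT (fun p : pt * pt => tnth p.2 j - tnth p.1 j : R).
  exact: measurable_funB.
apply: measurable_funD => //.
exact: (measurableT_comp (measurable_sample L) (measurableT_comp measurable_frac1 mB)).
Qed.

Lemma trig_energy : (\int[mu]_x (trig kappa a x ^+ 2)%:E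
  <= (\sum_i normsq (a i) * weight (kappa i))%:E)%E.
Proof.
apply: le_trans (trig_sqr_integral kappa_inj a) _; rewrite lee_fin; apply: ler_sum => i _.
case: (a_low i) => [->|[_ k0]]; first by rewrite normsq0 mul0r.
by rewrite ler_peMr ?normsq_ge0// weight_ge1.
Qed.

End Decomposition.
End Sampling.

(** * Mean square error for trigonometric polynomials *)

Lemma integral_prob_cste {disp : measure_display} {T : measurableType disp} {R : realType}
    (P : probability T R) (c : \bar R) : (0 <= c)%E -> (\int[P]_x c = c)%E.
Proof.
move=> c0; transitivity (\int[P]_x (c * 1%:E))%E.
  by apply: eq_integral => x _; rewrite mule1.
rewrite (@ge0_integralZl _ _ _ P setT measurableT (cst 1%:E))//.
by rewrite integral_prob_cst mule1.
Qed.

Section MeanSquare.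
Context {R : realType} (d s T : nat) (C : R) (delta : nat -> nat -> R).
Local Notation pt := (@pt R d).
Local Notation mu := (@unif_cube R d).
Local Notation n := (2 ^ T)%N.
Local Notation L := (level_bound d C n).

Hypothesis delta_bounds : forall m N, (1 < m * N)%N -> 0 < delta m N <= 2^-1.

Context {X : finType} (kappa : X -> frequency d) (a : X -> R[i]).
Hypotheses (kappa_inj : injective kappa)
  (a_low : forall i, a i = 0 \/ (order_at_most s (kappa i) /\ kappa i != [ffun=> 0])).

Variables (f g : pt -> R) (Lam : R).
Local Notation h := (trig kappa a).
Hypotheses (f_decomp : forall x, cube x -> f x - cube_integral f = g x + h x)
  (Lam_ge0 : 0 <= Lam)
  (Lam_bound : forall N, (2 < N <= 4 ^ T)%N ->
     let m := (N + #|{: dyadic_box d L s}|)%N in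
     walk_lambda (delta m N./2) (m * N./2) * (1 + ((d * L.+1).+1 ^ s)%:R) <= Lam).

Lemma errE (A : seq pt) : (0 < size A)%N -> (forall x, x \in A -> cube x) ->
  err A f = (size A)%:R^-1 * \sum_(x <- A) (g x + h x).
Proof.
move=> A0 Acube; rewrite /err.
have -> : \sum_(x <- A) (g x + h x) = \sum_(x <- A) f x - (size A)%:R * cube_integral f.
  rewrite (_ : (size A)%:R * _ = \sum_(x <- A) cube_integral f); last first.
    by rewrite big_const_seq count_predT iter_addr_0 mulr_natl.
  rewrite -sumrB big_seq [RHS]big_seq; apply: eq_bigr => x xA.
  by rewrite (f_decomp (Acube _ xA)).
by rewrite mulrBr mulKf// pnatr_eq0 -lt0n.
Qed.

Lemma mean_square_pointwise (tau : pt) (Z : (n ^ 2).-tuple pt) (i : 'I_n) :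
  (forall l, cube (tnth Z l)) ->
  0 <= expect (subgaussian_transference C s n delta tau Z)
    (fun As => err (nth [::] As i) f ^+ 2) <=
  n%:R ^- 4 * (\sum_(l < n ^ 2) (g (tnth Z l) + h (tnth Z l))) ^+ 2
  + (8 * n%:R ^- 3 * \sum_(l < n ^ 2)
       (2 * g (tnth Z l) ^+ 2 + 2 * (h (tnth Z l) - sampled L kappa a tau (tnth Z l)) ^+ 2)
  + 8 * n%:R ^- 2 * (Lam * \sum_(B : dyadic_box d L s) box_coef kappa a B tau ^+ 2)).
Proof.
move=> Zcube; set F := fun x => g x + h x.
pose G x := g x + (h x - sampled L kappa a tau x).
pose theta B := @box_coef R d L s X kappa a B tau.
have F_G z : z \in (Z : seq pt) -> F z = G z + \sum_B theta B * (in_shifted_box tau B z)%:R.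
  by move=> _; rewrite /F /G (sampledE L a_low); ring.
have hitsS z : z \in (Z : seq pt) ->
    1 + (hits L s tau z)%:R <= 1 + ((d * L.+1).+1 ^ s)%:R :> R.
  by move=> _; rewrite lerD2l ler_nat hits_le.
have sZ : size Z = (4 ^ T)%N by rewrite size_tuple -expnM mulnC expnM.
have sup := supported_levels delta_bounds sZ Lam_ge0 hitsS F_G (leqnn T).
have sq := levels_square delta_bounds sZ Lam_ge0 hitsS F_G Lam_bound (leqnn T) (ltn_ord i).
rewrite /subgaussian_transference trunc_expnK//.
set N := n%:R : R; have N0 : 0 < N by rewrite ltr0n expn_gt0.
have -> : expect (levels L s delta tau T Z) (fun As => err (nth [::] As i) f ^+ 2) =
    N ^- 2 * expect (levels L s delta tau T Z) (fun As => (\sum_(z <- nth [::] As i) F z) ^+ 2).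
  rewrite -expectZ; apply: (eq_expect_supported sup) => As [sAs okAs].
  have [sA subA] : size (nth [::] As i)%SEQ = (2 ^ (T + (T - T)))%N /\ {subset nth [::] As i <= Z}.
    by apply/okAs/mem_nth; rewrite sAs.
  rewrite subnn addn0 in sA; rewrite errE; last 2 first.
  - by rewrite sA expn_gt0.
  - by move=> x /subA /tnthP[l ->].
  by rewrite sA exprMn exprVn.
have E0 : 0 <= expect (levels L s delta tau T Z) (fun As => (\sum_(z <- nth [::] As i) F z) ^+ 2).
  rewrite -[leLHS](mul0r (expect (levels L s delta tau T Z) (fun=> 1))) -expectZ.
  by apply: (le_expect sup) => As _; rewrite mul0r sqr_ge0.
apply/andP; split; first by rewrite mulr_ge0// invr_ge0 exprn_ge0// ltW.
have N2 : 2 ^+ T = N by rewrite /N natrX.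
have N4 : 4 ^+ T = N ^+ 2 by rewrite -N2 -exprM mulnC exprM; congr (_ ^+ _); ring.
move: sq; rewrite N2 N4; set E := expect _ _ in E0 * => sq.
have GE : \sum_(z <- Z) G z ^+ 2 <= \sum_(l < n ^ 2)
    (2 * g (tnth Z l) ^+ 2 + 2 * (h (tnth Z l) - sampled L kappa a tau (tnth Z l)) ^+ 2).
  rewrite big_tuple; apply: ler_sum => l _; rewrite /G.
  move: (g _) (h _ - _) => u v; have := sqr_ge0 (u - v); lra.
have FE : \sum_(z <- Z) F z = \sum_(l < n ^ 2) (g (tnth Z l) + h (tnth Z l)) by rewrite big_tuple.
rewrite -FE; move: sq GE; rewrite -/theta.
move: (\sum_(z <- Z) F z) (\sum_(z <- Z) G z ^+ 2) (\sum_(l < n ^ 2) _) (Lam * _).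
move=> u v w l sq vw.
have Ni : 0 < N^-1 by rewrite invr_gt0.
have : N ^- 4 * (N ^+ 2 * E) <= N ^- 4 * (u ^+ 2 + 8 * N * w + 8 * N ^+ 2 * l).
  apply: ler_wpM2l; first by rewrite invr_ge0 exprn_ge0// ltW.
  apply: le_trans sq _; rewrite lerD2r lerD2l; apply: ler_wpM2l => //.
  by rewrite mulr_ge0// ltW.
have -> : N ^- 4 * (N ^+ 2 * E) = N ^- 2 * E by field; rewrite gt_eqF.
have -> : N ^- 4 * (u ^+ 2 + 8 * N * w + 8 * N ^+ 2 * l) =
   N ^- 4 * u ^+ 2 + (8 * N ^- 3 * w + 8 * N ^- 2 * l) by field; rewrite gt_eqF.
by [].
Qed.

Let scale_sum_le (u : R) : 0 <= u -> u <= 1 -> u * u * 2 + 16 * u <= 18 * u.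
Proof. by move=> u0 u1; nra. Qed.

(** Used with u = 1/n, v = 2^-L, p = 80^s and l = Lam: 258 is 2, from the initial sample, plus 16 *
    16, from the sampling error. *)
Let energy_sum_le (u v p l S : R) : 0 <= u -> v <= u -> 0 <= S ->
  u * u * (2 * S) + (16 * u * (16 * v * S) + 8 * (u * u) * l * (2 * p * S))
  <= (258 + 16 * p * l) * (u * u) * S.
Proof.
move=> u0 vu S0; have := ler_wpM2l (mulr_ge0 u0 S0) vu; lra.
Qed.

Local Open Scope ereal_scope.

Hypotheses (g_meas : measurable_fun setT g)
  (gh_sqr : mu.-integrable setT (fun x => ((g x + h x) ^+ 2)%:E))
  (gh_int : mu.-integrable setT (fun x => (g x + h x)%:E))
  (gh_mean : \int[mu]_x (g x + h x)%:E = 0).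

Lemma integral_tuple_tnth (N : nat) (l : 'I_N) (phi : pt -> \bar R) :
  measurable_fun setT phi -> (forall x, 0 <= phi x) ->
  \int[tuple_prob mu N]_Z phi (tnth Z l) = \int[mu]_x phi x.
Proof.
move=> mphi phi0; elim: N l => [[]//|N IH] l.
have m k (l' : 'I_k) : measurable_fun setT (fun Z : k.-tuple pt => phi (tnth Z l')).
  by apply: (measurableT_comp mphi); exact: measurable_tnth.
rewrite tuple_probS//; case: (unliftP ord0 l) => [j ->|->].
  transitivity (\int[mu]_x \int[mu]_z phi z).
    apply: eq_integral => x _; rewrite -(IH j); apply: eq_integral => y _.
    by rewrite /tcons tnthS.
  by apply: integral_prob_cste; apply: integral_ge0.
apply: eq_integral => x _; rewrite -[RHS](integral_prob_cste (tuple_prob mu N))//.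
Qed.

Lemma integral_tuple_sum (N : nat) (phi : pt -> R) :
  measurable_fun setT phi -> (forall x, 0 <= phi x)%R ->
  \int[tuple_prob mu N]_Z (\sum_(l < N) phi (tnth Z l))%:E = N%:R%:E * \int[mu]_x (phi x)%:E.
Proof.
move=> mphi phi0; under eq_integral do rewrite -sumEFin.
have mE : measurable_fun setT (EFin \o phi) by exact/measurable_EFinP.
rewrite ge0_integral_sum//; last 2 first.
- by move=> l; apply: (measurableT_comp mE); exact: measurable_tnth.
- by move=> l Z _; rewrite lee_fin.
rewrite (eq_bigr (fun=> \int[mu]_x (phi x)%:E)); last first.
  by move=> l _; exact: (integral_tuple_tnth l mE).
by rewrite sumr_const card_ord mule_natl.
Qed.

Lemma le_integral_setT {d' : measure_display} {S : measurableType d'}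
    (nu : {measure set S -> \bar R}) (D : set S) (u v : S -> \bar R) :
  (forall x, D x -> 0 <= u x <= v x) -> (forall x, 0 <= v x) ->
  \int[nu]_(x in D) u x <= \int[nu]_x v x.
Proof.
move=> uv v0; rewrite integral_mkcond; apply: ge0_le_integral_nonmeasurable => x _.
  by rewrite patchE; case: ifPn => // /[!inE] /uv /andP[].
by rewrite patchE; case: ifPn => [/[!inE] /uv /andP[]|_]; last exact: v0.
Qed.

Let A1 : \bar R := \int[mu]_x ((g x + h x) ^+ 2)%:E.
Let V : \bar R := \int[mu]_x (g x ^+ 2)%:E.
Let err2 tau z : R := ((h z - sampled L kappa a tau z) ^+ 2)%R.
Let energy tau : R := (\sum_(B : dyadic_box d L s) box_coef kappa a B tau ^+ 2)%R.
Let n' : R := n%:R.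

Let m_h : measurable_fun setT h := (tame_trig kappa a).1.

Let m_err2 tau : measurable_fun setT (err2 tau).
Proof.
apply: measurable_funX; apply: measurable_funB => //.
exact: (measurableT_comp (f := fun p : pt * pt => sampled L kappa a p.1 p.2)
  (g := fun z => (tau, z)) (measurable_sampled L kappa a) (pair1_measurable tau)).
Qed.

(** The mean of g + h is zero, so the squared sum over n^2 independent points has expectation n^2
    A1, and n^-4 leaves n^-2. The other sum has n^2 equal terms, whence 8 n^-3 * n^2 * 2 = 16/n. *)
Lemma inner_integral tau :
  \int[tuple_prob mu (n ^ 2)]_Z
     (n' ^- 4 * (\sum_(l < n ^ 2) (g (tnth Z l) + h (tnth Z l))) ^+ 2
      + (8 * n' ^- 3 * \sum_(l < n ^ 2)
           (2 * g (tnth Z l) ^+ 2 + 2 * err2 tau (tnth Z l))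
      + 8 * n' ^- 2 * (Lam * energy tau)))%:E
  = (n' ^- 2)%:E * A1 + ((16 * n'^-1)%:E * V + ((16 * n'^-1)%:E * \int[mu]_z (err2 tau z)%:E
      + (8 * n' ^- 2 * Lam)%:E * (energy tau)%:E)).
Proof.
pose phi z : R := (2 * g z ^+ 2 + 2 * err2 tau z)%R.
have phi0 z : (0 <= phi z)%R by rewrite addr_ge0// mulr_ge0// sqr_ge0.
have mphi : measurable_fun setT phi.
  apply: measurable_funD; apply: measurable_funM => //; exact: measurable_funX.
have mgh : measurable_fun setT (fun x => g x + h x)%R by exact: measurable_funD.
have n0 : (0 <= n')%R by [].
have msum (psi : pt -> R) : measurable_fun setT psi ->
    measurable_fun setT (fun Z : (n ^ 2).-tuple pt => \sum_(l < n ^ 2) psi (tnth Z l))%R.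
  move=> mpsi; apply: measurable_sum => l; apply: (measurableT_comp mpsi); exact: measurable_tnth.
have energy0 : (0 <= energy tau)%R by apply: sumr_ge0 => B _; exact: sqr_ge0.
have c0 k : (0 <= 8 * n' ^- k)%R by rewrite mulr_ge0// invr_ge0 exprn_ge0.
have c1 : (0 <= n' ^- 4)%R by rewrite invr_ge0 exprn_ge0.
transitivity ((n' ^- 4)%:E * (\int[tuple_prob mu (n ^ 2)]_Z
      ((\sum_(l < n ^ 2) (g (tnth Z l) + h (tnth Z l))) ^+ 2)%:E)
    + ((8 * n' ^- 3)%:E * (\int[tuple_prob mu (n ^ 2)]_Z (\sum_(l < n ^ 2) phi (tnth Z l))%:E)
    + (8 * n' ^- 2 * (Lam * energy tau))%:E)).
  under eq_integral do rewrite !EFinD [X in X + _]EFinM [X in _ + (X + _)]EFinM.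
  rewrite ge0_integralD//=.
  - rewrite ge0_integralZl//=; last 2 first.
    + by apply/measurable_EFinP/measurable_funX; exact: (msum _ mgh).
    + by move=> Z _; rewrite lee_fin sqr_ge0.
    congr (_ + _); rewrite ge0_integralD//=.
    + rewrite ge0_integralZl//=; last 3 first.
      * by apply/measurable_EFinP; exact: (msum _ mphi).
      * by move=> Z _; rewrite lee_fin sumr_ge0// => l _; exact: phi0.
      * by rewrite lee_fin.
      by rewrite integral_prob_cst.
    + by move=> Z _; rewrite -EFinM lee_fin mulr_ge0// sumr_ge0// => l _; exact: phi0.
    + by apply: measurable_funeM; apply/measurable_EFinP; exact: (msum _ mphi).
    + by move=> Z _; rewrite lee_fin; apply: mulr_ge0 => //; exact: mulr_ge0.
  - by move=> Z _; rewrite -EFinM lee_fin mulr_ge0// sqr_ge0.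
  - by apply: measurable_funeM; apply/measurable_EFinP/measurable_funX; exact: (msum _ mgh).
  - move=> Z _; rewrite -EFinM -EFinD lee_fin; apply: addr_ge0; apply: mulr_ge0 => //.
      by apply: sumr_ge0 => l _; exact: phi0.
    exact: mulr_ge0.
  - apply: emeasurable_funD => //.
    by apply: measurable_funeM; apply/measurable_EFinP; exact: (msum _ mphi).
rewrite (tuple_prob_sqr_sum _ mgh gh_int gh_sqr gh_mean) integral_tuple_sum//.
have n1 : n' != 0%R by rewrite pnatr_eq0 -lt0n expn_gt0.
have -> : \int[mu]_x (phi x)%:E = 2%:E * V + 2%:E * \int[mu]_z (err2 tau z)%:E.
  under eq_integral do rewrite EFinD [X in X + _]EFinM [X in _ + X]EFinM.
  rewrite ge0_integralD//=.
  - rewrite ge0_integralZl//=; last 2 first.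
    + by apply/measurable_EFinP/measurable_funX.
    + by move=> z _; rewrite lee_fin sqr_ge0.
    rewrite ge0_integralZl//=.
    + by apply/measurable_EFinP; exact: m_err2.
    + by move=> z _; rewrite lee_fin sqr_ge0.
  - by move=> z _; rewrite -EFinM lee_fin mulr_ge0// sqr_ge0.
  - by apply: measurable_funeM; apply/measurable_EFinP/measurable_funX.
  - by move=> z _; rewrite -EFinM lee_fin mulr_ge0// sqr_ge0.
  - by apply: measurable_funeM; apply/measurable_EFinP; exact: m_err2.
rewrite -/A1 muleA -EFinM; congr (_%:E * _ + _).
  by rewrite natrX -/n'; field.
have V0 : 0 <= V by apply: integral_ge0 => z _; rewrite lee_fin sqr_ge0.
have E0 : 0 <= \int[mu]_z (err2 tau z)%:E by apply: integral_ge0 => z _; rewrite lee_fin sqr_ge0.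
rewrite muleA -EFinM ge0_muleDr ?mule_ge0// !muleA -!EFinM natrX -/n' -addeA.
have -> : (8 * n' ^- 3 * n' ^+ 2 * 2 = 16 * n'^-1)%R by field.
by rewrite mulrA.
Qed.

Let Sigma : R := (\sum_i normsq (a i) * weight (kappa i))%R.

Let Sigma_ge0 : (0 <= Sigma)%R.
Proof. by apply: sumr_ge0 => i _; rewrite mulr_ge0// ?normsq_ge0 ?weight_ge0. Qed.

Let V_ge0 : 0 <= V. Proof. by apply: integral_ge0 => x _; rewrite lee_fin sqr_ge0. Qed.

Let energy_ge0 tau : (0 <= energy tau)%R.
Proof. by apply: sumr_ge0 => B _; exact: sqr_ge0. Qed.

Let A1_le : A1 <= 2%:E * V + (2 * Sigma)%:E.
Proof.
have := trig_energy kappa_inj a_low; rewrite -/Sigma => hS.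
apply: (@le_trans _ _ (2%:E * V + 2%:E * \int[mu]_x (h x ^+ 2)%:E)); last first.
  by rewrite leeD2l// EFinM lee_pmul2l.
rewrite -!ge0_integralZl//=.
- rewrite -ge0_integralD//=.
  + apply: ge0_le_integral_nonmeasurable => x _; rewrite ?lee_fin ?sqr_ge0//.
    by have := sqr_ge0 (g x - h x)%R; lra.
  + by move=> x _; rewrite -EFinM lee_fin mulr_ge0// sqr_ge0.
  + by apply: measurable_funeM; apply/measurable_EFinP/measurable_funX.
  + by move=> x _; rewrite -EFinM lee_fin mulr_ge0// sqr_ge0.
  + by apply: measurable_funeM; apply/measurable_EFinP/measurable_funX.
- by apply/measurable_EFinP/measurable_funX.
- by move=> x _; rewrite lee_fin sqr_ge0.
- by apply/measurable_EFinP/measurable_funX.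
- by move=> x _; rewrite lee_fin sqr_ge0.
Qed.

Lemma mean_square_trig (i : 'I_n) : (n%:R <= 2 ^+ L :> R)%R ->
  mean_square_err C s delta i f <=
  (18 / n')%:E * V + ((258 + 16 * 80 ^+ s * Lam) * n' ^- 2 * Sigma)%:E.
Proof.
move=> nL.
have n0 : (0 < n')%R by rewrite ltr0n expn_gt0.
pose v tau := (n' ^- 2)%:E * A1 + ((16 * n'^-1)%:E * V
  + ((16 * n'^-1)%:E * \int[mu]_z (err2 tau z)%:E + (8 * n' ^- 2 * Lam)%:E * (energy tau)%:E)).
have A1_0 : 0 <= A1 by apply: integral_ge0 => x _; rewrite lee_fin sqr_ge0.
have c2 : (0 <= n' ^- 2)%R by rewrite invr_ge0 exprn_ge0// ltW.
have i0 : (0 <= n'^-1)%R by rewrite invr_ge0 ltW.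
have c16 : (0 <= 16 * n'^-1)%R by rewrite mulr_ge0// invr_ge0 ltW.
have c8 : (0 <= 8 * n' ^- 2 * Lam)%R by rewrite !mulr_ge0.
have err2_0 tau : 0 <= \int[mu]_z (err2 tau z)%:E.
  by apply: integral_ge0 => z _; rewrite lee_fin sqr_ge0.
have v0 tau : 0 <= v tau by rewrite !adde_ge0// mule_ge0// lee_fin.
apply: (@le_trans _ _ (\int[mu]_tau v tau)).
  apply: le_integral_setT => // tau _.
  apply/andP; split.
    apply: integral_ge0 => Z Zc; rewrite lee_fin.
    by have /andP[] := mean_square_pointwise tau i Zc.
  rewrite /v -inner_integral; apply: le_integral_setT => Z.
    by move=> Zc; rewrite !lee_fin; exact: mean_square_pointwise.
  have p0 k : (0 <= n' ^- k)%R by rewrite invr_ge0 exprn_ge0// ltW.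
  rewrite lee_fin; apply: addr_ge0; first by rewrite mulr_ge0// sqr_ge0.
  apply: addr_ge0; apply: mulr_ge0; rewrite ?mulr_ge0//.
  by apply: sumr_ge0 => l _; rewrite addr_ge0// mulr_ge0// sqr_ge0.
have merr : measurable_fun setT (fun tau => \int[mu]_z (err2 tau z)%:E).
  apply: (@measurable_fun_fubini_tonelli_F _ _ _ _ _ mu (fun p : pt * pt => (err2 p.1 p.2)%:E)).
    apply/measurable_EFinP/measurable_funX; apply: measurable_funB.
      by apply: (measurableT_comp m_h); exact: measurable_snd.
    exact: measurable_sampled.
  by move=> p; rewrite lee_fin sqr_ge0.
have men : measurable_fun setT (fun tau => (energy tau)%:E).
  apply/measurable_EFinP; apply: measurable_sum => B; apply: measurable_funX.
  exact: (tame_trig _ _).1.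
rewrite /v ge0_integralD//=; last 3 first.
- by move=> tau _; rewrite mule_ge0.
- by move=> tau _; rewrite !adde_ge0// mule_ge0// lee_fin.
- by apply: emeasurable_funD => //; apply: emeasurable_funD; exact: measurable_funeM.
rewrite integral_prob_cste ?mule_ge0// ge0_integralD//=; last 3 first.
- by move=> tau _; rewrite mule_ge0.
- by move=> tau _; rewrite !adde_ge0// mule_ge0// lee_fin.
- by apply: emeasurable_funD; exact: measurable_funeM.
rewrite integral_prob_cste ?mule_ge0// ge0_integralD//=; last 4 first.
- by move=> tau _; rewrite mule_ge0.
- exact: measurable_funeM.
- by move=> tau _; rewrite mule_ge0// lee_fin.
- exact: measurable_funeM.
rewrite !ge0_integralZl//=; last first.
  by move=> tau _; rewrite lee_fin.
have := sampling_error L a kappa_inj; rewrite -/Sigma => se.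
have := box_energy L kappa_inj a_low; rewrite -/Sigma => be.
apply: (@le_trans _ _ ((n' ^- 2)%:E * (2%:E * V + (2 * Sigma)%:E) + ((16 * n'^-1)%:E * V
  + ((16 * n'^-1)%:E * (16 * 2 ^- L * Sigma)%:E
  + (8 * n' ^- 2 * Lam)%:E * (2 * 80 ^+ s * Sigma)%:E)))).
  apply: leeD; first exact: lee_wpmul2l.
  by rewrite leeD2l//; apply: leeD; apply: lee_wpmul2l.
rewrite ge0_muleDr ?mule_ge0 ?lee_fin ?mulr_ge0// muleA -!EFinM -EFinD addeACA.
rewrite -ge0_muleDl ?lee_fin ?mulr_ge0//.
have i_le : (2 ^- L <= n'^-1)%R by rewrite lef_pV2 ?posrE// (lt_le_trans n0).
have i1 : (n'^-1 <= 1)%R by rewrite invf_le1// ler1n expn_gt0.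
have i2 : (n' ^- 2 = n'^-1 * n'^-1)%R by rewrite expr2 invfM.
rewrite i2 -!EFinD; apply: leeD.
  by apply: lee_wpmul2r => //; rewrite lee_fin; exact: scale_sum_le.
by rewrite lee_fin; exact: energy_sum_le.
Qed.

End MeanSquare.

(** * Size of the logarithmic factors *)

Section ParameterBounds.
Context {R : realType}.

Lemma ln_ge0_nat (k : nat) : 0 <= ln k%:R :> R.
Proof. by case: k => [|k]; [rewrite ln0|rewrite ln_ge0// ler1n]. Qed.

Lemma ler_ln_nat (k l : nat) : (0 < k <= l)%N -> ln k%:R <= ln l%:R :> R.
Proof. by case/andP=> k0 kl; rewrite ler_ln ?posrE ?ltr0n ?ler_nat//; exact: leq_trans kl. Qed.

Lemma lnM_nat (k l : nat) : (0 < k)%N -> (0 < l)%N -> ln (k * l)%:R = ln k%:R + ln l%:R :> R.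
Proof. by move=> k0 l0; rewrite natrM lnM// posrE ltr0n. Qed.

Lemma lnX_nat (k e : nat) : (0 < k)%N -> ln (k ^ e)%:R = e%:R * ln k%:R :> R.
Proof. by move=> k0; rewrite natrX lnXn ?ltr0n// mulr_natl. Qed.

Lemma ln_nat_lt (k : nat) : ln k.+1%:R <= k%:R :> R.
Proof.
have k1 : -1 < k%:R :> R by apply: (@lt_le_trans _ _ 0) => //; rewrite ltrN10.
by rewrite -natr1 addrC; exact: le_ln1Dx.
Qed.

Lemma expn_le (k l e : nat) : (k <= l)%N -> (k ^ e <= l ^ e)%N.
Proof. by case: e => // e kl; rewrite leq_exp2r. Qed.

Variables (C D : R) (s T d : nat) (delta : nat -> nat -> R).
Local Notation n := (2 ^ T)%N.
Local Notation L := (level_bound d C n).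
Let x : R := ln (d * n)%:R.

Hypotheses (C_ge2 : 2 <= C) (d_gt0 : (0 < d)%N) (T_gt0 : (0 < T)%N).

Let dn_ge2 : (2 <= d * n)%N.
Proof. by apply: (@leq_trans (1 * 2 ^ 1)) => //; rewrite leq_mul// leq_exp2l. Qed.

Let x_ge : 2^-1 <= x.
Proof. by apply: le_trans ln2_ge_half _; apply: (ler_ln_nat (k := 2)). Qed.

Let L_bounds : C * x <= L%:R < C * x + 1.
Proof.
have c0 : 0 <= C * x by rewrite mulr_ge0//; [have := C_ge2|have := x_ge]; lra.
have -> : L%:R = (Num.ceil (C * x))%:~R :> R.
  by rewrite /level_bound natr_absz ger0_norm// ceil_ge0//; apply: lt_le_trans c0; rewrite ltrN10.
by have /andP[h ->] := ceil_itv (C * x); move: h; rewrite intrB ltrBlDr.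
Qed.

(** L ln 2 >= C ln(dn)/2 >= ln(dn); this is where C >= 2 is used to make the grid fine enough. *)
Lemma level_bound_scale : n%:R <= 2 ^+ L :> R.
Proof.
apply: (@le_trans _ _ (d * n)%:R); first by rewrite ler_nat leq_pmull.
have h2 : (0 < d * n)%N := ltnW dn_ge2.
rewrite -natrX -ler_ln ?posrE ?ltr0n ?expn_gt0// lnX_nat//.
have /andP[cL _] := L_bounds; have l2 := @ln2_ge_half R; have xg := x_ge; have c2 := C_ge2.
apply: (@le_trans _ _ (L%:R * 2^-1)); last by rewrite ler_wpM2l.
apply: (@le_trans _ _ (C * x * 2^-1)); last by rewrite ler_wpM2r.
by rewrite -/x; nra.
Qed.

(** The ceiling and the summand 2 add less than 3, and 3 <= 6 x since x >= ln 2 >= 1/2. *)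
Lemma level_bound_le : L%:R + 2 <= (C + 6) * x.
Proof. have /andP[_] := L_bounds; have := x_ge; lra. Qed.

Lemma hits_bound_le : 1 + ((d * L.+1).+1 ^ s)%:R <= 2 * (C + 6) ^+ s * d%:R ^+ s * x ^+ s :> R.
Proof.
have Ll := level_bound_le; have xg := x_ge; have c2 := C_ge2.
have d1 : 1 <= d%:R :> R by rewrite ler1n.
have h : ((d * L.+1).+1)%:R <= (C + 6) * d%:R * x.
  apply: (@le_trans _ _ (d%:R * (L%:R + 2))); last by nra.
  by rewrite -natr1 natrM -(natr1 L); lra.
have h' : ((d * L.+1).+1 ^ s)%:R <= (C + 6) ^+ s * d%:R ^+ s * x ^+ s.
  by rewrite natrX -!exprMn lerXn2r// nnegrE//; apply: le_trans h.
have : 1 <= ((d * L.+1).+1 ^ s)%:R :> R by rewrite ler1n expn_gt0.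
by rewrite -!mulrA (mulrCA 2) in h' *; lra.
Qed.

Hypothesis delta_bounds : forall m N : nat, (1 < m * N)%N ->
   0 < delta m N <= 2^-1 /\ ln (delta m N)^-1 <= D * ln (m * N)%:R.

(** From the logarithm of (dn)^5 (dn * 4^(L+1))^s, which bounds dimension times number of walk
    vectors, using ln 4 <= 3 and L + 1 <= (C + 6) x. *)
Let K1 : R := 5 + s%:R + 3 * s%:R * (C + 6).

Lemma card_bound_le (N : nat) : (2 < N <= 4 ^ T)%N ->
  let m := (N + #|{: dyadic_box d L s}|)%N in
  (1 < m * N./2)%N /\ ln (m * N./2)%:R <= K1 * x.
Proof.
case/andP=> N2 N4 m.
have N1 : (0 < N./2)%N by lia.
have m1 : (1 < m)%N by rewrite /m; lia.
split; first by nia.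
have nE : (4 ^ T = n ^ 2)%N by rewrite -expnM mulnC expnM.
have q2 := dn_ge2.
have Nq : (N <= (d * n) ^ 2)%N.
  by rewrite (leq_trans N4)// nE leq_sqr leq_pmull.
set A := ((d * n * 4 ^ L.+1) ^ s)%N.
have cA : (#|{: dyadic_box d L s}| <= A)%N.
  apply: leq_trans (card_dyadic_box d L s) _; apply: expn_le.
  have p2 : (L.+1 <= 2 ^ L)%N by exact: ltn_expl.
  have -> : (4 ^ L.+1 = 4 * (2 ^ L * 2 ^ L))%N by rewrite expnS -expnMn.
  have : (d <= d * n)%N by rewrite leq_pmulr// expn_gt0.
  move: (2 ^ L)%N (d * n)%N p2 q2 => p q p2 q2 dq; have : (L.+1 * p <= p * p)%N by nia.
  have : (0 < L.+1 * p)%N by nia.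
  by move: (L.+1 * p)%N (p * p)%N => u v; nia.
have A0 : (0 < A)%N by rewrite /A expn_gt0 muln_gt0 (ltnW q2) expn_gt0.
have mA : (m * N./2 <= (d * n) ^ 5 * A)%N.
  have Nh : (N./2 <= (d * n) ^ 2)%N by lia.
  have mh : (m <= (d * n) ^ 3 * A)%N.
    have Nq' : (0 < (d * n) ^ 2)%N by rewrite expn_gt0 (ltnW q2).
    have h1 : (N <= (d * n) ^ 2 * A)%N by apply: leq_trans Nq _; rewrite leq_pmulr.
    have h2 : (#|{: dyadic_box d L s}| <= (d * n) ^ 2 * A)%N.
      by apply: leq_trans cA _; rewrite leq_pmull.
    apply: (leq_trans (leq_add h1 h2)); rewrite addnn -mul2n (expnS _ 2) -(mulnA (d * n)%N).
    by rewrite leq_mul.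
  by rewrite (expnD _ 3 2) mulnAC leq_mul.
apply: le_trans (ler_ln_nat (l := (d * n) ^ 5 * A) _) _.
  by rewrite mA andbT muln_gt0 N1 (ltnW m1).
have q0 : (0 < d * n)%N := ltnW q2.
have q5 : (0 < (d * n) ^ 5)%N by rewrite expn_gt0 q0.
have p4 : (0 < 4 ^ L.+1)%N by rewrite expn_gt0.
have q4 : (0 < d * n * 4 ^ L.+1)%N by rewrite muln_gt0 q0 p4.
rewrite (lnM_nat q5 A0) (lnX_nat 5 q0) (lnX_nat s q4).
rewrite (lnM_nat q0 p4) lnX_nat// -/x.
have l4 : ln 4%:R <= 3%:R :> R := @ln_nat_lt 3.
have Ll := level_bound_le; have xg := x_ge.
have Ll1 : L.+1%:R <= (C + 6) * x by rewrite -natr1; lra.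
have : L.+1%:R * ln 4%:R <= (C + 6) * x * 3%:R :> R by apply: ler_pM => //; exact: ln_ge0_nat.
have s0 : 0 <= s%:R :> R by [].
by move=> /(ler_wpM2l s0); rewrite /K1; lra.
Qed.

(** Here 60 = 30 * 2, from lambda and from [hits_bound_le]; 1 + |D| accounts for ln(1/delta), the
    third factor is [K1], and (C + 6)^s comes from the number of boxes through a point. *)
Definition walk_scale : R := 60 * (1 + `|D|) * (5 + s%:R + 3 * s%:R * (C + 6)) * (C + 6) ^+ s.

Lemma walk_lambda_le (N : nat) : (2 < N <= 4 ^ T)%N ->
  let m := (N + #|{: dyadic_box d L s}|)%N in
  walk_lambda (delta m N./2) (m * N./2) * (1 + ((d * L.+1).+1 ^ s)%:R)
  <= walk_scale * (d%:R ^+ s * x ^+ s.+1).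
Proof.
move=> /card_bound_le /=; set m := (_ * _)%N => -[m1 lnm].
set del := delta _ _; have [/andP[del0 _] lndel] := delta_bounds m1.
have m0 : 0 < m%:R :> R by rewrite ltr0n ltnW.
have lm0 : 0 <= ln m%:R :> R := ln_ge0_nat m.
have l1 : walk_lambda del m <= 30 * (1 + `|D|) * (K1 * x).
  rewrite /walk_lambda -mulrA ler_wpM2l// lnM ?posrE ?invr_gt0//.
  apply: (@le_trans _ _ ((1 + `|D|) * ln m%:R)); last by rewrite ler_wpM2l ?addr_ge0.
  by rewrite mulrDl mul1r lerD2l (le_trans lndel)// ler_wpM2r// ler_norm.
have x0 : 0 <= x by have := x_ge; lra.
have C0 : 0 <= C + 6 by have := C_ge2; lra.
have K10 : 0 <= K1 by rewrite /K1 !addr_ge0// !mulr_ge0.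
have h := hits_bound_le; have h0 : 0 <= 1 + ((d * L.+1).+1 ^ s)%:R :> R by rewrite addr_ge0.
have D0 : 0 <= 1 + `|D| by rewrite addr_ge0.
have p0 : 0 <= 30 * (1 + `|D|) * (K1 * x) by apply: mulr_ge0; apply: mulr_ge0.
apply: (@le_trans _ _ (30 * (1 + `|D|) * (K1 * x) * (2 * (C + 6) ^+ s * d%:R ^+ s * x ^+ s))).
  by apply: le_trans (ler_wpM2r h0 l1) _; rewrite ler_wpM2l.
have -> : 30 * (1 + `|D|) * (K1 * x) * (2 * (C + 6) ^+ s * d%:R ^+ s * x ^+ s) =
  60 * ((1 + `|D|) * K1 * (C + 6) ^+ s * (d%:R ^+ s * x ^+ s.+1)) by rewrite exprS; ring.
have : 0 <= (1 + `|D|) * K1 * (C + 6) ^+ s * (d%:R ^+ s * x ^+ s.+1).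
  by rewrite mulr_ge0 ?mulr_ge0 ?exprn_ge0.
rewrite /walk_scale -/K1; lra.
Qed.

(** Since 2 x >= 1. It lets the terms of order sigma_SO^2/n^2 without logarithms be absorbed. *)
Lemma scale_factor_ge : 1 <= 2 ^+ s.+1 * (d%:R ^+ s * x ^+ s.+1).
Proof.
have -> : 2 ^+ s.+1 * (d%:R ^+ s * x ^+ s.+1) = d%:R ^+ s * (2 * x) ^+ s.+1.
  by rewrite exprMn; ring.
have xg := x_ge; rewrite -[leLHS]mulr1 ler_pM// exprn_ege1// ?ler1n//.
by lra.
Qed.

End ParameterBounds.

(** * Square integrable functions and Bessel's inequality *)

Section SquareIntegrable.
Context {R : realType} (d : nat).
Local Notation pt := (@pt R d).
Local Notation Re := complex.Re.
Local Notation Im := complex.Im.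
Local Notation mu := (@unif_cube R d).
Local Notation Cube := (@cube R d).
Implicit Types (F G phi : pt -> R) (k : frequency d).

Definition sqint F : Prop :=
  measurable_fun setT F /\ mu.-integrable setT (fun x => (F x ^+ 2)%:E).

Lemma square_integrable_sqint phi : square_integrable phi -> sqint (phi \_ Cube).
Proof.
move=> phi2; split; last exact: Lfun2_integrable_sqr.
by move: phi2; rewrite /square_integrable inE => /andP[] /[!inE].
Qed.

Lemma sqint_mul F G : sqint F -> sqint G -> mu.-integrable setT (EFin \o (fun x => F x * G x)).
Proof.
move=> [mF iF] [mG iG]; have iFG := integrableD measurableT iF iG.
apply: le_integrable iFG => //.
  by apply/measurable_EFinP; exact: measurable_funM.
move=> x _ /=; rewrite lee_fin [leRHS]ger0_norm ?addr_ge0 ?sqr_ge0//.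
have := sqr_ge0 (F x - G x); have := sqr_ge0 (F x + G x).
have := sqr_ge0 (F x); have := sqr_ge0 (G x).
by rewrite ler_norml => *; apply/andP; split; lra.
Qed.

Lemma tame_sqint F : tame F -> sqint F.
Proof.
move=> tF; split; first exact: tF.1.
by have := tame_integrable (tameM tF tF).
Qed.

Lemma sqint_integrable F : sqint F -> mu.-integrable setT (EFin \o F).
Proof.
move=> F2; have := sqint_mul F2 (tame_sqint (@tame_cst R d 1)).
by apply: eq_integrable => // x _ /=; rewrite mulr1.
Qed.

Lemma sqintD F G : sqint F -> sqint G -> sqint (fun x => F x + G x).
Proof.
move=> F2 G2; split; first exact: measurable_funD F2.1 G2.1.
have iFG := sqint_mul F2 G2.
have := integrableD measurableT (integrableD measurableT F2.2 G2.2) (integrableD measurableT iFG iFG).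
by apply: eq_integrable => // x _ /=; rewrite -!EFinD; congr EFin; ring.
Qed.

Lemma sqintN F : sqint F -> sqint (fun x => - F x).
Proof.
move=> [mF iF]; split; first exact: measurableT_comp.
by apply: eq_integrable iF => // x _; rewrite sqrrN.
Qed.

Lemma sqintB F G : sqint F -> sqint G -> sqint (fun x => F x - G x).
Proof. by move=> F2 G2; exact: (sqintD F2 (sqintN G2)). Qed.

Lemma sqint_sum (I : Type) (r : seq I) (P : pred I) (F : I -> pt -> R) :
  (forall i, P i -> sqint (F i)) -> sqint (fun x => \sum_(i <- r | P i) F i x).
Proof.
move=> F2; elim: r => [|i r IH].
  by under eq_fun do rewrite big_nil; exact: (tame_sqint (@tame_cst R d 0)).
by case: (boolP (P i)) => [/[dup] Pi /F2 Fi|/negbTE Pi]; under eq_fun do rewrite big_cons Pi;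
  [exact: sqintD|].
Qed.

Definition fcoef F k : R[i] :=
  Complex (\int[mu]_x (F x * cos (phase k x))) (- \int[mu]_x (F x * sin (phase k x))).

Lemma fourier_coefE phi k : fourier_coef phi k = fcoef (phi \_ Cube) k.
Proof.
rewrite /fourier_coef /fcoef /cube_integral.
by congr (Complex _ (- _)); rewrite Rintegral_mkcond; apply: eq_Rintegral => x _;
  rewrite !patchE; case: ifP; rewrite ?mul0r.
Qed.

Lemma tame_cos k : tame (fun x : pt => cos (phase k x)).
Proof.
have := tame_Re_expi (1 : R[i]) k; congr tame.
by apply/funext => x; rewrite mul1r.
Qed.

Lemma tame_sin k : tame (fun x : pt => sin (phase k x)).
Proof.
have := tame_Re_expi (Complex 0 (-1) : R[i]) k; congr tame.
by apply/funext => x; rewrite Re_mul_expi /= /phase; ring.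
Qed.

Lemma fcoefD F G k : sqint F -> sqint G -> fcoef (fun x => F x + G x) k = fcoef F k + fcoef G k.
Proof.
move=> F2 G2; have c2 := tame_sqint (tame_cos k); have s2 := tame_sqint (tame_sin k).
rewrite /fcoef; under eq_Rintegral do rewrite mulrDl.
rewrite RintegralD//; [|exact: sqint_mul|exact: sqint_mul].
under [X in Complex _ (- X)]eq_Rintegral do rewrite mulrDl.
rewrite RintegralD//; [|exact: sqint_mul|exact: sqint_mul].
by rewrite opprD.
Qed.

Lemma fcoef0 k : fcoef (fun=> 0) k = 0.
Proof.
rewrite /fcoef; under eq_Rintegral do rewrite mul0r.
under [X in Complex _ (- X)]eq_Rintegral do rewrite mul0r.
by rewrite /Rintegral integral0 /= oppr0.
Qed.

Lemma fcoef_sum (I : Type) (r : seq I) (P : pred I) (F : I -> pt -> R) k :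
  (forall i, P i -> sqint (F i)) ->
  fcoef (fun x => \sum_(i <- r | P i) F i x) k = \sum_(i <- r | P i) fcoef (F i) k.
Proof.
move=> F2; elim: r => [|i r IH].
  by under eq_fun do rewrite big_nil; rewrite big_nil fcoef0.
under eq_fun do rewrite big_cons; rewrite big_cons; case: ifPn => // Pi.
by rewrite fcoefD ?IH//; [exact: F2|exact: sqint_sum].
Qed.

Lemma integral_mul_mode F k (c : R[i]) : sqint F ->
  \int[mu]_x (F x * Re (c * expi (dotk k x))) =
  Re c * Re (fcoef F k) + Im c * Im (fcoef F k).
Proof.
move=> F2; have ic := sqint_mul F2 (tame_sqint (tame_cos k)).
have si := sqint_mul F2 (tame_sqint (tame_sin k)).
transitivity (\int[mu]_x (Re c * (F x * cos (phase k x)) + (- Im c) * (F x * sin (phase k x)))).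
  by apply: eq_Rintegral => x _; rewrite Re_mul_expi /phase; ring.
rewrite RintegralD//; first by rewrite !RintegralZl//= mulrN mulNr.
- by have := integrableZl measurableT (Re c) ic.
- by have := integrableZl measurableT (- Im c) si.
Qed.

Lemma integral_mul_trig (X : finType) (kappa : X -> frequency d) (a : X -> R[i]) F : sqint F ->
  \int[mu]_x (F x * trig kappa a x) =
  \sum_i (Re (a i) * Re (fcoef F (kappa i)) + Im (a i) * Im (fcoef F (kappa i))).
Proof.
move=> F2; under [RHS]eq_bigr do rewrite -integral_mul_mode//.
rewrite /trig; under eq_Rintegral do rewrite mulr_sumr.
have it i : sqint (fun x => Re (a i * expi (dotk (kappa i) x))) := tame_sqint (tame_Re_expi _ _).
elim: (index_enum X) => [|i r IH].
  by under eq_Rintegral do rewrite big_nil; rewrite big_nil /Rintegral integral0.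
under eq_Rintegral do rewrite big_cons.
rewrite RintegralD ?big_cons ?IH//; first exact: sqint_mul.
have := sqint_mul F2 (sqint_sum r (P := xpredT) (fun i _ => it i)).
by apply: eq_integrable => // x _ /=; rewrite mulr_sumr.
Qed.

(** Moving by half a period in the coordinate j fixes phi and negates the mode, so the integral
    equals its own negative. *)
Lemma fcoef_depends_only_on (u : {set 'I_d}) phi k j :
  square_integrable phi -> depends_only_on u phi -> j \notin u -> k j != 0 ->
  fcoef (phi \_ Cube) k = 0.
Proof.
move=> /square_integrable_sqint F2 dep ju kj; set F := phi \_ Cube in F2 *.
have zero c : \int[mu]_x (F x * Re (c * expi (dotk k x))) = 0.
  pose G x := F x * Re (c * expi (dotk k x)).
  have mG : measurable_fun setT G.
    by apply: measurable_funM; [exact: F2.1|exact: (tame_Re_expi c k).1].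
  pose z : pt := [tuple 0 | i < d].
  have e1 := Rintegral_cshift (half_period k j) mG.
  have e2 := Rintegral_cshift z mG.
  have iG : mu.-integrable setT (EFin \o G).
    exact: (sqint_mul F2 (tame_sqint (tame_Re_expi c k))).
  (* [dep] speaks of points of the cube only, so the unshifted point is folded too, by the zero
     shift z. *)
  have opp x : G (cshift (half_period k j) x) = -1 * G (cshift z x).
    rewrite /G expi_half_period// expi_cshift (_ : dotk k z = 0) ?expi0 ?mulr1; last first.
      by rewrite /dotk big1// => i _; rewrite /coordinate tnth_mktuple mulr0.
    rewrite mulrN (_ : Re (- _) = - Re (c * expi (dotk k x))); last by case: (c * _).
    rewrite mulrN mulN1r /F !patchE !mem_set; [|exact: cube_cshift|exact: cube_cshift].
    congr (- (_ * _)); apply: dep; [exact: cube_cshift|exact: cube_cshift|move=> i iu].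
    rewrite /coordinate !tnth_mktuple; case: eqP => // ij.
    by move: ju; rewrite -ij iu.
  have mGz : measurable_fun setT (fun x => G (cshift z x)).
    by apply: (measurableT_comp mG); exact: measurable_cshift.
  have iGz : mu.-integrable setT (EFin \o (fun x => G (cshift z x))).
    apply/integrableP; split; first exact/measurable_EFinP.
    have mGn : measurable_fun setT (fun x => `|(G x)%:E|%E).
      by apply: measurableT_comp => //; exact/measurable_EFinP.
    by rewrite (integral_cshift z mGn); have /integrableP[] := iG.
  move: e1; under eq_Rintegral do rewrite opp.
  by rewrite RintegralZl// e2 -/G; move: (Rintegral _ _ _) => v; lra.
have := zero 1; have := zero (Complex 0 1); rewrite !integral_mul_mode//=.
by rewrite /fcoef => h1 h2; congr Complex; lra.
Qed.

Lemma fcoef_low_order s (h : pt -> R) k : low_order s h -> ~~ order_at_most s k ->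
  fcoef (h \_ Cube) k = 0.
Proof.
move=> [fu [fu2 hE]] kord.
have -> : h \_ Cube = fun x => \sum_(u : {set 'I_d} | (#|u| <= s)%N) (fu u \_ Cube) x.
  apply/funext => x; rewrite patchE; case: ifPn => [/[!inE] xc|xc].
    by rewrite hE//; apply: eq_bigr => u _; rewrite patchE mem_set.
  by rewrite big1// => u _; rewrite patchE (negbTE xc).
rewrite fcoef_sum; last by move=> u /fu2[/square_integrable_sqint].
apply: big1 => u us; have [u2 udep] := fu2 u us.
have [j kj ju] : exists2 j, k j != 0 & j \notin u.
  move: kord; rewrite /order_at_most -ltnNge => kord.
  have /fintype.subsetPn[j] : ~~ ([set j | k j != 0]%SET \subset u).
    by apply: contraL kord => /subset_leq_card ku; rewrite -leqNgt (leq_trans ku).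
  by rewrite finset.inE => kj ju; exists j.
exact: (fcoef_depends_only_on u2 udep ju kj).
Qed.

End SquareIntegrable.

(** * Bessel's inequality and truncation of the Fourier series *)

Section Reduction.
Context {R : realType} (d : nat).
Local Notation pt := (@pt R d).
Local Notation Re := complex.Re.
Local Notation Im := complex.Im.
Local Notation mu := (@unif_cube R d).
Local Notation Cube := (@cube R d).
Implicit Types F G : pt -> R.

Let ip F G : R := \int[mu]_x (F x * G x).

Let ipC F G : ip F G = ip G F.
Proof. by apply: eq_Rintegral => x _; rewrite mulrC. Qed.

Let ipBl F G H : sqint F -> sqint G -> sqint H -> ip (fun x => F x - G x) H = ip F H - ip G H.
Proof.
move=> F2 G2 H2; rewrite /ip; under eq_Rintegral do rewrite mulrBl.
by rewrite RintegralB//; exact: sqint_mul.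
Qed.

Let ipBr F G H : sqint F -> sqint G -> sqint H -> ip H (fun x => F x - G x) = ip H F - ip H G.
Proof. by move=> *; rewrite ipC ipBl// ipC (ipC G). Qed.

Let ip_cst F (c : R) : sqint F -> ip F (fun=> c) = c * \int[mu]_x F x.
Proof.
move=> F2; rewrite /ip; under eq_Rintegral do rewrite mulrC.
by rewrite RintegralZl//; exact: sqint_integrable.
Qed.

Let int_cst (c : R) : \int[mu]_x c = c.
Proof. by rewrite /Rintegral integral_prob_cst. Qed.

Section Bessel.
Context {X : finType} (kappa : X -> frequency d) (a : X -> R[i]).
Hypothesis kappa_inj : injective kappa.

Lemma trig_sqr_Rintegral : \int[mu]_x (trig kappa a x ^+ 2) <= \sum_i normsq (a i).
Proof.
have it := (tame_sqint (tame_trig kappa a)).2.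
by rewrite -lee_fin /Rintegral fineK ?trig_sqr_integral//; exact: integrable_fin_num.
Qed.

(** Expand 0 <= |F - m - P|^2 with P the polynomial: <F,P> = q, <P,P> <= q and P has mean zero.
    Removing the mean m leaves the variance on the right. *)
Lemma bessel F : sqint F ->
  (forall i, a i = 0 \/ kappa i != [ffun=> 0] /\ a i = fcoef F (kappa i)) ->
  \sum_i normsq (a i) <= \int[mu]_x (F x ^+ 2) - (\int[mu]_x F x) ^+ 2.
Proof.
move=> F2 aE; set m := \int[mu]_x F x; set q := \sum_i _; set P := trig kappa a.
have P2 : sqint P := tame_sqint (tame_trig kappa a).
have m2 c : sqint (fun=> c) := tame_sqint (@tame_cst R d c).
have PF : ip F P = q.
  rewrite /ip integral_mul_trig//; apply: eq_bigr => i _.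
  by case: (aE i) => [->|[_ <-]]; [rewrite normsq0 /= !mul0r addr0|rewrite /normsq !expr2].
have P0 : \int[mu]_x P x = 0.
  rewrite /P /trig Rintegral_tame_sum; last by move=> i; exact: tame_Re_expi.
  apply: big1 => i _; case: (aE i) => [->|[k0 _]]; last exact: integral_mode.
  by under eq_Rintegral do rewrite mul0r; rewrite int_cst.
have PP : ip P P <= q.
  have := trig_sqr_Rintegral; rewrite /ip; apply: le_trans.
  by rewrite le_eqVlt; apply/orP; left; apply/eqP; apply: eq_Rintegral => x _; rewrite expr2.
have mm : ip (fun=> m) (fun=> m) = m * m by rewrite ip_cst// int_cst.
have Fm : ip F (fun=> m) = m * m by rewrite ip_cst.
have Pm : ip P (fun=> m) = 0 by rewrite ip_cst// P0 mulr0.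
have FF : \int[mu]_x (F x ^+ 2) = ip F F by apply: eq_Rintegral => x _; rewrite expr2.
have Fm2 : sqint (fun x => F x - m) := sqintB F2 (m2 m).
have u0 : 0 <= ip (fun x => F x - m - P x) (fun x => F x - m - P x).
  by apply: Rintegral_ge0 => x _; rewrite -expr2 sqr_ge0.
have Fu G : sqint G -> ip G (fun x => F x - m - P x) = ip G F - ip G (fun=> m) - ip G P.
  by move=> G2; rewrite ipBr// ipBr.
move: u0; rewrite ipBl//; last exact: sqintB.
rewrite (ipBl F2 (m2 m) (sqintB Fm2 P2)) !Fu// FF (ipC (fun=> m) F) (ipC (fun=> m) P) (ipC P F).
rewrite mm Fm Pm PF expr2; move: PP; lra.
Qed.

Lemma sum_le_sigma_SO2 (h : pt -> R) :
  (forall i, a i = 0 \/ kappa i != [ffun=> 0] /\ a i = fourier_coef h (kappa i)) ->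
  ((\sum_i normsq (a i) * weight (kappa i))%:E <= sigma_SO2 h)%E.
Proof.
move=> aE; apply: esum_ge.
pose r := [seq kappa i | i <- enum X & kappa i != [ffun=> 0]].
have ur : uniq r by rewrite map_inj_uniq// filter_uniq// enum_uniq.
exists [set` r].
  split; first exact: finite_seq.
  have /allP r0 : all (fun k => k != [ffun=> 0]) r.
    by rewrite all_map; apply/allP => i; rewrite mem_filter => /andP[].
  by move=> k; exact: r0.
rewrite -fsbig_seq// big_map big_filter big_enum_cond sumEFin lee_fin.
have -> : \sum_i normsq (a i) * weight (kappa i) =
    \sum_(i | kappa i != [ffun=> 0]) normsq (a i) * weight (kappa i).
  rewrite (bigID (fun i => kappa i != [ffun=> 0]))/= [X in _ + X]big1 ?addr0// => i ki.
  by case: (aE i) => [->|[]]; [rewrite normsq0 mul0r|rewrite (negbTE ki)].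
apply: ler_sum => i ki; rewrite -/(weight _) normc_sqr ler_wpM2r ?weight_ge0//.
by case: (aE i) => [->|[_ ->]]//; rewrite normsq0 normsq_ge0.
Qed.

End Bessel.

Section Truncation.
Variable N : nat.
Local Notation X := {ffun 'I_d -> 'I_(N.*2.+1)}.

Definition box_freq (l : X) : frequency d := [ffun j => (l j)%:Z - N%:Z].

Lemma box_freq_inj : injective box_freq.
Proof.
move=> l l' ll'; apply/ffunP => j; apply/val_inj.
have := congr1 (fun k : frequency d => k j) ll'; rewrite !ffunE /=.
by move/addIr => [].
Qed.

(** The zero frequency is removed: constants do not change [err], and the polynomial then has mean
    zero, as the weights and Bessel's inequality require. *)
Definition truncation F (l : X) : R[i] :=
  if box_freq l == [ffun=> 0] then 0 else fcoef F (box_freq l).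

Lemma truncationE F l :
  truncation F l = 0 \/ box_freq l != [ffun=> 0] /\ truncation F l = fcoef F (box_freq l).
Proof. by rewrite /truncation; case: eqP => h; [left|right]. Qed.

Lemma Re_partial_sum f x :
  Re (fourier_partial_sum f N x) =
  cube_integral f + trig box_freq (truncation (f \_ Cube)) x.
Proof.
have -> : Re (fourier_partial_sum f N x) =
    \sum_(l : X) Re (fcoef (f \_ Cube) (box_freq l) * fourier_mode (box_freq l) x).
  by rewrite Re_sum; apply: eq_bigr => l _; rewrite -fourier_coefE.
have l0P : (N < N.*2.+1)%N by rewrite ltnS -addnn leq_addr.
pose l0 : X := [ffun=> Ordinal l0P].
have l0E : box_freq l0 = [ffun=> 0] by apply/ffunP => j; rewrite !ffunE subrr.
have k0 (y : pt) : phase ([ffun=> 0] : frequency d) y = 0.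
  by rewrite /phase big1 ?mulr0// => j _; rewrite ffunE mul0r.
have t0 : truncation (f \_ Cube) l0 = 0 by rewrite /truncation l0E eqxx.
have -> : trig box_freq (truncation (f \_ Cube)) x =
    \sum_(l | l != l0) Re (truncation (f \_ Cube) l * expi (dotk (box_freq l) x)).
  by rewrite /trig (bigD1 l0)// t0 mul0r; exact: add0r.
rewrite (bigD1 l0)// l0E; congr (_ + _).
  rewrite /fourier_mode k0 cos0 sin0 /= !mulr0 subr0 mulr1 /cube_integral [RHS]Rintegral_mkcond.
  by apply: eq_Rintegral => y _; rewrite k0 cos0 mulr1.
apply: eq_bigr => l ll0; rewrite fourier_modeE /truncation ifN//.
by rewrite -l0E; apply: contra ll0 => /eqP /box_freq_inj ->.
Qed.

Section Transference.
Variables (s T : nat) (C D : R) (delta : nat -> nat -> R) (f g h : pt -> R).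
Local Notation n := (2 ^ T)%N.
Local Notation x0 := (ln (d * n)%:R : R).

Hypotheses (C_ge2 : 2 <= C) (d_gt0 : (0 < d)%N) (T_gt0 : (0 < T)%N).
Hypothesis delta_bounds : forall m N : nat, (1 < m * N)%N ->
   0 < delta m N <= 2^-1 /\ ln (delta m N)^-1 <= D * ln (m * N)%:R.
Hypotheses (f2 : square_integrable f) (g2 : square_integrable g) (h_low : low_order s h)
  (fgh : forall x, cube x -> f x = g x + h x).

Let F := f \_ Cube.
Let G := g \_ Cube.
Let H := h \_ Cube.
Let F2 : sqint F := square_integrable_sqint f2.
Let G2 : sqint G := square_integrable_sqint g2.

Let FE : F = fun x => G x + H x.
Proof.
apply/funext => x; rewrite /F /G /H !patchE; case: ifPn => [/[!inE] /fgh//|_].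
by rewrite addr0.
Qed.

Let H2 : sqint H.
Proof.
have -> : H = fun x => F x - G x by apply/funext => x; rewrite FE addrC addKr.
exact: sqintB.
Qed.

Let af := truncation F.
Let ag := truncation G.
Let ah := truncation H.

Let afE l : af l = ag l + ah l.
Proof.
rewrite /af /ag /ah /truncation; case: ifP => _; first by rewrite addr0.
by rewrite FE fcoefD.
Qed.

Let ah_low l : ah l = 0 \/ (order_at_most s (box_freq l) /\ box_freq l != [ffun=> 0]).
Proof.
rewrite /ah; case: (truncationE H l) => [->|[l0 hl]]; first by left.
case: (boolP (order_at_most s (box_freq l))) => hs; [by right|left].
by rewrite hl (fcoef_low_order h_low hs).
Qed.

Let trig_split x : trig box_freq af x = trig box_freq ag x + trig box_freq ah x.
Proof.
rewrite /trig -big_split; apply: eq_bigr => l _ /=; rewrite afE mulrDl.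
by case: (ag l * _) => ? ?; case: (ah l * _).
Qed.

Let m := cube_integral f.

Let mE : m = \int[mu]_x F x. Proof. exact: Rintegral_mkcond. Qed.

Let sigma2E : sigma2 g = \int[mu]_x (G x ^+ 2) - (\int[mu]_x G x) ^+ 2.
Proof.
rewrite /sigma2 /cube_integral; congr (_ - _ ^+ 2); rewrite Rintegral_mkcond//.
by apply: eq_Rintegral => x _; rewrite /G !patchE; case: ifP => // _; rewrite expr0n.
Qed.

Lemma sigma2_ge0 : 0 <= sigma2 g.
Proof.
rewrite sigma2E; apply: le_trans (bessel box_freq_inj G2 (truncationE G)).
by apply: sumr_ge0 => i _; exact: normsq_ge0.
Qed.

Local Open Scope ereal_scope.

Let eps : \bar R := \int[mu]_(x in Cube)
  (Normc.normc ((f x)%:C%C - fourier_partial_sum f N x) ^+ 2)%:E.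

(* The polynomial with the coefficients of g, plus f minus its partial sum; it takes
   the place of g in [mean_square_trig]. *)
Let remainder x : R := (F x - m - trig box_freq ah x)%R.

Let remainder_sqint : sqint remainder.
Proof.
apply: sqintB; last exact: tame_sqint (tame_trig _ _).
exact: sqintB F2 (tame_sqint (@tame_cst R d m)).
Qed.

Let int_remainder : \int[mu]_x (remainder x ^+ 2)%:E <= (2 * sigma2 g)%:E + 2%:E * eps.
Proof.
pose P := trig box_freq ag; pose r x := (F x - m - trig box_freq af x)%R.
have rE x : remainder x = (P x + r x)%R by rewrite /remainder /r trig_split -/P; ring.
have mP : measurable_fun setT P := (tame_trig _ _).1.
have mr : measurable_fun setT r.
  by apply: measurable_funB; [apply: measurable_funB => //; exact: F2.1|exact: (tame_trig _ _).1].
have iP : \int[mu]_x (P x ^+ 2)%:E <= (sigma2 g)%:E.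
  apply: (le_trans (trig_sqr_integral box_freq_inj ag)); rewrite lee_fin sigma2E.
  exact: (bessel box_freq_inj G2 (truncationE G)).
have ir : \int[mu]_x (r x ^+ 2)%:E <= eps.
  rewrite -integral_cube; last exact/measurable_EFinP/measurable_funX.
  apply: ge0_le_integral_nonmeasurable => x xc; first by rewrite lee_fin sqr_ge0.
  rewrite lee_fin normc_sqr /normsq (_ : r x = Re ((f x)%:C%C - fourier_partial_sum f N x)%R).
    by rewrite lerDl sqr_ge0.
  rewrite (_ : Re _ = f x - Re (fourier_partial_sum f N x))%R; last by case: fourier_partial_sum.
  by rewrite Re_partial_sum /r /F patchE mem_set// -/m; ring.
apply: (@le_trans _ _ (2%:E * \int[mu]_x (P x ^+ 2)%:E + 2%:E * \int[mu]_x (r x ^+ 2)%:E)); last first.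
  by rewrite EFinM; apply: leeD; apply: lee_wpmul2l.
rewrite -!ge0_integralZl//=.
- rewrite -ge0_integralD//=.
  + apply: ge0_le_integral_nonmeasurable => x _; rewrite ?lee_fin ?sqr_ge0//.
    by rewrite rE; have := sqr_ge0 (P x - r x)%R; lra.
  + by move=> x _; rewrite -EFinM lee_fin mulr_ge0// sqr_ge0.
  + by apply: measurable_funeM; apply/measurable_EFinP/measurable_funX.
  + by move=> x _; rewrite -EFinM lee_fin mulr_ge0// sqr_ge0.
  + by apply: measurable_funeM; apply/measurable_EFinP/measurable_funX.
- by apply/measurable_EFinP/measurable_funX.
- by move=> x _; rewrite lee_fin sqr_ge0.
- by apply/measurable_EFinP/measurable_funX.
- by move=> x _; rewrite lee_fin sqr_ge0.
Qed.

(** [mean_square_trig] with [remainder] as g and the truncation of h as polynomial: 36 = 18 * 2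
    comes from splitting the remainder, and 258 becomes 258 * 2^(s+1) through [scale_factor_ge]. *)
Lemma mean_square_truncated (i : 'I_n) :
  mean_square_err C s delta i f <=
  (36 / n%:R * sigma2 g)%:E
  + ((258 * 2 ^+ s.+1 + 16 * 80 ^+ s * walk_scale C D s)
     * (d%:R ^+ s * x0 ^+ s.+1 / n%:R ^+ 2))%:E * sigma_SO2 h
  + (36 / n%:R)%:E * eps.
Proof.
set y := (d%:R ^+ s * x0 ^+ s.+1)%R; set W := walk_scale C D s; set Lam := (W * y)%R.
have db m' N' : (1 < m' * N')%N -> (0 < delta m' N' <= 2^-1)%R by move=> /delta_bounds[].
have y_ge : (1 <= 2 ^+ s.+1 * y)%R := scale_factor_ge s d_gt0 T_gt0.
have y0 : (0 <= y)%R by rewrite -(pmulr_rge0 _ (exprn_gt0 s.+1 (ltr0Sn R 1))) (le_trans ler01).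
have W0 : (0 <= W)%R.
  rewrite /W /walk_scale !mulr_ge0 ?exprn_ge0 ?addr_ge0 ?mulr_ge0//; have := C_ge2; lra.
have Lam0 : (0 <= Lam)%R by rewrite mulr_ge0.
have decomp x : cube x -> (f x - cube_integral f = remainder x + trig box_freq ah x)%R.
  by move=> xc; rewrite /remainder subrK /F patchE mem_set.
have FmE : (fun x => remainder x + trig box_freq ah x)%R = (fun x => F x - m)%R.
  by apply/funext => x; rewrite /remainder subrK.
have Fm2 : sqint (fun x => F x - m)%R := sqintB F2 (tame_sqint (@tame_cst R d m)).
have n0 : (0 < n%:R :> R)%R by rewrite ltr0n expn_gt0.
have gh_sqr : mu.-integrable setT (fun x => ((remainder x + trig box_freq ah x) ^+ 2)%:E).
  by have := Fm2.2; apply: eq_integrable => // x _; rewrite /remainder subrK.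
have gh_int : mu.-integrable setT (fun x => (remainder x + trig box_freq ah x)%:E).
  by have := sqint_integrable Fm2; apply: eq_integrable => // x _; rewrite /= /remainder subrK.
have gh_mean : \int[mu]_x (remainder x + trig box_freq ah x)%:E = 0.
  have := integrable_fin_num measurableT gh_int => /fineK <-; congr EFin.
  rewrite -/(Rintegral _ _ _) FmE RintegralB//; last 2 first.
  - exact: sqint_integrable.
  - exact: sqint_integrable (tame_sqint (@tame_cst R d m)).
  by rewrite -mE int_cst subrr.
have := mean_square_trig db box_freq_inj ah_low decomp Lam0
  (walk_lambda_le s C_ge2 d_gt0 T_gt0 delta_bounds) remainder_sqint.1 gh_sqr gh_int gh_mean i
  (level_bound_scale C_ge2 d_gt0 T_gt0).
move=> /le_trans; apply.
have S_le : ((\sum_l normsq (ah l) * weight (box_freq l))%:E <= sigma_SO2 h).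
  apply: (sum_le_sigma_SO2 box_freq_inj) => l.
  by rewrite fourier_coefE; exact: truncationE.
set Sg := (\sum_l _)%R in S_le *.
have Sg0 : (0 <= Sg)%R by apply: sumr_ge0 => l _; rewrite mulr_ge0 ?normsq_ge0 ?weight_ge0.
have c18 : (0 <= 18 / n%:R :> R)%R by rewrite divr_ge0// ltW.
have eps0 : 0 <= eps by apply: integral_ge0 => x _; rewrite lee_fin sqr_ge0.
rewrite addeAC; apply: leeD.
  apply: (le_trans (lee_wpmul2l _ int_remainder)); first by rewrite lee_fin.
  rewrite ge0_muleDr ?mule_ge0 ?lee_fin ?mulr_ge0 ?sigma2_ge0// muleA -!EFinM.
  have -> : (18 / n%:R * (2 * sigma2 g) = 36 / n%:R * sigma2 g)%R by ring.
  by have -> : (18 / n%:R * 2 = 36 / n%:R :> R)%R by ring.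
set K := (258 * _ + _)%R.
have K0 : (0 <= K)%R.
  apply: addr_ge0; first exact: (mulr_ge0 (ler0n R 258) (exprn_ge0 _ (ler0n R 2))).
  exact: (mulr_ge0 (mulr_ge0 (ler0n R 16) (exprn_ge0 s (ler0n R 80))) W0).
apply: le_trans (lee_wpmul2l _ S_le); last first.
  rewrite lee_fin; apply: (mulr_ge0 K0); apply: (mulr_ge0 y0).
  by rewrite invr_ge0 exprn_ge0// ltW.
rewrite -EFinM lee_fin ler_wpM2r// mulrA ler_wpM2r ?invr_ge0 ?exprn_ge0 ?(ltW n0)//.
by rewrite /K /Lam; lra.
Qed.

End Transference.

End Truncation.

End Reduction.

Theorem theorem3p3 (R : realType) :
  exists C0 : R, forall C : R, C0 <= C ->
  forall (s : nat) (D : R), (1 <= s)%N ->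
  exists2 K : R, 0 < K &
  forall (d n : nat), (1 <= d)%N -> (s <= d)%N ->
    (2 <= n)%N -> (exists T : nat, n = (2 ^ T)%N) ->
  forall delta : nat -> nat -> R,
    (forall m N : nat, (1 < m * N)%N ->
       0 < delta m N <= 2^-1 /\ ln (delta m N)^-1 <= D * ln (m * N)%:R) ->
  forall (i : 'I_n) (f : pt d -> R), fourier_decomposable f ->
    (mean_square_err C s delta i f <= K%:E * decomposition_bound s n f)%E.
Proof.
(* C >= 2 makes 2^L >= n. The constant has to absorb A and 72 = 36 * 2, where the 2 comes from 1 <=
   2 ln n. *)
exists 2 => C C2 s D _; pose A : R := 258 * 2 ^+ s.+1 + 16 * 80 ^+ s * walk_scale C D s.
exists (72 + `|A|); first exact: (ltr_wpDr (normr_ge0 A) (ltr0Sn R 71)).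
move=> d n d0 _ n2 [T nE]; rewrite nE in n2 *; have T0 : (0 < T)%N by case: (T) n2.
move=> delta delta_bounds i f [f2 f_lim].
have K0 : 0 < 72 + `|A| := ltr_wpDr (normr_ge0 A) (ltr0Sn R 71).
(* Dividing by the constant turns the claim into a lower bound for an infimum, to be checked on each
   decomposition. *)
rewrite -lee_pdivrMl//; apply: le_ereal_inf_tmp => _ [g [h [g2 h_low fgh ->]]].
rewrite lee_pdivrMl//; set n' : R := (2 ^ T)%:R; set y : R := _ / n' ^+ 2.
have n0 : 0 < n' by rewrite ltr0n expn_gt0.
(* The 0 is an arbitrary truncation order: the variance is nonnegative by Bessel's inequality at any
   order. *)
have sg := sigma2_ge0 0 g2.
have lnn : 1 <= 2 * ln n' :> R.
  have := @ln2_ge_half R; have : ln 2%:R <= ln n' :> R.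
    by apply: ler_ln_nat; exact: n2.
  by lra.
have y0 : 0 <= y by rewrite divr_ge0 ?mulr_ge0 ?exprn_ge0 ?ln_ge0_nat// ltW.
have so0 : (0 <= sigma_SO2 h)%E.
  apply: esum_ge0 => k _; rewrite lee_fin mulr_ge0 ?sqr_ge0//.
  exact: (weight_ge0 k).
apply: (@le_trans _ _ ((36 / n' * sigma2 g)%:E + (A * y)%:E * sigma_SO2 h)%E); last first.
  have l0 : 0 <= ln n' by lra.
  have b1 : 0 <= ln n' / n' * sigma2 g by rewrite mulr_ge0// divr_ge0// ltW.
  have b2 : (0 <= y%:E * sigma_SO2 h)%E by rewrite mule_ge0// lee_fin.
  rewrite ge0_muleDr ?lee_fin//.
  apply: leeD.
    rewrite -EFinM lee_fin mulrA ler_wpM2r//.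
    have -> : 36 / n' = 36 * n'^-1 * 1 by rewrite mulr1.
    have i0 : 0 <= n'^-1 by rewrite invr_ge0 ltW.
    have := normr_ge0 A; have := ler_wpM2l i0 lnn; nra.
  rewrite muleA -EFinM lee_wpmul2r// lee_fin ler_wpM2r//.
  have := ler_norm A; lra.
pose eps N : \bar R := (\int[unif_cube d]_(x in @cube R d)
  (Normc.normc ((f x)%:C%C - fourier_partial_sum f N x) ^+ 2)%:E)%E.
have lim_eps : ((36 / n' * sigma2 g)%:E + (A * y)%:E * sigma_SO2 h + (36 / n')%:E * eps N
    @[N --> \oo] --> (36 / n' * sigma2 g)%:E + (A * y)%:E * sigma_SO2 h + (36 / n')%:E * 0)%E.
  (* The vanishing term has the finite limit 0, so the sum of the limits is defined even if
     [sigma_SO2 h] is infinite. *)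
  apply: cvgeD; [|exact: cvg_cst|exact: cvgeZl].
  by rewrite mule0 fin_num_adde_defl.
rewrite -[leRHS]adde0 -[X in (_ + X)%E](mule0 (36 / n')%:E).
apply: (cvge_to_ge lim_eps); apply: nearW => N.
exact: (mean_square_truncated N C2 d0 T0 delta_bounds f2 g2 h_low fgh i).
Qed.
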